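(* Let $F_n$ be the free group with free generators $a_1,\dots,a_n$, let $c\in\mathrm{CO}(F_n)$, and let $\rho$ be the dynamical realization of $c$. The order $c$ is isolated (i.e. an isolated point of $\mathrm{CO}(F_n)$) if and only if there exist pairwise disjoint sets $D(s)\subset S^1$, one for every $s\in\{a_1^{\pm1},\dots,a_n^{\pm1}\}$, each consisting of a finite union of closed intervals, such that $$\rho(s)\big(S^1\setminus D(s^{-1})\big)\subset D(s)$$ holds for all $s\in\{a_1^{\pm1},\dots,a_n^{\pm1}\}$, and the basepoint of $\rho$ is in the complement of the union of the sets $D(s)$.
   Context: $\mathrm{Homeo}_+(S^1)$ is the group of orientation-preserving homeomorphisms of the circle. $\mathrm{ord}:(S^1)^3\to\{\pm1,0\}$ is the orientation cocycle: $\mathrm{ord}(x,y,z)=1$ (resp. $-1$) if $x,y,z$ are distinct and occur in counterclockwise (resp. clockwise) order, and $0$ if two of the points agree. A circular order on a group $G$ is a map $c:G^3\to\{\pm1,0\}$ such that (i) $c(g_1,g_2,g_3)=0$ iff $g_i=g_j$ for some $i\ne j$; (ii) $c(g_2,g_3,g_4)-c(g_1,g_3,g_4)+c(g_1,g_2,g_4)-c(g_1,g_2,g_3)=0$ for all $g_1,\dots,g_4$; (iii) $c(u,v,w)=1$ implies $c(gu,gv,gw)=1$ for all $g,u,v,w\in G$. $\mathrm{CO}(G)$ is the set of circular orders on $G$ with the subspace topology from the product $\{\pm1,0\}^{G\times G\times G}$. Dynamical realization. Let $G$ be countable with circular order $c$, and enumerate $G=\{g_1,g_2,\dots\}$. Define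 $\iota:G\to S^1$ inductively: $\iota(g_1),\iota(g_2)$ are arbitrary distinct points, and $\iota(g_n)$ is the midpoint of the unique connected component of $S^1\setminus\{\iota(g_1),\dots,\iota(g_{n-1})\}$ such that $c(g_i,g_j,g_k)=\mathrm{ord}(\iota(g_i),\iota(g_j),\iota(g_k))$ for all $i,j,k\le n$. The left action of $G$ on itself gives an order-preserving action on $\iota(G)$, which extends to the closure of $\iota(G)$ by homeomorphisms, and then to $S^1$ by permuting the complementary intervals of the closure by affine maps; call the result $\phi_\iota:G\to\mathrm{Homeo}_+(S^1)$. A dynamical realization of $c$ is any homomorphism $h\circ\phi_\iota\circ h^{-1}$, where $\iota:G\to S^1$ is an embedding obtained by the inductive midpoint construction from some enumeration of $G$ and some distinct points $\iota(g_1),\iota(g_2)$, and $h\in\mathrm{Homeo}_+(S^1)$; its basepoint is $h(\iota(\mathrm{id}))$. All dynamical realizations of $c$ are conjugate in $\mathrm{Homeo}_+(S^1)$, so one speaks of ''the'' dynamical realization. *)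

(* Defs.v *)
(* The circle is R/Z, with the quotient topology and the orientation given by
   the usual order of R. *)
From HB Require Import structures.
From mathcomp Require Import all_boot all_order all_algebra.
From mathcomp Require Import generic_quotient.
From mathcomp Require Import all_classical all_reals all_analysis.

Set Implicit Arguments.
Unset Strict Implicit.
Unset Printing Implicit Defensive.

Import Order.TTheory GRing.Theory Num.Theory.
Import numFieldNormedType.Exports.

Local Open Scope classical_set_scope.
Local Open Scope ring_scope.
Local Open Scope quotient_scope.

(* (i, false) stands for a_i and (i, true) for a_i^-1. *)
Notation letter n := ('I_n * bool)%type.

Section FreeGroup.
Variable n : nat.
Local Notation letter := (letter n).

Definition letter_inv (s : letter) : letter := (s.1, ~~ s.2).

Lemma letter_invK : involutive letter_inv.
Proof. by case=> i b; rewrite /letter_inv /= negbK. Qed.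

Definition reduced (w : seq letter) : bool :=
  sorted (fun s t => t != letter_inv s) w.

Record free_group : Type := FreeGroup { word : seq letter; _ : reduced word }.
HB.instance Definition _ := [isSub for word].
HB.instance Definition _ := [Countable of free_group by <:].

(* The reduced form of s :: w, for w reduced. *)
Definition push (s : letter) (w : seq letter) : seq letter :=
  if w is t :: w' then (if t == letter_inv s then w' else s :: w) else [:: s].

Lemma reduced_push s w : reduced w -> reduced (push s w).
Proof.
case: w => [|t w] //= rw; case: ifPn => [_|ts]; last by rewrite /= ts.
exact: path_sorted rw.
Qed.

Lemma pushK s w : reduced w -> push s (push (letter_inv s) w) = w.
Proof.
case: w => [|t w] rw /=; first by rewrite eqxx.
rewrite letter_invK; case: eqP => [ts|_]; last by rewrite /= eqxx.
by move: rw; rewrite ts; case: w => [|u w] //= /andP[/negPf->].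
Qed.

Lemma reduced_foldr_push u v : reduced v -> reduced (foldr push v u).
Proof. by move=> rv; elim: u => //= s u; exact: reduced_push. Qed.

Lemma foldr_push_push s v w : reduced v -> reduced w ->
  foldr push w (push s v) = push s (foldr push w v).
Proof.
case: v => [|t v] //= rv rw; case: eqP => [->|//].
by rewrite pushK // reduced_foldr_push.
Qed.

Lemma foldr_push_word w : reduced w -> foldr push [::] w = w.
Proof.
elim: w => //= s w IH rw; rewrite (IH (path_sorted rw)).
by case: w rw {IH} => [|t w] //= /andP[/negPf->].
Qed.

Fact reduced_nil : reduced [::]. Proof. by []. Qed.

Fact reduced_mul (u v : free_group) : reduced (foldr push (word v) (word u)).
Proof. by apply: reduced_foldr_push; exact: valP v. Qed.

Fact reduced_inv (u : free_group) : reduced (rev (map letter_inv (word u))).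
Proof.
rewrite /reduced rev_sorted sorted_map; case: u => w /= rw.
by apply: sub_sorted rw => s t /=; rewrite letter_invK eq_sym.
Qed.

Definition free_one : free_group := FreeGroup reduced_nil.
Definition free_mul (u v : free_group) : free_group :=
  FreeGroup (reduced_mul u v).
Definition free_inv (u : free_group) : free_group := FreeGroup (reduced_inv u).

Fact free_mulA : associative free_mul.
Proof.
case=> [u ru] [v rv] [w rw]; apply: val_inj => /=.
elim: u {ru} => //= s u ->; rewrite foldr_push_push //.
exact: reduced_foldr_push.
Qed.

Fact free_mul1 : left_id free_one free_mul.
Proof. by move=> u; apply: val_inj. Qed.

Fact free_1mul : right_id free_one free_mul.
Proof. by case=> u ru; apply: val_inj; exact: foldr_push_word. Qed.

Fact free_mulV : left_inverse free_one free_inv free_mul.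
Proof.
case=> u ru; apply: val_inj => /=.
suff H (w v : seq letter) : reduced (v : seq letter) ->
    foldr push (foldr push v w) (rev (map letter_inv w)) = v.
  by rewrite -[X in foldr _ X _](foldr_push_word ru) H.
elim: w v => //= s w IH v rv.
have := @pushK (letter_inv s) (foldr push v w); rewrite letter_invK => pK.
by rewrite rev_cons -cats1 foldr_cat /= pK ?IH //; exact: reduced_foldr_push.
Qed.

Fact free_Vmul : right_inverse free_one free_inv free_mul.
Proof.
move=> u; have {1}-> : u = free_inv (free_inv u).
  apply: val_inj => /=; rewrite map_rev revK -map_comp map_id_in // => s _.
  exact: letter_invK.
exact: free_mulV.
Qed.

HB.instance Definition _ := isGroup.Build free_group
  free_mulA free_mul1 free_1mul free_mulV free_Vmul.

Definition generator (s : letter) : free_group := @FreeGroup [:: s] isT.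

End FreeGroup.

Section Circle.
Variable R : realType.

Definition eq_mod1 (x y : R) : bool := x - y \is a Num.int.

Fact eq_mod1_equiv : equiv_class_of eq_mod1.
Proof.
rewrite /eq_mod1; split=> [x|x y|y x z xy yz]; first by rewrite subrr.
  by rewrite -opprB rpredN.
by rewrite -(subrKA y) rpredD.
Qed.

Canonical eq_mod1_equiv_rel := EquivRelPack eq_mod1_equiv.

Definition circle : Type := quotient_topology {eq_quot eq_mod1}.
HB.instance Definition _ := Topological.on circle.
HB.instance Definition _ := Quotient.on circle.

Definition circ (t : R) : circle := \pi_circle t.

(* x, y, z have lifts a < b < d within one turn counterclockwise from a. *)
Definition ccw (x y z : circle) : Prop := exists a b d : R,
  [/\ a < b, b < d & d < a + 1] /\ [/\ x = circ a, y = circ b & z = circ d].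

Definition ord (x y z : circle) : int :=
  if `[< ccw x y z >] then 1 else if `[< ccw x z y >] then -1 else 0.

(* Preserving the orientation of the circle means preserving ord. *)
Definition homeo_plus (f : circle -> circle) : Prop :=
  [/\ continuous f,
      exists f' : circle -> circle, [/\ continuous f', cancel f f' & cancel f' f]
    & forall x y z, ord (f x) (f y) (f z) = ord x y z].

Definition closed_arc (p : R * R) : set circle := circ @` `[p.1, p.2].

Definition finite_union_of_closed_arcs (D : set circle) : Prop :=
  exists2 l : seq (R * R),
    (forall p, p \in l -> p.1 < p.2 < p.1 + 1) &
    D = \bigcup_(p in [set` l]) closed_arc p.

(* The connected component of x in U is the open arc with lifts a and b of its
   endpoints; b = a + 1 is the circle minus a point. *)
Definition arc_component (U : set circle) (x : circle) (a b : R) : Prop :=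
  [/\ U x, a < b <= a + 1 & connected_component U x = circ @` `]a, b[].

End Circle.

Definition sign3 : Type := {z : int | z \in [:: -1; 0; 1]}.
HB.instance Definition _ := Choice.on sign3.

Section CircularOrders.
Variable G : groupType.

Definition co_val (c : G * G * G -> sign3) (g h k : G) : int :=
  sval (c (g, h, k)).

Definition is_circular_order (c : G * G * G -> sign3) : Prop :=
  [/\ forall g1 g2 g3, co_val c g1 g2 g3 = 0 <->
        [\/ g1 = g2, g2 = g3 | g1 = g3],
      forall g1 g2 g3 g4,
        co_val c g2 g3 g4 - co_val c g1 g3 g4 + co_val c g1 g2 g4
          - co_val c g1 g2 g3 = 0
    & forall g u v w : G, co_val c u v w = 1 ->
        co_val c (g * u)%g (g * v)%g (g * w)%g = 1].

Definition CO : set {ptws G * G * G -> discrete_topology sign3} :=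
  is_circular_order.

Variable R : realType.
Local Notation S1 := (circle R).

(* An enumeration g_1, g_2, ... of G, finite or infinite, given by the map
   sending g_(k+1) to k. *)
Definition enumeration (rank : G -> nat) : Prop :=
  injective rank /\ forall g k, (k < rank g)%N -> exists h, rank h = k.

Definition midpoint_embedding (c : G * G * G -> sign3) (rank : G -> nat)
    (iota : G -> S1) : Prop :=
  [/\ injective iota,
      forall g h k, co_val c g h k = ord (iota g) (iota h) (iota k)
    & forall g, (2 <= rank g)%N -> exists a b : R,
        arc_component (~` (iota @` [set h | (rank h < rank g)%N])) (iota g) a b
        /\ iota g = circ ((a + b) / 2)].

Definition circle_action (rho : G -> S1 -> S1) : Prop :=
  (forall g, homeo_plus (rho g)) /\
  (forall g h x, rho (g * h)%g x = rho g (rho h x)).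

(* A component of the complement of the closure of iota(G) goes to another one
   because phi g is a homeomorphism preserving iota(G); the last clause says
   that it does so by an affine map, in terms of lifts. *)
Definition canonical_action (iota : G -> S1) (phi : G -> S1 -> S1) : Prop :=
  [/\ circle_action phi,
      forall g h, phi g (iota h) = iota (g * h)%g
    & forall g x a b, arc_component (~` closure (range iota)) x a b ->
        exists k m : R,
          forall t, a < t < b -> phi g (circ t) = circ (k * t + m)].

(* x0 is the basepoint; the last clauses say rho = h o phi o h^-1. *)
Definition dynamical_realization (c : G * G * G -> sign3)
    (rho : G -> S1 -> S1) (x0 : S1) : Prop :=
  exists rank iota phi h,
    [/\ enumeration rank,
        midpoint_embedding c rank iota,
        canonical_action iota phi,
        homeo_plus h
      & (forall g x, rho g (h x) = h (phi g x)) /\ x0 = h (iota 1%g)].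

End CircularOrders.

Arguments CO G : clear implicits.

(* Main.v *)
(* Call two adjacent elements x, y of the cyclically ordered group a jump, and
   call the order separated by jumps if between any two elements with different
   first letters there is a jump whose ends have different first letters. Both
   sides of the equivalence amount to this property.

   - If it holds, the jumps with different first letters are finitely many,
     because x^-1 y is the same element w for all jumps, and w is the reduced
     product of x^-1 and y. Their position relative to their translates by the
     letters determines the position of every element relative to them, by
     induction on the length, and then the whole order.
   - If it fails, there are q, q' with different first letters, q' arbitrarily
     long, consecutive in a finite suffix-closed set P. Exchanging them, together
     with the pairs obtained from them by deleting letters on the left of q', is
     compatible with the partial action of the letters on P. A partially
     invariant order on P extends to the group one element at a time, the group
     being free, so the order is not isolated.
   - Given ping-pong domains, the orbit points in D(s) are those of the words
     starting with s. As the domains are closed and disjoint, the orbit closure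
     has a gap between two such classes; the ends of a gap of a dynamical
     realization belong to the orbit, so the gap is a jump.
   - Conversely, let w be the successor of 1. Cut the gap between 1 and w into
     len w + 1 arcs and give the i-th one to the prefix of w of length i. This
     extends equivariantly to all gaps, and neighbouring arcs belong to
     neighbours in the Cayley graph. So the words starting with s are separated
     from those starting with another letter by arcs belonging to 1: each closed
     arc complementary to these meets only one class, and D(s) is the union of
     those meeting the class of s. *)
Require Import Defs.
From mathcomp Require Import all_boot all_order all_algebra.
From mathcomp Require Import generic_quotient.
From mathcomp Require Import all_classical all_reals all_analysis.
From mathcomp Require Import zify lra.

Set Implicit Arguments.
Unset Strict Implicit.
Unset Printing Implicit Defensive.

Import Order.TTheory GRing.Theory Num.Theory.
Import numFieldNormedType.Exports.

(** * Cyclic orders *)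

Definition cycn (a b c : nat) : bool :=
  [|| a < b < c, b < c < a | c < a < b].

(** Read [r x y z] as: going round from [x], the point [y] comes strictly before [z]. *)
Record corder (T : eqType) (r : T -> T -> T -> bool) : Prop := Corder {
  corder_rot : forall x y z, r x y z -> r y z x;
  corder_asym : forall x y z, r x y z -> ~~ r x z y;
  corder_trans : forall x y z w, r x y z -> r x z w -> r x y w;
  corder_total : forall x y z,
    x != y -> y != z -> x != z -> r x y z || r x z y
}.

Section CyclicOrder.
Variables (T : eqType) (r : T -> T -> T -> bool).
Hypothesis co : corder r.

Lemma corder_neq x y z : r x y z -> [/\ x != y, y != z & x != z].
Proof.
move=> rxyz; have ryzx := corder_rot co rxyz; have rzxy := corder_rot co ryzx.
split; apply/eqP => e; subst.
- by move: (corder_asym co rxyz); rewrite ryzx.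
- by move: (corder_asym co rxyz); rewrite rxyz.
- by move: (corder_asym co ryzx); rewrite ryzx.
Qed.

Lemma corder_cut p x y z : r p x y -> r p y z -> r x y z.
Proof.
move=> /(corder_rot co)/(corder_rot co) ypx /(corder_rot co) yzp.
by do 2!apply: (corder_rot co); exact: (corder_trans co yzp ypx).
Qed.

(* Cutting the cyclic order at p turns it into a linear one. *)
Lemma corder_rank (p : T) (l : seq T) : exists f : T -> nat,
  [/\ f p = 0, {in p :: l &, forall x y, (x == y) = (f x == f y)}
    & {in p :: l & &, forall x y z, r x y z = cycn (f x) (f y) (f z)}].
Proof.
(* The rank counts the listed points strictly between [p] and [x], shifted by one to reserve 0 for
   [p]. *)
pose f x := if x == p then 0 else (count (fun y => r p y x) (undup l)).+1.
have fp : f p = 0 by rewrite /f eqxx.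
have fP x : x != p -> 0 < f x by rewrite /f => /negPf->.
have flt x y : x \in p :: l -> r p x y -> f x < f y.
  rewrite inE => xl rpxy; have [px xy py] := corder_neq rpxy.
  have xp : x != p by rewrite eq_sym.
  have yp : y != p by rewrite eq_sym.
  rewrite (negPf xp) /= in xl.
  rewrite /f (negPf xp) (negPf yp) ltnS.
  rewrite -!size_filter; pose A := [seq z <- undup l | r p z x].
  apply: (@uniq_leq_size _ (x :: A)).
    rewrite /= filter_uniq ?undup_uniq // mem_filter andbT.
    by apply/andP => -[/corder_neq[_ ]]; rewrite eqxx.
  move=> z; rewrite inE => /orP[/eqP->|]; first by rewrite mem_filter rpxy mem_undup.
  rewrite !mem_filter => /andP[rpzx ->].
  by rewrite (corder_trans co rpzx rpxy).
have fE x y : x \in p :: l -> y \in p :: l -> x != p -> y != p ->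
    r p x y = (f x < f y).
  move=> xl yl xp yp; apply/idP/idP; first exact: flt.
  move=> fxy; have xy : x != y by apply: contraTneq fxy => ->; rewrite ltnn.
  have := @corder_total _ _ co p x y; rewrite eq_sym xp xy eq_sym yp.
  by case/(_ isT isT isT)/orP => // /(flt _ _ yl); lia.
have finj : {in p :: l &, forall x y, (x == y) = (f x == f y)}.
  move=> x y xl yl; apply/eqP/eqP => [->//|].
  have [->|xp] := eqVneq x p; have [->|yp] := eqVneq y p => //; rewrite ?fp.
  - by have := fP _ yp; lia.
  - by have := fP _ xp; lia.
  move=> fxy; apply/eqP; apply: contraT => xy.
  have := @corder_total _ _ co p x y; rewrite eq_sym xp xy eq_sym yp.
  by case/(_ isT isT isT)/orP => [/(flt _ _ xl)|/(flt _ _ yl)]; lia.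
exists f; split => // x y z xl yl zl.
have rotE a b c : r a b c = r b c a.
  by apply/idP/idP => [/(corder_rot co)//|/(corder_rot co)/(corder_rot co)].
have E0 y' z' : y' \in p :: l -> z' \in p :: l -> r p y' z' = cycn 0 (f y') (f z').
  move=> yl' zl'; rewrite /cycn /= ltn0 !andbF !orbF /=.
  have [->|yp] := eqVneq y' p.
    by rewrite fp; apply: contraTF isT => /corder_neq[]; rewrite eqxx.
  have [->|zp] := eqVneq z' p.
    by rewrite fp; apply/idP/idP => [/corder_neq[_ _]|]; rewrite ?eqxx //; lia.
  by rewrite fE // fP.
have [->|xp] := eqVneq x p; first by rewrite fp E0.
have [->|yp] := eqVneq y p; first by rewrite fp rotE E0 // /cycn; lia.
have [->|zp] := eqVneq z p; first by rewrite fp rotE rotE E0 // /cycn; lia.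
have L a b c : a \in p :: l -> b \in p :: l -> c \in p :: l ->
  a != p -> b != p -> c != p -> f a < f b < f c -> r a b c.
  by move=> ? ? ? ? ? ? /andP[]; rewrite -!fE // => /corder_cut; apply.
have L' a b c : a \in p :: l -> b \in p :: l -> c \in p :: l ->
  a != p -> b != p -> c != p -> cycn (f a) (f b) (f c) -> r a b c.
  move=> al bl initial ap bp cp /or3P[] lt; first exact: L.
    by rewrite rotE; apply: L.
  by rewrite -rotE; apply: L.
apply/idP/idP => [rxyz|]; last exact: L'.
have [] := corder_neq rxyz; rewrite !finj // => xy yz xz.
apply: contraT => nxyz; have := corder_asym co rxyz.
by rewrite L' //; move: nxyz; rewrite /cycn; lia.
Qed.

End CyclicOrder.

Ltac generalize_ranks f l :=
  lazymatch l with
  | ?x :: ?l' => move: (f x); generalize_ranks f l'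
  | _ => idtac
  end.

(* The goal must be a statement on the order of the listed points; p becomes
   the smallest one. *)
Ltac corder_lia co p l :=
  let f := fresh "f" in let f0 := fresh in let fi := fresh in let fr := fresh in
  have [f [f0 fi fr]] := corder_rank co p l;
  rewrite ?fr ?fi ?inE ?eqxx ?orbT //; rewrite /cycn ?f0; clear f0 fi fr;
  generalize_ranks f l; clear; lia.

Section Extremal.
Variables (T : eqType) (r : T -> T -> T -> bool).
Hypothesis co : corder r.

(** [h] is the point of [l] immediately before [p]; the induction keeps whichever candidate is
    closer to [p]. *)
Lemma corder_pred (p : T) (l : seq T) : l != [::] -> p \notin l ->
  exists2 h, h \in l & {in l, forall k, k != h -> r h p k}.
Proof.
elim: l => // a [|b l] IH _.
  rewrite inE => pa; exists a; rewrite ?inE ?eqxx //.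
  by move=> k; rewrite inE => ->.
rewrite inE negb_or => /andP[pa pl]; have [//|h hl hP] := IH _ pl.
have ph : p != h by apply: contraNneq pl => ->.
have [ah|ah] := eqVneq a h.
  exists a; first by rewrite mem_head.
  move=> k; rewrite inE => /orP[->//|kl] ka; rewrite ah; apply: hP => //.
  by rewrite -ah.
have [rhap|nrhap] := boolP (r h a p).
  exists a; first by rewrite mem_head.
  move=> k; rewrite inE => /orP[->//|kl] ka.
  have [->|kh] := eqVneq k h; first exact: (corder_rot co).
  move: (hP _ kl kh) rhap; corder_lia co h [:: a; p; k].
exists h; first by rewrite inE hl orbT.
move=> k; rewrite inE => /orP[/eqP-> _|]; last exact: hP.
move: nrhap pa ph ah; corder_lia co h [:: a; p].
Qed.

Lemma corder_op : corder (fun x y z => r x z y).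
Proof.
split.
- by move=> x y z; corder_lia co x [:: y; z].
- by move=> x y z; corder_lia co x [:: y; z].
- by move=> x y z w; corder_lia co x [:: y; z; w].
- by move=> x y z; corder_lia co x [:: y; z].
Qed.

End Extremal.

Lemma corder_succ (T : eqType) (r : T -> T -> T -> bool) (p : T) (l : seq T) :
  corder r -> l != [::] -> p \notin l ->
  exists2 h, h \in l & {in l, forall k, k != h -> r p h k}.
Proof.
move=> co l0 pl; have [h hl hP] := corder_pred (corder_op co) l0 pl.
by exists h => // k kl kh; have := hP k kl kh; corder_lia co p [:: h; k].
Qed.

(** * Reduced words *)

Section FreeWords.
Variable n : nat.
Local Notation letter := (letter n).
Local Notation G := (free_group n).
Local Notation gen := (@generator n).
Local Open Scope group_scope.

Implicit Types (s t : letter) (g h k : G).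

Definition len g := size (word g).
Definition initial g : option letter := ohead (word g).

Lemma word_inj : injective (@word n).
Proof. exact: val_inj. Qed.

Lemma word_mul s g : word (gen s * g) = push s (word g).
Proof. by []. Qed.

Lemma letter_inv_neq s : letter_inv s != s.
Proof. by case: s => i b; rewrite -pair_eqE /= eqxx /=; case: b. Qed.

Lemma gen_inv s : gen (letter_inv s) = (gen s)^-1.
Proof. exact: val_inj. Qed.

Lemma gen_invK s g : gen (letter_inv s) * (gen s * g) = g.
Proof. by rewrite gen_inv mulKg. Qed.

Lemma gen_Kinv s g : gen s * (gen (letter_inv s) * g) = g.
Proof. by rewrite gen_inv mulVKg. Qed.

Lemma word_mulS s g : initial g != Some (letter_inv s) ->
  word (gen s * g) = s :: word g.
Proof. by rewrite word_mul /initial; case: (word g) => //= t w /negPf;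
  case: ifP => // /eqP->; rewrite eqxx. Qed.

Lemma len_mulS s g : initial g != Some (letter_inv s) -> len (gen s * g) = (len g).+1.
Proof. by move=> /word_mulS; rewrite /len => ->. Qed.

Lemma initial_mulS s g : initial g != Some (letter_inv s) ->
  initial (gen s * g) = Some s.
Proof. by move=> /word_mulS; rewrite /initial => ->. Qed.

Lemma len1 : len 1 = 0%N. Proof. by []. Qed.
Lemma initial1 : initial 1 = None. Proof. by []. Qed.

Lemma initial_None g : initial g = None -> g = 1.
Proof. by rewrite /initial => H; apply: word_inj; case: (word g) H. Qed.

Lemma len_gen s : len (gen s) = 1%N. Proof. by []. Qed.

Lemma initial_Some s g : initial g = Some s ->
  initial (gen (letter_inv s) * g) != Some (letter_inv s) /\
  len g = (len (gen (letter_inv s) * g)).+1.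
Proof.
rewrite /initial /len word_mul; case: g => -[|t w] //= rw [ts]; subst t.
rewrite letter_invK eqxx; split => //; case: w rw => //= t w /andP[ts _].
by apply: contra ts => /eqP[->].
Qed.

Lemma word_ind (P : G -> Prop) : P 1 ->
  (forall s g, initial g != Some (letter_inv s) -> P g -> P (gen s * g)) ->
  forall g, P g.
Proof.
move=> P1 PS g; move: {2}(len g) (erefl (len g)) => m.
elim: m g => [|m IH] g gm.
  by rewrite (_ : g = 1) //; apply: word_inj; apply/nilP; rewrite /nilp -/(len g) gm.
case E: (initial g) => [s|]; last by rewrite (initial_None E).
have [nE lE] := initial_Some E; rewrite -(gen_Kinv s g); apply: PS => //.
by apply: IH; move: lE; rewrite gm => -[].
Qed.

Fixpoint ball m : seq G := if m is m'.+1 then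
  ball m' ++ [seq gen s * g | s <- enum {: letter}, g <- ball m'] else [:: 1].

Lemma mem_ball m g : (g \in ball m) = (len g <= m).
Proof.
apply/idP/idP.
  elim: m g => [|m IH] g /=; first by rewrite inE => /eqP->.
  rewrite mem_cat => /orP[/IH|/allpairsP[[s h] /= [_ /IH hm ->]]]; first exact: leqW.
  have [E|E] := eqVneq (initial h) (Some (letter_inv s)); last by rewrite len_mulS.
  by have [_] := initial_Some E; rewrite letter_invK; lia.
elim: m g => [|m IH] g /=.
  by rewrite leqn0 => /nilP/(@word_inj g 1)->; rewrite inE.
rewrite mem_cat; case E: (initial g) => [s|] lg; last by rewrite (initial_None E) IH.
apply/orP; right; apply/allpairsP; exists (s, gen (letter_inv s) * g).
rewrite mem_enum gen_Kinv; split => //=; apply: IH.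
by have [_] := initial_Some E; move: lg; lia.
Qed.

(** These are the subtrees through 1 of the graph joining each [g] to its products [gen s * g]. *)
Definition suffix_closed (P : seq G) := 1 \in P /\
  forall s g, initial g != Some (letter_inv s) -> gen s * g \in P -> g \in P.

Lemma suffix_closed_ball m : suffix_closed (ball m).
Proof. by split=> [|s g /len_mulS]; rewrite !mem_ball => // ->; lia. Qed.

Lemma suffix_closed_cat P Q : suffix_closed P -> suffix_closed Q ->
  suffix_closed (P ++ Q).
Proof.
move=> [P1 PS] [Q1 QS]; split; first by rewrite mem_cat P1.
by move=> s g gs; rewrite !mem_cat => /orP[/(PS _ _ gs)->|/(QS _ _ gs)->] //;
  rewrite orbT.
Qed.

End FreeWords.

Arguments len {n}.
Arguments initial {n}.

Record gorder n (r : free_group n -> free_group n -> free_group n -> bool) : Prop :=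
  Gorder {
    gorder_co : corder r;
    gorder_inv : forall g x y z, r x y z -> r (g * x)%g (g * y)%g (g * z)%g
  }.

Lemma gorderE n r (H : @gorder n r) g x y z :
  r (g * x)%g (g * y)%g (g * z)%g = r x y z.
Proof.
apply/idP/idP; last exact: (gorder_inv H).
by move/(gorder_inv H g^-1%g); rewrite !mulKg.
Qed.

Lemma gorder_op n r : @gorder n r -> gorder (fun x y z => r x z y).
Proof.
by move=> H; split; [exact: corder_op (gorder_co H)|move=> g x y z;
  exact: gorder_inv].
Qed.

(** * The cyclic order of an ordered field *)

Section Positions.
Local Open Scope ring_scope.

Definition cycq (K : realFieldType) (a b c : K) : bool :=
  [|| a < b < c, b < c < a | c < a < b].

Lemma cycq_corder {K : realFieldType} : corder (@cycq K).
Proof.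
rewrite /cycq; split.
- by move=> x y z /or3P[]->; rewrite ?orbT.
- move=> x y z /or3P[]/andP[h1 h2]; rewrite !negb_or !negb_and -!leNgt;
  by repeat (apply/andP; split); apply/orP; lra.
- move=> x y z w /or3P[]/andP[h1 h2] /or3P[]/andP[h3 h4]; apply/or3P;
  first [ by exfalso; lra
    | by apply: Or31; apply/andP; split; lra
    | by apply: Or32; apply/andP; split; lra
    | by apply: Or33; apply/andP; split; lra ].
- by move=> x y z; case: (ltgtP x y); case: (ltgtP y z); case: (ltgtP x z);
    rewrite ?orbT //= => *; lra.
Qed.

(** Density leaves room for [b] between [a] and the next larger entry of [l]; the entries below [a]
    come later, after wrapping round. *)
Lemma cycq_dense (a : rat) (l : seq rat) :
  exists2 b, b \notin l & {in l, forall x, x != a -> cycq a b x}.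
Proof.
have [b ab bP] : exists2 b, a < b & {in l, forall x, a < x -> b < x}.
  elim: l => [|x l [b ab bP]]; first by exists (a + 1) => //; lra.
  have [ax|xa] := ltP a x; last first.
    by exists b => // y; rewrite inE => /orP[/eqP->|/bP//]; lra.
  exists (Num.min b ((a + x) / 2)).
    by rewrite lt_min ab; lra.
  move=> y; rewrite inE gt_min => /orP[/eqP-> _|/bP bP' /bP' ->//].
  by apply/orP; right; lra.
exists b; first by apply/negP => /bP /(_ ab); rewrite ltxx.
move=> x xl xa; rewrite /cycq ab /=; case: (ltgtP a x) xa => [ax _|ax _|] //.
  by rewrite bP.
by rewrite !orbT.
Qed.

(* A partial order-preserving map u g |-> v g extends to one more point. *)
Lemma cycq_extend (T : eqType) (D : seq T) (u v : T -> rat) (a : rat) (l : seq rat) :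
  {in D &, injective u} -> {in D &, injective v} ->
  {in D & &, forall x y z, cycq (u x) (u y) (u z) -> cycq (v x) (v y) (v z)} ->
  a \notin map u D -> {subset map v D <= l} ->
  exists2 b, b \notin l & {in D &, forall x y,
    cycq a (u x) (u y) = cycq b (v x) (v y)}.
Proof.
move=> iu iv uv aD vl; have [D0|D0] := eqVneq (map u D) [::].
  have [b bl _] := cycq_dense a l; exists b => // x y.
  by case: D D0 {iu iv uv aD vl}.
(* [u h] is the last image before [a], so [b] is put immediately after [v h]. *)
have [_ /mapP[h hD ->] hP] := corder_pred cycq_corder D0 aD.
have [b bl bP] := cycq_dense (v h) l; exists b => // x y xD yD.
have uE : {in D &, forall x y, (u x == u y) = (x == y)} by move=> ? ? ? ?;
  apply: (inj_in_eq iu).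
have vE : {in D &, forall x y, (v x == v y) = (x == y)} by move=> ? ? ? ?;
  apply: (inj_in_eq iv).
have hP' z : z \in D -> z != h -> cycq (u h) a (u z).
  by move=> zD zh; apply: hP; [exact: map_f|rewrite uE].
have bP' z : z \in D -> z != h -> cycq (v h) b (v z).
  by move=> zD zh; apply: bP; [apply: vl; exact: map_f|rewrite vE].
have [->|xy] := eqVneq x y.
  by have C := @cycq_corder rat; corder_lia C a [:: b; u y; v y].
have : cycq (u x) (u y) (u h) = cycq (v x) (v y) (v h).
  apply/idP/idP; first exact: uv.
  move=> V; apply: contraT => nU.
  have [vxy vyh vxh] := corder_neq cycq_corder V; rewrite !vE // in vxy vyh vxh.
  have := corder_total cycq_corder (x := u x) (y := u y) (z := u h).
  rewrite !uE // vxy vyh vxh (negPf nU) => /(_ isT isT isT) /= /uv.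
  by move=> /(_ xD hD yD) V'; move: (corder_asym cycq_corder V); rewrite V'.
have C := @cycq_corder rat.
have [xh|xh] := eqVneq x h; have [yh|yh] := eqVneq y h.
- by move: xy; rewrite xh yh eqxx.
- rewrite xh; transitivity false; last apply/esym.
    by move: (hP' _ yD yh); corder_lia C (u h) [:: u y; a].
  by move: (bP' _ yD yh); corder_lia C (v h) [:: v y; b].
- rewrite yh; transitivity true; last apply/esym.
    by move: (hP' _ xD xh); corder_lia C (u h) [:: u x; a].
  by move: (bP' _ xD xh); corder_lia C (v h) [:: v x; b].
move: (hP' _ xD xh) (bP' _ xD xh) (hP' _ yD yh) (bP' _ yD yh) => P1 P2 P3 P4 E.
have -> : cycq a (u x) (u y) = cycq (u x) (u y) (u h).
  by move: P1 P3; corder_lia C (u h) [:: u x; u y; a].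
rewrite E; by move: P2 P4; corder_lia C (v h) [:: v x; v y; b].
Qed.

End Positions.

(** * Extension of partially invariant orders *)

Section Extension.
Variable n : nat.
Local Notation letter := (letter n).
Local Notation G := (free_group n).
Local Notation gen := (@generator n).
Local Open Scope group_scope.

Implicit Types (P : seq G) (f : G -> rat) (s t : letter).

(** A finite approximation of a left-invariant cyclic order: [f] places a finite subtree on the
    rationals, read cyclically. *)
Record local_order P f : Prop := LocalOrder {
  local_order_closed : suffix_closed P;
  local_order_inj : {in P &, injective f};
  local_order_inv : forall s x y z, x \in P -> y \in P -> z \in P ->
    gen s * x \in P -> gen s * y \in P -> gen s * z \in P ->
    cycq (f x) (f y) (f z) ->
    cycq (f (gen s * x)) (f (gen s * y)) (f (gen s * z))
}.

Lemma gen_mul_neq s (g : G) : gen s * g != g.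
Proof.
apply/eqP => e; have [E|E] := eqVneq (initial g) (Some (letter_inv s)); last first.
  by move/(congr1 len): e; rewrite len_mulS //; lia.
by have [_] := initial_Some E; rewrite letter_invK e; lia.
Qed.

(** The new element is a leaf attached to [g], because [P] is suffix-closed. Only the letter [s] and
    its inverse constrain its position, and they do so by asking that a partial order-preserving map
    extend to one more point. *)
Lemma local_order_step P f s g : local_order P f -> g \in P ->
  initial g != Some (letter_inv s) ->
  exists P' f', [/\ local_order P' f', {subset P <= P'}, {in P,
    f' =1 f} & gen s * g \in P'].
Proof.
move=> PF gP gs; have [wP|wP] := boolP (gen s * g \in P); first by exists P, f; split.
have [[P1 Pcl] Pinj Pinv] := PF.
set w := gen s * g in wP *.
pose D := [seq h <- P | gen s * h \in P].
have DP h : h \in D -> h \in P /\ gen s * h \in P by rewrite mem_filter => /andP[].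
have fv : {in D &, injective (fun h => f (gen s * h))}.
  move=> x y /DP[xP xP'] /DP[yP yP'] /Pinj;
    move=> /(_ xP' yP') /(congr1 (fun u => (gen s)^-1 * u)).
  by rewrite !mulKg.
(* The map from [f h] to [f (gen s * h)], defined on [D], is extended to [f g]; the value [b]
   becomes the position of [w]. *)
have [] := @cycq_extend _ D f (fun h => f (gen s * h)) (f g) (map f P).
- by move=> x y /DP[xP _] /DP[yP _]; exact: Pinj.
- exact: fv.
- by move=> x y z /DP[xP xP'] /DP[yP yP'] /DP[zP zP']; exact: Pinv.
- apply/mapP => -[h /DP[hP hP']] /Pinj e; move: hP'; rewrite -e // => wP'.
  by rewrite /w wP' in wP.
- by move=> _ /mapP[x /DP[_ xP] ->]; exact: map_f.
move=> b bP bE; pose f' x := if x == w then b else f x.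
have f'P x : x \in P -> f' x = f x.
  by rewrite /f'; case: eqP => // -> wP'; rewrite wP' in wP.
have f'w : f' w = b by rewrite /f' eqxx.
have wcl : initial w = Some s by rewrite initial_mulS.
have ws : initial w != Some (letter_inv s).
  by rewrite wcl; apply/eqP => -[/eqP]; rewrite eq_sym; exact/negP/letter_inv_neq.
exists (w :: P), f'; split; last exact: mem_head.
- split.
  + split; first by rewrite inE P1 orbT.
    move=> t x xt; rewrite inE => /orP[/eqP e|/(Pcl _ _ xt) xP];
      last by rewrite inE xP orbT.
      have st : s = t by have := initial_mulS xt; rewrite e wcl => -[].
      have -> : x = g by apply: (mulgI (gen t)); rewrite e -st.
      by rewrite inE gP orbT.
  + move=> x y; rewrite !inE => /orP[/eqP->|xP] /orP[/eqP->|yP] //;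
      rewrite ?f'w ?f'P //.
    * by move=> e; rewrite e map_f in bP.
    * by move=> e; rewrite -e map_f in bP.
    * exact: Pinj.
  (* With [g] added to its domain, [s] still preserves and reflects the order. *)
  have key x y z : x \in g :: D -> y \in g :: D -> z \in g :: D ->
      cycq (f' x) (f' y) (f' z) = cycq (f' (gen s * x)) (f' (gen s * y)) (f' (gen s *
        z)).
    have f'D h : h \in D -> (f' (gen s * h) = f (gen s * h)) * (f' h = f h).
      by move=> /DP[hP hP']; rewrite !f'P.
    have rotE a c d : cycq a c d = cycq c d a.
      apply/idP/idP; [exact: (corder_rot cycq_corder)|].
      by move=> h; apply: (corder_rot cycq_corder); exact: (corder_rot cycq_corder).
    have same a c : cycq a a c = false.
      by apply/negP => /(corder_neq cycq_corder)[]; rewrite eqxx.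
    have same' a c : cycq a c a = false by rewrite -rotE same.
    have same'' a c : cycq c a a = false by rewrite rotE same.
    have f'g : (f' g = f g) * (f' (gen s * g) = b) by rewrite f'P.
    have bE' : {in D &, forall x y,
      cycq (f g) (f x) (f y) = cycq b (f (gen s * x)) (f (gen s * y))} by exact: bE.
    rewrite !inE => /orP[/eqP->|xD] /orP[/eqP->|yD] /orP[/eqP->|zD];
      rewrite ?f'g ?f'D // ?same ?same' ?same'' //.
    + exact: bE'.
    + by rewrite rotE bE' // -rotE.
    + by rewrite -rotE bE' // rotE.
    apply/idP/idP; first by move: xD yD zD => /DP[xP xP'] /DP[yP yP'] /DP[zP zP'];
      exact: Pinv.
    move: xD yD zD => /DP[xP xP'] /DP[yP yP'] /DP[zP zP'] H.
    by have := @Pinv (letter_inv s) _ _ _ xP' yP' zP'; rewrite !gen_invK; apply.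
  (* The only edge at [w] in the enlarged tree is the one to [g]. *)
  have loc t x : x \in w :: P -> gen t * x \in w :: P ->
    [\/ x \in P /\ gen t * x \in P, t = s /\ x = g | t = letter_inv s /\ x = w].
    rewrite !inE => /orP[/eqP->|xP].
      have [->|ts] := eqVneq t (letter_inv s); first by constructor 3.
      rewrite (negPf (gen_mul_neq _ _)) /= => tw; have wP' := fun h => Pcl _ _ h tw.
      have : initial w != Some (letter_inv t).
        by rewrite wcl; apply: contra ts => /eqP[->]; rewrite letter_invK.
      by move/wP' => wP''; rewrite wP'' in wP.
    move=> /orP[/eqP e|txP]; last by constructor 1.
    have [ts|ts] := eqVneq t s; first by constructor 2; split=> //;
      apply: (mulgI (gen t)); rewrite e ts.
    have ex : x = gen (letter_inv t) * w by rewrite -e gen_invK.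
    have : initial w != Some (letter_inv (letter_inv t)).
      by rewrite wcl letter_invK; apply: contra ts => /eqP[->].
    by move/Pcl; rewrite -ex => /(_ xP) wP'; rewrite wP' in wP.
  have Dloc x : x \in w :: P -> gen s * x \in w :: P -> x \in g :: D.
    move=> xP xP'; case: (loc _ _ xP xP') => -[].
    + by move=> h1 h2; rewrite inE mem_filter h1 h2 orbT.
    + by move=> _ ->; rewrite mem_head.
    + by move=> /eqP; rewrite eq_sym (negPf (letter_inv_neq s)).
  move=> t x y z xP yP zP xP' yP' zP'.
  have [ts|ts] := eqVneq t s.
    by rewrite ts in xP' yP' zP' *; rewrite key //; exact: Dloc.
  have [ts'|ts'] := eqVneq t (letter_inv s).
    have K u : gen s * (gen t * u) = u by rewrite ts' gen_Kinv.
    by rewrite -{1}(K x) -{1}(K y) -{1}(K z) -key //; apply: Dloc => //; rewrite K.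
  have {}loc u : u \in w :: P -> gen t * u \in w :: P -> u \in P /\ gen t * u \in P.
    move=> uP tuP; case: (loc _ _ uP tuP) => [//|[e]|[e]];
      last by rewrite e eqxx in ts'.
    by rewrite e eqxx in ts.
  have [? ?] := loc _ xP xP'; have [? ?] := loc _ yP yP'; have [? ?] := loc _ zP zP'.
  by rewrite !f'P //; exact: Pinv.
- by move=> x xP; rewrite inE xP orbT.
- by move=> x xP; exact: f'P.
Qed.

Definition local_extension (S S' : seq G * (G -> rat)) :=
  [/\ local_order S'.1 S'.2, {subset S.1 <= S'.1} & {in S.1, S'.2 =1 S.2}].

Lemma local_extension_trans S1 S2 S3 : local_extension S1 S2 ->
  local_extension S2 S3 -> local_extension S1 S3.
Proof.
move=> [C1 s1 f1] [C2 s2 f2]; split=> // x xS; first by apply: s2; exact: s1.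
by rewrite f2 ?f1 //; exact: s1.
Qed.

Lemma local_order_extend S g : local_order S.1 S.2 ->
  exists S', local_extension S S' /\ g \in S'.1.
Proof.
elim/word_ind: g => [|s g gs IH] C; first by exists S; split;
  [split|exact: (local_order_closed C).1].
have [S1 [E1 gS1]] := IH C; have [C1 _ _] := E1.
have [P' [f' [C' sP' fP' wP']]] := local_order_step C1 gS1 gs.
by exists (P', f'); split => //; apply: local_extension_trans E1 _.
Qed.

(* Positions are assigned one element at a time along an enumeration of the
   group, and never changed afterwards. *)
Lemma local_order_gorder P f : local_order P f ->
  exists2 r, gorder r & {in P & &, forall x y z, r x y z = cycq (f x) (f y) (f z)}.
Proof.
move=> C.
have [next nextP] : exists next : seq G * (G -> rat) -> G -> seq G * (G -> rat),
    forall S g, local_order S.1 S.2 ->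
      local_extension S (next S g) /\ g \in (next S g).1.
  have H (x : (seq G * (G -> rat)) * G) : exists S', local_order x.1.1 x.1.2 ->
    local_extension x.1 S' /\ x.2 \in S'.1.
    have [C'|C'] := pselect (local_order x.1.1 x.1.2); last by exists x.1.
    by have [S' HS'] := local_order_extend x.2 C'; exists S'.
  exists (fun S g => sval (cid (H (S, g)))) => S g.
  exact: (svalP (cid (H (S, g)))).
pose en k : G := if unpickle k is Some g then g else 1.
pose st := fix st k := if k is k'.+1 then next (st k') (en k') else (P, f).
have stC k : local_order (st k).1 (st k).2.
  by elim: k => //= k IH; have [[]] := nextP _ (en k) IH.
have stE k m : (k <= m)%N -> local_extension (st k) (st m).
  elim: m => [|m IH]; first by rewrite leqn0 => /eqP->; split.
  rewrite leq_eqVlt => /orP[/eqP->|/IH E]; first by split.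
  by apply: local_extension_trans E _; have [] := nextP _ (en m) (stC m).
have stP k g : (pickle g < k)%N -> g \in (st k).1.
  move=> gk; have [_ sub _] := stE _ _ gk; apply: sub => /=.
  by have [_] := nextP _ (en (pickle g)) (stC (pickle g)); rewrite /en pickleK.
pose F g := (st (pickle g).+1).2 g.
have FE k g : (pickle g < k)%N -> F g = (st k).2 g.
  by move=> gk; have [_ _ ->//] := stE _ _ gk; exact: stP.
have Finj : injective F.
  move=> x y; pose k := (pickle x + pickle y).+1.
  rewrite (@FE k) ?(@FE k y) /k; try lia.
  by apply: (local_order_inj (stC k)); apply: stP; rewrite /k; lia.
exists (fun x y z => cycq (F x) (F y) (F z)).
  split.
    split.
    + by move=> *; exact: (corder_rot cycq_corder).
    + by move=> *; exact: (corder_asym cycq_corder).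
    + by move=> ? ? ? ?; exact: (corder_trans cycq_corder).
    + by move=> x y z *; apply: (corder_total cycq_corder); rewrite inj_eq.
  elim/word_ind => [|s g gs IH] x y z; first by rewrite !mul1g.
  move=> /IH; rewrite -!mulgA.
  move: (g * x) (g * y) (g * z) => {}x {}y {}z.
  (* All six elements are present at stage [k], where invariance is that of a local order. *)
  pose l := [:: x; y; z; gen s * x; gen s * y; gen s * z].
  pose k := (\max_(u <- l) pickle u).+1.
  have kP u : u \in l -> (pickle u < k)%N.
    by move=> ul; rewrite ltnS; exact: (@leq_bigmax_seq _ _ xpredT pickle).
  rewrite !(@FE k); try by apply: kP; rewrite !inE eqxx ?orbT.
  by apply: (local_order_inv (stC k)); apply: stP; apply: kP; rewrite !inE eqxx ?orbT.
move=> x y z xP yP zP.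
have F0 g : g \in P -> F g = f g.
  by move=> gP; have [_ _ H] := stE 0 (pickle g).+1 isT; rewrite /F H.
by rewrite !F0.
Qed.

End Extension.

(** * Orders separated by jumps are isolated *)

Section Border.
Variable n : nat.
Local Notation letter := (letter n).
Local Notation G := (free_group n).
Local Notation gen := (@generator n).
Local Open Scope group_scope.

Implicit Types (s t : letter) (g h x y : G) (r : G -> G -> G -> bool).

(** Different first letters leave nothing to cancel between [x^-1] and [y]. *)
Lemma len_mulV x y : initial x != initial y -> len (x^-1 * y) = (len x + len y)%N.
Proof.
elim/word_ind: x y => [|s x xs IH] y xy; first by rewrite invg1 mul1g.
rewrite initial_mulS // in xy; have ys :
  initial y != Some (letter_inv (letter_inv s)).
  by rewrite letter_invK eq_sym.
by rewrite invgM -mulgA -gen_inv IH ?len_mulS ?initial_mulS //; lia.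
Qed.

Definition jump r x y : Prop := x != y /\ forall z, ~~ r x z y.
Definition border r x y : Prop := jump r x y /\ initial x != initial y.
(** The jump is located by its lower end; nothing lies inside a jump, so its upper end comes no
    later than [h]. *)
Definition jump_separated r : Prop := forall g h, initial g != initial h ->
  exists x y, border r x y /\ (x = g \/ r g x h).

Section Jumps.
Variable r : G -> G -> G -> bool.
Hypothesis H : gorder r.
Let co : corder r := gorder_co H.

Lemma jump_mul g x y : jump r x y -> jump r (g * x) (g * y).
Proof.
move=> [xy Hz]; split; first by rewrite (inj_eq (mulgI g)).
by move=> z; rewrite -(mulVKg g z) gorderE.
Qed.

Lemma jump_uniq x y y' : jump r x y -> jump r x y' -> y = y'.
Proof.
move=> [xy Hy] [xy' Hy']; apply/eqP.
by move: xy xy' (Hy y') (Hy' y); corder_lia co x [:: y; y'].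
Qed.

(** By invariance all jumps have the same quotient [w], and for a border the lengths of the two ends
    add up to [len w]. So all ends of borders lie in one ball. *)
Lemma border_list : exists F : seq G,
  (forall e, e \in F <-> (exists y, border r e y) \/ (exists x, border r x e)) /\
  (F = [::] \/ exists2 w, border r 1 w & 1 \in F /\ w \in F).
Proof.
have [[x0 [y0 [b0 c0]]]|nb] := pselect (exists x y, border r x y); last first.
  exists [::]; split; [|by left].
  by move=> e; split=> //; case=> -[z b]; case: nb; [exists e, z|exists z, e].
pose w := x0^-1 * y0.
have j1 x y : jump r x y -> x^-1 * y = w.
  move=> /(jump_mul x^-1); rewrite mulVg => j.
  by apply: jump_uniq j _; have := jump_mul x0^-1 b0; rewrite mulVg.
have b1 : border r 1 w.
  split; first by have := jump_mul x0^-1 b0; rewrite mulVg.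
  rewrite initial1 eq_sym; apply/eqP => /initial_None w1.
  by have := len_mulV c0; rewrite -/w w1 len1; move: c0; case: b0 => /eqP; case;
     apply: (mulgI x0^-1); rewrite -/w w1 mulVg.
have lb x y : border r x y -> (len x <= len w)%N /\ (len y <= len w)%N.
  by move=> [j c]; rewrite -(j1 _ _ j) len_mulV //; split; lia.
pose P e := (exists y, border r e y) \/ (exists x, border r x e).
exists [seq e <- ball n (len w) | `[< P e >]]; split.
  move=> e; rewrite mem_filter mem_ball; split=> [/andP[/asboolP]//|Pe].
  apply/andP; split; first exact/asboolP.
  by case: Pe => -[z /lb[]].
right; exists w => //; rewrite !mem_filter !mem_ball len1 leqnn /= !andbT.
by split; apply/asboolP; [left; exists w|right; exists 1].
Qed.

End Jumps.

Section Rigidity.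
Variables (r r' : G -> G -> G -> bool) (F : seq G).
Hypotheses (H : gorder r) (H' : gorder r') (S : jump_separated r).
Hypothesis F_border :
  forall e, e \in F <-> (exists y, border r e y) \/ (exists x, border r x e).
Hypothesis F_one : F = [::] \/ exists2 w, border r 1 w & 1 \in F /\ w \in F.

Let F' := F ++ [seq gen s * e | s <- enum {: letter}, e <- F].
Hypothesis agree : {in F' & &, forall x y z, r' x y z = r x y z}.
Let co : corder r := gorder_co H.
Let co' : corder r' := gorder_co H'.

Lemma sep_l g h : initial g != initial h -> exists2 x, x \in F & x = g \/ r g x h.
Proof.
move=> gh; have [x [y [b xgh]]] := S gh; exists x => //.
by apply/F_border; left; exists y.
Qed.

Lemma sep_r g h : initial g != initial h -> exists2 y, y \in F & y = h \/ r g y h.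
Proof.
move=> gh; have [x [y [b xgh]]] := S gh; exists y.
  by apply/F_border; right; exists x.
have gh' : g != h by apply: contraNneq gh => ->.
have [[xy /(_ h) xhy] _] := b.
have E : (x == g) || r g x h by case: xgh => [->|->]; rewrite ?eqxx ?orbT.
suff /orP[/eqP|] : (y == h) || r g y h by [left|right].
by move: E xy xhy gh'; corder_lia co g [:: x; y; h].
Qed.

Lemma rot_E (T : eqType) (q : T -> T -> T -> bool) (x y z : T) : corder q ->
  q x y z = q y z x.
Proof. by move=> C; corder_lia C x [:: y; z]. Qed.

(** Points outside an open arc do not distinguish between the points of the arc, so the position of
    [g] can be read off at the end [a]. *)
Lemma same_gap (T : eqType) (q : T -> T -> T -> bool) (a g b e f : T) : corder q ->
  q a g b -> ~~ q a e b -> ~~ q a f b ->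
  q e g f = (e != f) && ((e == a) || q e a f).
Proof. by move=> C; corder_lia C a [:: g; b; e; f]. Qed.

(* The arc of consecutive elements of F containing g = s h is the translate by s
   of an arc containing h, which is known by induction. *)
Lemma location g : {in F &, forall e f, r' e g f = r e g f}.
Proof.
case: F_one => [F0|[w bw [F1 Fw]]]; first by rewrite F0.
have FF' e : e \in F -> e \in F' by move=> eF; rewrite mem_cat eF.
have FsF' s e : e \in F -> gen s * e \in F'.
  move=> eF; rewrite mem_cat; apply/orP; right; apply/allpairsP.
  by exists (s, e); rewrite mem_enum.
elim/word_ind: g => [|s h hs IH] e f eF fF; first by apply: agree; exact: FF'.
have [hF|hF] := boolP (h \in F); first by apply: agree;
  [exact: FF'|exact: FsF'|exact: FF'].
have Fn0 : F != [::] by apply: contraTneq F1 => ->.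
(* [u] and [v] are the neighbours of [h] in [F]. *)
have [u uF uP] := corder_pred co Fn0 hF; have [v vF vP] := corder_succ co Fn0 hF.
have hneq k : k \in F -> k != h by move=> kF; apply: contraNneq hF => <-.
have uv : u != v.
  apply/eqP => uv; have [k kF ku] : exists2 k, k \in F & k != u.
    have [->|] := eqVneq u 1; last by move=> u1; exists 1; rewrite // eq_sym.
    by exists w => //; case: bw => -[]; rewrite eq_sym.
  move: (uP _ kF ku) (vP _ kF); rewrite -uv => P1 /(_ ku) P2.
  by move: P1 P2; corder_lia co u [:: h; k].
have uhv : r u h v by apply: uP => //; rewrite eq_sym.
have uh := hneq _ uF; have vh := hneq _ vF.
(* A change of first letter between [u] and [v] would put an end of a border strictly inside this
   arc, against the choice of [u] and [v]. *)
have clk k : (k == u) || (k == v) || r u k v -> initial k = initial h.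
  move=> ukv; apply/eqP; apply: contraT => kh.
  have kh' : k != h by apply: contraNneq kh => ->.
  have [c1|c1] := boolP ((k == v) || r h k v).
    have hk : initial h != initial k by rewrite eq_sym.
    have [x xF [xh|hxk]] := sep_l hk; first by move: (hneq _ xF); rewrite xh eqxx.
    have xv : x != v by move: hxk c1 uhv; corder_lia co u [:: h; x; k; v].
    by move: (vP _ xF xv) hxk c1 uhv; corder_lia co u [:: h; x; k; v].
  have c2 : (k == u) || r u k h.
    by move: ukv c1 kh' uhv; corder_lia co u [:: h; k; v].
  have [y yF [yh|kyh]] := sep_r kh; first by move: (hneq _ yF); rewrite yh eqxx.
  have yu : y != u by move: kyh c2 uhv; corder_lia co u [:: h; y; k; v].
  by move: (uP _ yF yu) kyh c2 uhv; corder_lia co u [:: h; y; k; v].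
(* If an end [k] of a border fell inside the translated arc, its partner, being adjacent, would fall
   inside or at an end of it. Pulled back by [s], both have the first letter of [h]; so both start
   with [s], and the jump is no border. *)
have nin k : k \in F -> ~~ r (gen s * u) k (gen s * v).
  move=> kF; apply/negP; rewrite -(gen_Kinv s k) gorderE //.
  set k' := _ * k => uk'v.
  have ck' : initial k = Some s by rewrite -(gen_Kinv s k) initial_mulS // clk //
    uk'v !orbT.
  move/F_border: kF => [] [y [/(jump_mul H (gen (letter_inv s)))[]]].
    rewrite -/k'; set y' := _ * y => ky' /(_ v) nv; rewrite ck'.
    rewrite -(gen_Kinv s y) -/y' initial_mulS ?eqxx // clk //.
    by move: ky' nv uk'v; corder_lia co u [:: k'; y'; v].
  rewrite -/k'; set y' := _ * y => ky' /(_ u) nv; rewrite ck'.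
  rewrite -(gen_Kinv s y) -/y' initial_mulS ?eqxx // clk //.
  by move: ky' nv uk'v; corder_lia co u [:: k'; y'; v].
have suv : r (gen s * u) (gen s * h) (gen s * v) by rewrite gorderE.
have suv' : r' (gen s * u) (gen s * h) (gen s * v) by rewrite gorderE // IH.
have nin' k : k \in F -> ~~ r' (gen s * u) k (gen s * v).
  by move=> kF; rewrite agree ?nin //; [exact: FsF'|exact: FF'|exact: FsF'].
(* In both orders [gen s * h] can be replaced by [gen s * u], which belongs to [F']. *)
rewrite (same_gap co suv (nin _ eF) (nin _ fF)).
rewrite (same_gap co' suv' (nin' _ eF) (nin' _ fF)).
by rewrite agree //; [exact: FF'|exact: FsF'|exact: FF'].
Qed.

(* Without a jump inside, the arc from g1 to g2 consists of elements with the
   same first letter, so 1 is outside and can replace g3. *)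
Lemma rigid_step g1 g2 g3 :
  (forall h1 h2 h3, (len h1 + len h2 + len h3 < len g1 + len g2 + len g3)%N ->
    r h1 h2 h3 -> r' h1 h2 h3) ->
  ~ (exists2 y, y \in F & y = g2 \/ r g1 y g2) -> r g1 g2 g3 -> r' g1 g2 g3.
Proof.
move=> IH nQ r123; have [g12 g23 g13] := corder_neq co r123.
have clk k : (k == g2) || r g1 k g2 -> initial k = initial g1.
  move=> kP; apply/eqP; apply: contraT; rewrite eq_sym => /sep_r[y yF yP].
  case: nQ; exists y => //.
  have {}yP : (y == k) || r g1 y k by case: yP => ->; rewrite ?eqxx ?orbT.
  suff /orP[/eqP|] : (y == g2) || r g1 y g2 by [left|right].
  by move: yP kP; corder_lia co g1 [:: y; k; g2].
have c12 : initial g2 = initial g1 by rewrite clk ?eqxx.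
case c1: (initial g1) => [s|]; last first.
  by move: g12; rewrite (initial_None c1) (initial_None (etrans c12 c1)) eqxx.
rewrite c1 in c12.
have [[_ l1] [_ l2]] := (initial_Some c1, initial_Some c12).
have g1n : g1 != 1 by apply/eqP => e; rewrite e initial1 in c1.
have g2n : g2 != 1 by apply/eqP => e; rewrite e initial1 in c12.
have r121 : r g1 g2 1.
  have : ~~ r g1 1 g2 by apply/negP => h; have := clk 1;
    rewrite h orbT c1 => /(_ isT).
  by move: g12 g1n g2n; corder_lia co g1 [:: g2; 1%g].
(* Cancelling [s] shortens [g1] and [g2] by one letter each and turns 1 into a single letter, so the
   total length drops. *)
have r121' : r' g1 g2 1.
  rewrite -(gorderE H' (gen (letter_inv s))); apply: IH; last by rewrite gorderE.
  by rewrite mulg1 len_gen; move: l1 l2; rewrite /len; lia.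
have [c3|c3] := eqVneq (initial g3) (Some s).
  have [_ l3] := initial_Some c3.
  rewrite -(gorderE H' (gen (letter_inv s))); apply: IH; last by rewrite gorderE.
  by move: l1 l2 l3; rewrite /len; lia.
have [->//|g3n] := eqVneq g3 1.
(* Choose [Y] in [F] after [g2] and not beyond 1 or [g3], then [X] before [g1] and not before 1 or
   [g3]. The arc from [X] to [Y] contains [g1] and [g2] but neither 1 nor [g3]. By [location] this
   also holds for [r'], where [g3] can therefore replace 1. *)
have [] : exists2 Y, Y \in F & (Y == g3) || r g2 Y g3 /\ (Y == 1) || r g2 Y 1.
  have [y yF yP] : exists2 y, y \in F & y = g3 \/ r g2 y g3 by apply: sep_r;
    rewrite c12 eq_sym.
  have [y' yF' yP'] : exists2 y, y \in F & y = 1 \/ r g2 y 1 by apply: sep_r;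
    rewrite c12.
  have {}yP : (y == g3) || r g2 y g3 by case: yP => ->; rewrite ?eqxx ?orbT.
  have {}yP' : (y' == 1) || r g2 y' 1 by case: yP' => ->; rewrite ?eqxx ?orbT.
  have [c|c] := boolP ((y' == y) || r g2 y y').
    exists y => //; split => //.
    by move: c yP yP' g2n g23; corder_lia co g2 [:: y; y'; g3; 1%g].
  exists y' => //; split => //.
  by move: c yP yP' g2n g23; corder_lia co g2 [:: y; y'; g3; 1%g].
move=> Y YF [Y3 Y1].
have [] : exists2 X, X \in F & (X == g3) || r g3 X g1 /\ (X == 1) || r 1 X g1.
  have [y yF yP] : exists2 y, y \in F & y = g3 \/ r g3 y g1 by apply: sep_l;
    rewrite c1.
  have [y' yF' yP'] : exists2 y, y \in F & y = 1 \/ r 1 y g1 by apply: sep_l;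
    rewrite c1.
  have {}yP : (y == g3) || r g3 y g1 by case: yP => ->; rewrite ?eqxx ?orbT.
  have {}yP' : (y' == 1) || r 1 y' g1 by case: yP' => ->; rewrite ?eqxx ?orbT.
  have [c|c] := boolP ((y' == y) || r y' y g1).
    exists y => //; split => //.
    by move: c yP yP' g1n g13; corder_lia co g1 [:: y; y'; g3; 1%g].
  exists y' => //; split => //.
  by move: c yP yP' g1n g13; corder_lia co g1 [:: y; y'; g3; 1%g].
move=> X XF [X3 X1].
have Xg1Y : r X g1 Y by move: r123 r121 X3 X1 Y3 Y1 g3n; corder_lia co g1 [:: g2; g3;
  1%g; X; Y].
have Xg2Y : r X g2 Y by move: r123 r121 X3 X1 Y3 Y1 g3n; corder_lia co g1 [:: g2; g3;
  1%g; X; Y].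
have n3 : ~~ r X g3 Y by move: r123 r121 X3 X1 Y3 Y1 g3n; corder_lia co g1 [:: g2;
  g3; 1%g; X; Y].
have n1 : ~~ r X 1 Y by move: r123 r121 X3 X1 Y3 Y1 g3n; corder_lia co g1 [:: g2; g3;
  1%g; X; Y].
move: Xg1Y Xg2Y n3 n1; rewrite -!location // => Xg1Y Xg2Y n3 n1.
by move: Xg1Y Xg2Y n3 n1 r121' g13 g23; corder_lia co' X [:: g1; g2; g3; 1%g; Y].
Qed.

(** Induction on the total length. If one of the three arcs contains no point of [F], [rigid_step]
    applies after a rotation. Otherwise three points of [F] interlace with [g1], [g2], [g3], and
    [location] carries this pattern over to [r']. *)
Lemma rigid_imp g1 g2 g3 : r g1 g2 g3 -> r' g1 g2 g3.
Proof.
have [m] := ubnP (len g1 + len g2 + len g3)%N.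
elim: m g1 g2 g3 => // m IH g1 g2 g3; rewrite ltnS => lem r123.
pose Q g h := exists2 y, y \in F & y = h \/ r g y h.
have IH' h1 h2 h3 : (len h1 + len h2 + len h3 < len g1 + len g2 + len g3)%N ->
    r h1 h2 h3 -> r' h1 h2 h3 by move=> lh; apply: IH; lia.
have [q1|] := pselect (Q g1 g2); last by move=> nq; exact: (rigid_step IH').
have [q2|nq] := pselect (Q g2 g3); last first.
  rewrite (rot_E _ _ _ co'); apply: (rigid_step _ nq);
    last by rewrite -(rot_E _ _ _ co).
  by move=> h1 h2 h3 lh; apply: IH'; lia.
have [q3|nq] := pselect (Q g3 g1); last first.
  rewrite -(rot_E _ _ _ co'); apply: (rigid_step _ nq);
    last by rewrite (rot_E _ _ _ co).
  by move=> h1 h2 h3 lh; apply: IH'; lia.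
have QE g h : Q g h -> exists2 y, y \in F & (y == h) || r g y h.
  by move=> [y yF yP]; exists y => //; case: yP => ->; rewrite ?eqxx ?orbT.
have [[y1 F1 p1] [y2 F2 p2] [y3 F3 p3]] := And3 (QE _ _ q1) (QE _ _ q2) (QE _ _ q3).
have F3' y : y \in F -> y \in F' by rewrite mem_cat => ->.
have e1 : r' y1 y2 y3.
  by rewrite agree ?F3' //; move: p1 p2 p3 r123; corder_lia co g1 [:: g2; g3; y1; y2;
    y3].
have e2 : (g1 == y3) || r' y3 g1 y1.
  by rewrite location //; move: p1 p2 p3 r123; corder_lia co g1 [:: g2; g3; y1; y2;
    y3].
have e3 : (g2 == y1) || r' y1 g2 y2.
  by rewrite location //; move: p1 p2 p3 r123; corder_lia co g1 [:: g2; g3; y1; y2;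
    y3].
have e4 : (g3 == y2) || r' y2 g3 y3.
  by rewrite location //; move: p1 p2 p3 r123; corder_lia co g1 [:: g2; g3; y1; y2;
    y3].
by move: e1 e2 e3 e4; corder_lia co' y3 [:: y1; y2; g1; g2; g3].
Qed.

End Rigidity.

Lemma jump_separated_rigid r : gorder r -> jump_separated r ->
  exists S : seq G, forall r', gorder r' ->
    {in S & &, forall x y z, r' x y z = r x y z} ->
    forall x y z, r' x y z = r x y z.
Proof.
move=> H S; have [F [FP F1]] := border_list H.
exists (F ++ [seq gen s * e | s <- enum {: letter}, e <- F]) => r' H' agree.
have I := rigid_imp H H' S FP F1 agree.
move=> x y z; apply/idP/idP; last exact: I.
move=> r'xyz; have [xy yz xz] := corder_neq (gorder_co H') r'xyz.
have := corder_total (gorder_co H) xy yz xz; case/orP => // /I.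
by rewrite (negPf (corder_asym (gorder_co H') r'xyz)).
Qed.

End Border.

(** * Isolated orders are separated by jumps *)

Lemma cycq_nat (K : realFieldType) (a b c : nat) :
  cycq a%:R%R b%:R%R (c%:R%R : K) = cycn a b c.
Proof. by rewrite /cycq /cycn !ltr_nat. Qed.

Section Suffixes.
Variable n : nat.
Local Notation letter := (letter n).
Local Notation G := (free_group n).
Local Notation gen := (@generator n).
Local Open Scope group_scope.

Implicit Types (s t : letter) (g h x y : G) (r : G -> G -> G -> bool).

Definition gtail g : G := if initial g is Some s then gen (letter_inv s) * g else g.

Lemma gtail_initial s g : initial g = Some s ->
  [/\ g = gen s * gtail g, initial (gtail g) != Some (letter_inv s) & len g = (len
    (gtail g)).+1].
Proof. by move=> E; have [c l] := initial_Some E; rewrite /gtail E gen_Kinv. Qed.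

Lemma len_iter_gtail j g : len (iter j gtail g) = (len g - j)%N.
Proof.
elim: j => [|j IH]; first by rewrite subn0.
rewrite iterS; case E: (initial (iter j gtail g)) => [s|].
  by have [_ _] := gtail_initial E; rewrite IH; lia.
by rewrite /gtail E; move: IH; rewrite (initial_None E) len1; lia.
Qed.

Definition suffixes g : seq G := [seq iter j gtail g | j <- iota 0 (len g).+1].

Lemma suffixesP g h : reflect (exists2 j,
  (j <= len g)%N & h = iter j gtail g) (h \in suffixes g).
Proof.
apply: (iffP mapP) => -[j]; first by rewrite mem_iota => ? ->; exists j => //; lia.
by move=> jg ->; exists j => //; rewrite mem_iota; lia.
Qed.

Lemma suffix_closed_suffixes g : suffix_closed (suffixes g).
Proof.
split.
  apply/suffixesP; exists (len g) => //; apply/esym/initial_None.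
  case E: (initial _) => [s|] //; have [_ _] := gtail_initial E.
  by rewrite len_iter_gtail subnn.
move=> s h hs /suffixesP[j jg e]; apply/suffixesP; exists j.+1.
  by have := len_mulS hs; rewrite e len_iter_gtail; lia.
by rewrite iterS -e /gtail initial_mulS // gen_invK.
Qed.

Lemma suffixes_refl g : g \in suffixes g.
Proof. by apply/suffixesP; exists 0. Qed.

Lemma len_suffixes g h : h \in suffixes g -> (len h <= len g)%N.
Proof. by move=> /suffixesP[j jg ->]; rewrite len_iter_gtail; lia. Qed.

Lemma suffixes_trans g h k : h \in suffixes g -> k \in suffixes h -> k \in suffixes g.
Proof.
move=> /suffixesP[j jg ->] /suffixesP[i]; rewrite len_iter_gtail => ij ->.
by apply/suffixesP; exists (i + j)%N; [lia|rewrite iterD].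
Qed.

Lemma initial_len g : (0 < len g)%N -> exists s, initial g = Some s.
Proof. by case E: (initial g) => [s|]; [exists s|rewrite (initial_None E)]. Qed.

End Suffixes.

(** * Exchanging adjacent elements of a finite tree *)

Section Swap.
Variable n : nat.
Local Notation letter := (letter n).
Local Notation G := (free_group n).
Local Notation gen := (@generator n).
Local Open Scope group_scope.

Implicit Types (s t : letter) (g h k : G).

Variables (r : G -> G -> G -> bool) (N : nat) (q q' : G).
Hypotheses (H : gorder r) (N_gt0 : (0 < N)%N) (cqq : initial q != initial q')
  (lqq : (len q < len q')%N) (lN : (2 * N < len q')%N).

Let co : corder r := gorder_co H.
(** The ball, on which the order is to be kept, is enlarged by [q] and [q'] and what
    suffix-closedness requires. *)
Let P := ball n N ++ (suffixes q ++ suffixes q').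

Hypotheses (empty_arc : forall g, g \in P -> ~~ r q g q')
  (short : forall g, r q g q' -> initial g != initial q -> (len q' <= len g)%N).

(* y j and x j are q' and q translated by the inverse of v j, the prefix of
   length j of q' *)
Let y j := iter j (@gtail n) q'.
Let x := fix x j : G :=
  if j is j'.+1 then
    if initial (y j') is Some t then gen (letter_inv t) * x j' else x j'
  else q.
Let v := fix v j : G :=
  if j is j'.+1 then if initial (y j') is Some t then v j' * gen t else v j' else 1.

Let ly j : len (y j) = (len q' - j)%N. Proof. exact: len_iter_gtail. Qed.

Let yS j t : initial (y j) = Some t -> y j.+1 = gen (letter_inv t) * y j.
Proof. by rewrite /y iterS => E; rewrite {1}/gtail E. Qed.

Let xS j t : initial (y j) = Some t -> x j.+1 = gen (letter_inv t) * x j.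
Proof. by move=> /= ->. Qed.

Let vS j t : initial (y j) = Some t -> v j.+1 = v j * gen t.
Proof. by move=> /= ->. Qed.

Let vy j : v j * y j = q'.
Proof.
elim: j => [|j IH]; first by rewrite /= mul1g.
case E: (initial (y j)) => [t|]; first by rewrite (vS E) (yS E) -mulgA gen_Kinv.
by rewrite /= E /gtail E.
Qed.

Let vx j : v j * x j = q.
Proof.
elim: j => [|j IH]; first by rewrite /= mul1g.
case E: (initial (y j)) => [t|]; first by rewrite (vS E) (xS E) -mulgA gen_Kinv.
by rewrite /= E.
Qed.

Let cly j : (j < len q')%N -> exists t, initial (y j) = Some t.
Proof. by move=> jq; apply: initial_len; rewrite ly; lia. Qed.

(** By induction [x j.+1] starts with the inverse of the letter just deleted from [y j], and
    [y j.+1] cannot start so since [q'] is reduced. *)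
Let clxy j : (j < len q')%N -> initial (x j) != initial (y j).
Proof.
elim: j => [//|j IH] jq; have [t E] := cly (ltnW jq).
have [e1 e2 _] := gtail_initial E; rewrite (xS E) initial_mulS; last first.
  by rewrite letter_invK -E IH // ltnW.
by rewrite eq_sym.
Qed.

Let xS_red j t : (j < len q')%N -> initial (y j) = Some t ->
  initial (x j) != Some (letter_inv (letter_inv t)).
Proof. by move=> jq E; rewrite letter_invK -E clxy. Qed.

Let lx j : (j <= len q')%N -> len (x j) = (len q + j)%N.
Proof.
elim: j => [|j IH] jq; first by rewrite addn0.
have [t E] := cly jq; rewrite (xS E) len_mulS ?IH ?addnS //; first exact: ltnW.
exact: xS_red.
Qed.

Let P_closed : suffix_closed P.
Proof. by do 2?apply: suffix_closed_cat;
  [exact: suffix_closed_ball|exact: suffix_closed_suffixes|exact: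
    suffix_closed_suffixes]. Qed.

Let inP g : g \in P -> [\/ (len g <= N)%N, g \in suffixes q | g \in suffixes q'].
Proof. by rewrite !mem_cat mem_ball => /or3P. Qed.

Let yP j : (j <= len q')%N -> y j \in P.
Proof. by move=> jq; rewrite !mem_cat; apply/or3P; constructor 3; apply/suffixesP;
  exists j. Qed.

(** The indices of the pairs contained in [P]: [y j] is there as a suffix of [q'], so only [x j] is
    tested. They form an initial segment. *)
Let K j : bool := (j <= len q')%N && (x j \in P).

Let K_le j : K j -> (j <= len q')%N. Proof. by case/andP. Qed.
Let K_P j : K j -> x j \in P. Proof. by case/andP. Qed.

Let K_pred j : K j.+1 -> K j.
Proof.
move=> /andP[jq xP]; have [t E] := cly jq; apply/andP; split; first exact: ltnW.
move: xP; rewrite (xS E); apply: P_closed.2; exact: xS_red.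
Qed.

Let K_down i j : (i <= j)%N -> K j -> K i.
Proof.
elim: j => [|j IH]; first by rewrite leqn0 => /eqP->.
by rewrite leq_eqVlt => /orP[/eqP->//|] ij /K_pred; exact: IH.
Qed.

(** The difference of the lengths drops by two at each step. An [x j.+1] at least as long as
    [y j.+1] could belong to [P] only as [y j.+1] or as [y j]; the former would give [q = q'], and
    the latter has another first letter. *)
Let K_len j : K j -> (len (x j) < len (y j))%N.
Proof.
elim: j => [|j IH] Kj; first by rewrite ly subn0.
have := IH (K_pred Kj); have jq := K_le Kj; have [t E] := cly jq.
rewrite !ly !lx //; last exact: ltnW.
move=> ll; have := lx jq; case: (inP (K_P Kj)).
- by move=> ? ?; lia.
- by move=> /len_suffixes ? ?; lia.
move=> /suffixesP[i iq e] lxj; have := len_iter_gtail i q'; rewrite -e lxj => li.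
rewrite ltnNge; apply/negP => nl.
have [i1|i1] : i = j.+1 \/ i = j by lia.
  have xy : x j.+1 = y j.+1 by rewrite /y e i1.
  by move: cqq; rewrite -(vx j.+1) -(vy j.+1) xy eqxx.
have : initial (x j.+1) = initial (y j) by rewrite /y e i1.
rewrite (xS E) initial_mulS ?E; last exact: xS_red.
by case=> /eqP; rewrite (negPf (letter_inv_neq t)).
Qed.

(** The lengths of [x j] and [y j] add up to more than [2 * N], and [y j] is the longer one. So no
    pair lies within the ball. *)
Let K_N j : K j -> (N < len (y j))%N.
Proof.
move=> Kj; have := K_len Kj; have jq := K_le Kj; rewrite lx // ly; lia.
Qed.

Let K_ylt j : K j -> (j < len q')%N.
Proof. by move=> /K_N; rewrite ly; lia. Qed.

Let v_red j t g : (j < len q')%N -> initial (y j) = Some t ->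
  initial g != Some (letter_inv t) ->
  len (v j.+1 * g) = (len g + j.+1)%N /\ initial (v j.+1 * g) = initial q'.
Proof.
elim: j t g => [|j IH] t g jq E gt; rewrite (vS E) -mulgA.
  by rewrite /= mul1g len_mulS ?initial_mulS //; split; [lia|exact: esym].
have [t' E'] := cly (ltnW jq); have [_ c _] := gtail_initial E'.
have {}c : initial (gen t * g) != Some (letter_inv t').
  by rewrite initial_mulS // -E.
by have [-> ->] := IH _ _ (ltnW jq) E' c; rewrite len_mulS //; split=> //; lia.
Qed.

(* If some suffix were caught between x_(j+1) and y_(j+1), translating it back
   to the arc from q to q' would contradict the minimality of the length of q'. *)
Let K_adj j : K j -> forall g, g \in P -> ~~ r (x j) g (y j).
Proof.
elim/ltn_ind: j => -[|j] IH Kj; first exact: empty_arc.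
have jq : (j < len q')%N by exact: K_le.
have [t E] := cly jq; have Kj' := K_pred Kj.
(* If [g] starts with the inverse of [t], multiplying by [t] leads to the previous arc, which is
   empty. Otherwise [v j.+1 * g] is reduced, lies between [q] and [q'], and [short] bounds its
   length. *)
have A g : g \in P -> r (x j.+1) g (y j.+1) -> (len (y j.+1) <= len g)%N.
  move=> gP rg; have gt : initial g != Some (letter_inv t).
    apply/eqP => c; have [c1 _] := initial_Some c.
    have tgP : gen t * g \in P.
      by apply: (P_closed.2 (letter_inv t)); rewrite ?gen_invK //;
        rewrite letter_invK in c1 *.
    move: (IH j (ltnSn j) Kj' _ tgP); rewrite -(gorderE H (gen (letter_inv t))).
    by rewrite -(xS E) -(yS E) gen_invK rg.
  have [l c] := v_red jq E gt.
  have : r q (v j.+1 * g) q' by rewrite -(vx j.+1) -(vy j.+1) gorderE.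
  by move/short; rewrite c eq_sym cqq l ly => /(_ isT); lia.
move=> g gP; apply/negP => rg; have lg := A _ gP rg.
have Kl := K_len Kj; have KN := K_N Kj; have lxj := lx (K_le Kj).
case: (inP gP) => [|/len_suffixes|/suffixesP[i iq e]]; [lia|lia|].
have lgi := len_iter_gtail i q'; rewrite -e in lgi.
have [i1|ij] : i = j.+1 \/ (i <= j)%N by rewrite ly in lg; lia.
  by have [_ + _] := corder_neq co rg; rewrite e i1 eqxx.
(* Now [g] is [y i] with [i <= j]. Its partner [x i] is adjacent to it in [P], hence lies in the
   same arc, but it is too short for that. *)
have Ki := K_down ij Kj'; have ai := IH i ij Ki.
have lxi := lx (K_le Ki).
have xX : x i != x j.+1 by apply/eqP => h; rewrite h in lxi; lia.
have xy : x i != y i by apply/eqP => h; have := K_len Ki; rewrite h ltnn.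
have : r (x j.+1) (x i) (y j.+1).
  move: (ai _ (K_P Kj)) rg xX xy; rewrite e -/(y i).
  by corder_lia co (x j.+1) [:: x i; y i; y j.+1].
by move/A => /(_ (K_P Ki)); move: lxi lxj Kl ij; clear; lia.
Qed.

Let xy_neq i j : K i -> K j -> x i != y j.
Proof.
move=> Ki Kj; apply/eqP => e.
have := (K_len Ki, K_len Kj); have := congr1 len e.
rewrite !ly !lx; try exact: K_le.
by move=> ? [? ?]; case: (leqP i j) => ?; lia.
Qed.

Let x_inj i j : K i -> K j -> x i = x j -> i = j.
Proof. by move=> Ki Kj /(congr1 len); rewrite !lx; try exact: K_le; lia. Qed.

Let y_inj i j : K i -> K j -> y i = y j -> i = j.
Proof.
move=> Ki Kj /(congr1 len); rewrite !ly; have := K_le Ki; have := K_le Kj; lia.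
Qed.

Let paired g h : Prop := exists2 j,
  K j & (g = x j /\ h = y j) \/ (g = y j /\ h = x j).

Let paired_sym g h : paired g h -> paired h g.
Proof. by case=> j Kj [] [-> ->]; exists j => //; [right|left]. Qed.

Let paired_fun g h h' : paired g h -> paired g h' -> h = h'.
Proof.
case=> i Ki [] [-> ->] [j Kj] [] [].
- by move=> /(x_inj Ki Kj)-> ->.
- by move=> /eqP; rewrite (negPf (xy_neq Ki Kj)).
- by move=> /esym/eqP; rewrite (negPf (xy_neq Kj Ki)).
- by move=> /(y_inj Ki Kj)-> ->.
Qed.

Let paired_P g h : paired g h -> g \in P.
Proof. by case=> j Kj [] [-> _]; [exact: K_P|apply: yP; exact: K_le]. Qed.

Let paired_neq g h : paired g h -> g != h.
Proof. by case=> j Kj [] [-> ->]; rewrite 1?[y j == _]eq_sym xy_neq. Qed.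

(* The new order is the old one composed with the involution exchanging x j and
   y j for all j with K j. It still is partially invariant because a letter maps
   such a pair within P only to another such pair. *)
Let sigma g : G := if pselect (exists h,
  paired g h) is left e then sval (cid e) else g.

Let sigmaP g : paired g (sigma g) \/ (sigma g = g /\ forall h, ~ paired g h).
Proof.
rewrite /sigma; case: pselect => [e|ne]; first by left; exact: svalP (cid e).
by right; split=> // h ph; apply: ne; exists h.
Qed.

Let sigma_paired g h : paired g h -> sigma g = h.
Proof. by move=> gh; case: (sigmaP g) => [p|[_ /(_ h)]//];
  exact: paired_fun p gh. Qed.

Let sigmaK : involutive sigma.
Proof.
move=> g; case: (sigmaP g) => [p|[e _]]; last by rewrite !e.
by rewrite (sigma_paired (paired_sym p)).
Qed.

Let sigma_P g : g \in P -> sigma g \in P.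
Proof. by move=> gP; case: (sigmaP g) => [/paired_sym/paired_P//|[-> _]]. Qed.

(** Adjacent elements have the same position relative to all others in [P]. *)
Let swap1 g g' a b : paired g g' -> a \in P -> b \in P ->
  a != g -> a != g' -> b != g -> b != g' -> r g a b = r g' a b.
Proof.
case=> j Kj [] [-> ->] aP bP; move: (K_adj Kj aP) (K_adj Kj bP);
by corder_lia co (x j) [:: y j; a; b].
Qed.

Let swap_sigma g a b : g \in P -> a \in P -> b \in P -> a != g -> b != g ->
  ~ paired g a -> ~ paired g b -> r (sigma g) a b = r g a b.
Proof.
move=> gP aP bP ag bg pa pb; case: (sigmaP g) => [p|[-> _]//].
apply/esym/swap1 => //; apply/eqP => e; first by apply: pa; rewrite e.
by apply: pb; rewrite e.
Qed.

Let rotr a b c : r a b c = r b c a. Proof. exact: rot_E. Qed.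

Let unpaired_sigma g h : ~ paired g h -> ~ paired (sigma g) h \/ h = g.
Proof.
move=> gh; case: (sigmaP g) => [p|[-> _]]; last by left.
have [p'|] := pselect (paired (sigma g) h); last by left.
by right; exact: paired_fun p' (paired_sym p).
Qed.

Let r_unpaired g h k : g \in P -> h \in P -> k \in P ->
  g != h -> h != k -> g != k -> ~ paired g h -> ~ paired h k -> ~ paired g k ->
  r (sigma g) (sigma h) (sigma k) = r g h k.
Proof.
move=> gP hP kP gh hk gk pgh phk pgk.
have inj := inj_eq (inv_inj sigmaK).
have ns a b : a != b -> ~ paired a b -> sigma a != b.
  move=> ab pab; case: (sigmaP a) => [p|[-> _]//].
  by apply/eqP => e; apply: pab; rewrite -e.
have np a b : a != b -> ~ paired a b -> ~ paired (sigma a) b.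
  by move=> ab pab; case: (unpaired_sigma pab) => // e; rewrite e eqxx in ab.
have nps a b : a != b -> ~ paired a b -> ~ paired (sigma a) (sigma b).
  move=> ab pab p; apply: (np b (sigma a)); last exact: paired_sym.
    by rewrite eq_sym ns.
  by move=> p'; apply: (np _ _ ab pab); exact: paired_sym.
have ps a b : ~ paired a b -> ~ paired b a by move=> p /paired_sym.
have nps' a b : a != b -> ~ paired a b -> ~ paired a (sigma b).
  by move=> ab pab /paired_sym; apply: np; [rewrite eq_sym|exact: ps].
have e1 : r (sigma g) (sigma h) (sigma k) = r g (sigma h) (sigma k).
  by apply: swap_sigma; rewrite ?sigma_P ?ns //; try exact: nps'; try exact: ps;
    rewrite eq_sym.
have e2 : r (sigma h) (sigma k) g = r h (sigma k) g.
  by apply: swap_sigma; rewrite ?sigma_P ?ns //; try exact: nps'; try exact: ps;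
    rewrite eq_sym.
have e3 : r (sigma k) g h = r k g h by apply: swap_sigma => //; exact: ps.
by rewrite e1 rotr e2 rotr e3 rotr.
Qed.

(** Moving the third point to its partner has no effect, while exchanging [g] and [h] reverses the
    triple. *)
Let r_paired g h k : k \in P -> paired g h -> k != g -> k != h ->
  r (sigma g) (sigma h) (sigma k) = ~~ r g h k.
Proof.
move=> kP gh kg kh; have gP := paired_P gh; have hP := paired_P (paired_sym gh).
rewrite (sigma_paired gh) (sigma_paired (paired_sym gh)).
have ng : ~ paired k g by move=> p; have := paired_fun gh (paired_sym p) => e;
  rewrite e eqxx in kh.
have nh : ~ paired k h by move=> p;
  have := paired_fun (paired_sym gh) (paired_sym p) => e; rewrite e eqxx in kg.
rewrite -rotr swap_sigma // 1?eq_sym //.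
by move: kg kh (paired_neq gh); corder_lia co g [:: h; k].
Qed.

Let lenP g : g \in P -> (len g <= len q')%N.
Proof.
by move=> /inP[?|/len_suffixes ?|/len_suffixes]//; lia.
Qed.

(** A letter that deletes the first letter of [y j] leads to pair [j.+1], and the one that restores
    the letter deleted last leads to the preceding pair. Any other letter takes [y j] out of [P]:
    the product is too long for the ball and for a suffix of [q], and is no suffix of [q']. *)
Let paired_gen s g h : paired g h -> gen s * g \in P -> gen s * h \in P ->
  paired (gen s * g) (gen s * h).
Proof.
have W j : K j -> gen s * x j \in P -> gen s * y j \in P ->
    paired (gen s * x j) (gen s * y j).
  move=> Kj sxP syP; have jq := K_ylt Kj; have [t E] := cly jq.
  have [st|st] := eqVneq s (letter_inv t).
    rewrite st -(xS E) -(yS E); exists j.+1; last by left.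
    by rewrite /K jq (xS E) -st.
  have l : len (gen s * y j) = (len (y j)).+1.
    rewrite len_mulS // E; apply: contra st => /eqP[->].
    by rewrite letter_invK.
  case: j Kj sxP syP jq E l => [|j] Kj sxP syP jq E l.
    by move: (lenP syP); rewrite l ly; lia.
  have [t' E'] := cly (ltnW jq).
  have [st'|st'] := eqVneq s t'.
    have K' := K_pred Kj.
    by rewrite st' (xS E') (yS E') !gen_Kinv; exists j => //; left.
  have Kl := K_len Kj; have KN := K_N Kj; have lxj := lx (K_le Kj).
  case: (inP syP) => [|/len_suffixes|/suffixesP[i iq e]]; [lia|lia|].
  have li := len_iter_gtail i q'; rewrite -e l ly in li.
  have ij : i = j by lia.
  have [e' _ _] := gtail_initial E'; move: e; rewrite ij -/(y j) e' => /mulIg e.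
  by move: st' (congr1 initial e) => /eqP st' [].
move=> [j Kj] [] [-> ->] sP sP'; first exact: W.
by apply: paired_sym; exact: W.
Qed.

Let paired_genE s g h : g \in P -> h \in P -> gen s * g \in P -> gen s * h \in P ->
  paired (gen s * g) (gen s * h) -> paired g h.
Proof.
move=> gP hP gP' hP' p; have := @paired_gen (letter_inv s) _ _ p.
by rewrite !gen_invK; apply.
Qed.

Let r_sigma_gen s g h k : g \in P -> h \in P -> k \in P ->
  gen s * g \in P -> gen s * h \in P -> gen s * k \in P ->
  r (sigma g) (sigma h) (sigma k) ->
  r (sigma (gen s * g)) (sigma (gen s * h)) (sigma (gen s * k)).
Proof.
move=> gP hP kP gP' hP' kP' rs.
have [gh hk gk] : [/\ g != h, h != k & g != k].
  by have [] := corder_neq co rs; rewrite !(inj_eq (inv_inj sigmaK)).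
have gI := inj_eq (mulgI (gen s)).
have C a b c : a \in P -> b \in P -> c \in P ->
    gen s * a \in P -> gen s * b \in P -> gen s * c \in P -> c != a -> c != b ->
    paired a b -> r (sigma a) (sigma b) (sigma c) ->
    r (sigma (gen s * a)) (sigma (gen s * b)) (sigma (gen s * c)).
  move=> aP bP cP aP' bP' cP' ca cb ab.
  rewrite (r_paired cP ab) // (r_paired cP' (paired_gen ab aP' bP')) ?gI //.
  by rewrite gorderE.
have [p1|n1] := pselect (paired g h); first by apply: C; rewrite 1?eq_sym.
have [p2|n2] := pselect (paired h k).
  by rewrite rotr; apply: C => //; rewrite -rotr.
have [p3|n3] := pselect (paired g k).
  rewrite -rotr; apply: C => //; first by rewrite eq_sym.
    exact: paired_sym.
  by rewrite rotr.
have nP a b : a \in P -> b \in P -> gen s * a \in P -> gen s * b \in P ->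
    ~ paired a b -> ~ paired (gen s * a) (gen s * b).
  by move=> aP bP aP' bP' nab /paired_genE; auto.
by move: rs; rewrite !r_unpaired ?gorderE ?gI //; apply: nP.
Qed.

Lemma swap_gorder : exists r' : G -> G -> G -> bool,
  [/\ gorder r', {in ball n N & &, forall g h k, r' g h k = r g h k} &
      exists k, r' q q' k != r q q' k].
Proof.
have [f [_ fi fr]] := corder_rank co 1 P.
have P1 g : g \in P -> g \in 1 :: P by rewrite inE => ->; rewrite orbT.
have C : local_order P (fun g => ((f (sigma g))%:R)%R).
  split => //.
    move=> g h gP hP /eqP; rewrite Num.Theory.eqr_nat -fi ?P1 ?sigma_P //.
    by rewrite (inj_eq (inv_inj sigmaK)) => /eqP.
  move=> s g h k gP hP kP gP' hP' kP'; rewrite !cycq_nat -!fr ?P1 ?sigma_P //.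
  exact: r_sigma_gen.
have [r' H' r'E] := local_order_gorder C; exists r'.
have {}r'E g h k : g \in P -> h \in P -> k \in P ->
  r' g h k = r (sigma g) (sigma h) (sigma k).
  by move=> gP hP kP; rewrite r'E // cycq_nat -fr ?P1 ?sigma_P.
have BP g : g \in ball n N -> g \in P by rewrite mem_cat => ->.
split=> //.
  have np g h : g \in ball n N -> h \in ball n N -> ~ paired g h.
    by rewrite !mem_ball => lg lh [j /K_N Kj] [] [e1 e2]; move: lg lh; rewrite e1 e2;
      lia.
  move=> g h k gB hB kB; rewrite r'E ?BP //.
  have e3 a c : (r a a c = false) * (r a c a = false) * (r c a a = false).
    by do !split; apply/negP => /(corder_neq co)[]; rewrite ?eqxx.
  have [->|gh] := eqVneq g h; first by rewrite !e3.
  have [->|hk] := eqVneq h k; first by rewrite !e3.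
  have [->|gk] := eqVneq g k; first by rewrite !e3.
  by apply: r_unpaired; rewrite ?BP //; exact: np.
have K0 : K 0 by rewrite /K /= !mem_cat suffixes_refl orbT.
have p : paired q q' by exists 0 => //; left.
(* Every triple containing [q] and [q'] is reversed, so any third point of [P] will do: 1, or a
   single letter if [q] is 1. *)
suff [k [kP kq kq']] : exists k, [/\ k \in P, k != q & k != q'].
  by exists k; rewrite r'E ?(paired_P p) ?(paired_P (paired_sym p)) // r_paired //;
    case: (r _ _ _).
have [[t E] _] := (cly (j := 0) (leq_ltn_trans (leq0n _) lqq), tt).
have lq'1 : (1 < len q')%N by lia.
have [q1|q1] := eqVneq q 1.
  exists (gen t); rewrite BP ?mem_ball ?len_gen // q1; split=> //.
  by apply/eqP => e; rewrite -e len_gen in lq'1.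
exists 1; rewrite BP ?mem_ball ?len1 // eq_sym q1; split=> //.
by apply/eqP => e; rewrite -e len1 in lq'1.
Qed.

End Swap.

Section Isolated.
Variable n : nat.
Local Notation G := (free_group n).
Local Open Scope group_scope.

Definition determined (r : G -> G -> G -> bool) N : Prop := forall r', gorder r' ->
  {in ball n N & &, forall x y z, r' x y z = r x y z} ->
    forall x y z, r' x y z = r x y z.

Lemma determined_op r N : determined r N -> determined (fun x y z => r x z y) N.
Proof.
move=> D r' H' agree x y z; have := D _ (gorder_op H') => /(_ _ x z y); apply.
by move=> {}x {}y {}z xB yB zB; exact: agree.
Qed.

(** Otherwise let [q'] be a shortest element after [x] and up to [v] with another first letter, and
    [q] its predecessor among [x] and the suffixes of [q']. Exchanging them as above contradicts
    that the ball determines the order. *)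
Lemma initial_constant r N x v : gorder r -> (0 < N)%N -> determined r N ->
  x \in ball n (2 * N) -> x != v ->
  (forall g, g \in ball n (2 * N) -> ~~ ((g == v) || r x g v)) ->
    initial v = initial x.
Proof.
move=> H N0 D xB xv nB; have co := gorder_co H; apply/eqP; apply: contraT => cvx.
pose V g := (g == v) || r x g v.
pose Q m := `[< exists g, [/\ V g, initial g != initial x & len g = m] >].
have exQ : exists m, Q m by exists (len v); apply/asboolP; exists v; rewrite /V eqxx.
case: (ex_minnP exQ) => m /asboolP[q' [Vq' cq' lq'] minm].
have {}minm g : V g -> initial g != initial x -> (len q' <= len g)%N.
  by move=> Vg cg; rewrite lq'; apply: minm; apply/asboolP; exists g.
have lN : (2 * N < len q')%N.
  by rewrite ltnNge -mem_ball; apply/negP => /nB; rewrite -/(V q') Vq'.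
have q'x : q' != x by apply: contraNneq cq' => ->.
pose L := x :: [seq g <- suffixes q' | r x g q'].
have q'L : q' \notin L.
  rewrite inE negb_or q'x mem_filter /=; apply/negP => /andP[/(corder_neq co)[_]].
  by rewrite eqxx.
have [//|q qL qP] := corder_pred co _ q'L.
have qx : q = x \/ [/\ q \in suffixes q', r x q q' & (len q < len q')%N].
  move: qL; rewrite inE mem_filter => /orP[/eqP->|/andP[rx qs]]; first by left.
  right; split=> //; have [j jq e] := suffixesP _ _ qs; rewrite e len_iter_gtail.
  have [_ + _] := corder_neq co rx; rewrite {1}e; case: j jq {e} => [|j] jq;
    first by rewrite eqxx.
  by move=> _; move: jq; clear; lia.
have lB g : g \in ball n (2 * N) -> (len g < len q')%N by rewrite mem_ball; move: lN;
  clear; lia.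
have lq : (len q < len q')%N by case: qx => [->|[]//]; exact: lB.
have q'xq : (q == x) || r x q q' by case: qx => [->|[_ ->]]; rewrite ?eqxx ?orbT.
have Vsub g : r q g q' -> V g && r x g q'.
  rewrite /V => rg; move: rg q'xq Vq' xv q'x; rewrite /V.
  by corder_lia co x [:: q; q'; g; v].
have cq : initial q = initial x.
  case: qx => [->//|[_ rq lt]]; apply/eqP; apply: contraT => cqx.
  have : V q by move: rq Vq'; rewrite /V; corder_lia co x [:: q; q'; v].
  by move/minm => /(_ cqx); rewrite leqNgt lt.
have cqq : initial q != initial q' by rewrite cq eq_sym.
have [||r' [H' agree [k]]] := @swap_gorder _ r N q q' H N0 cqq lq lN; last first.
- by rewrite (D r' H' agree) eqxx.
- by move=> g /Vsub/andP[Vg _]; rewrite cq; exact: minm.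
move=> g gP; apply/negP => rg; have /andP[Vg rxg] := Vsub _ rg.
have gnB : g \notin ball n (2 * N).
  by apply/negP => /nB; rewrite -/(V g) Vg.
have gns : g \notin suffixes q'.
  apply/negP => gs; have gL : g \in L by rewrite inE mem_filter rxg gs orbT.
  have [gq _ _] := corder_neq co rg; rewrite eq_sym in gq.
  by move: (corder_asym co rg); rewrite (qP _ gL gq).
move: gP; rewrite !mem_cat (negPf gns) orbF => /orP[gB|gs].
  by move: gnB gB; rewrite !mem_ball; clear; lia.
case: qx => [qx|[qs _ _]]; last by rewrite (suffixes_trans qs gs) in gns.
by move: gnB (len_suffixes gs) xB; rewrite qx !mem_ball; clear; lia.
Qed.

(** A pair [e], [e'] with different first letters is chosen between [g] and [h] with no element of
    the ball inside. Any element inside would then contradict the constancy of first letters away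
    from the ball, used in both directions. *)
Lemma determined_jump_separated r N : gorder r -> (0 < N)%N -> determined r N ->
  jump_separated r.
Proof.
move=> H N0 D; have co := gorder_co H.
have III x v := initial_constant (x := x) (v := v) H N0 D.
have III' x v := initial_constant (x := x) (v := v) (gorder_op H) N0 (determined_op
  D).
set B := ball n (2 * N) in III III'.
move=> g h gh; have ghn : g != h by apply: contraNneq gh => ->.
(* [e] is the last element before [h] among [g] and the ball elements sharing its first letter; [e']
   is the next ball element, or [h]. *)
pose L1 := g :: [seq b <- B | r g b h && (initial b == initial g)].
have hL1 : h \notin L1.
  rewrite inE negb_or eq_sym ghn mem_filter /=;
    apply/negP => /andP[/andP[/(corder_neq co)[_]]].
  by rewrite eqxx.
have [//|e eL eP] := corder_pred co _ hL1.
have [ge ce] : (e == g) || r g e h /\ initial e = initial g.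
  move: eL; rewrite inE mem_filter => /orP[/eqP->|/andP[/andP[-> /eqP->] _]];
    first by rewrite eqxx.
  by rewrite orbT.
have eh : e != h by apply: contraNneq gh => <-; rewrite ce.
pose L2 := h :: [seq b <- B | r e b h].
have eL2 : e \notin L2.
  rewrite inE negb_or eh mem_filter /=; apply/negP => /andP[/(corder_neq co)[]].
  by rewrite eqxx.
have [//|e' eL' eP'] := corder_succ co _ eL2.
have eh' : (e' == h) || r e e' h.
  by move: eL'; rewrite inE mem_filter => /orP[->//|/andP[-> _]]; rewrite orbT.
have ee : e != e' by apply: contraNneq eL2 => ->.
have ce' : initial e != initial e'.
  rewrite ce; move: eL'; rewrite inE mem_filter => /orP[/eqP->//|/andP[re e'B]].
  rewrite eq_sym; apply/eqP => c.
  have e'L1 : e' \in L1.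
    rewrite inE mem_filter c eqxx e'B !andbT; apply/orP; right.
    by move: ge re; corder_lia co g [:: e; e'; h].
  by move: (eP _ e'L1) re; rewrite eq_sym ee => /(_ isT); corder_lia co e [:: e'; h].
have nB b : b \in B -> ~~ r e b e'.
  move=> bB; apply/negP => rb; have bL2 : b \in L2.
    rewrite inE mem_filter bB andbT; apply/orP; right.
    by move: rb eh'; corder_lia co e [:: b; e'; h].
  have [_ be _] := corder_neq co rb.
  by move: (eP' _ bL2 be) rb; corder_lia co e [:: b; e'].
suff nv v : ~~ r e v e'.
  exists e, e'; split; first by split.
  by case/orP: ge => [/eqP|]; [left|right].
have e0 b : b \in B -> e \notin B -> (b == e) = false by move=> bB eB;
  apply: contraNF eB => /eqP<-.
have e0' b : b \in B -> e' \notin B -> (b == e') = false by move=> bB eB;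
  apply: contraNF eB => /eqP<-.
apply/negP => rv; have [ev ve' _] := corder_neq co rv.
have [eB|eB] := boolP (e \in B).
  have [eB'|eB'] := boolP (e' \in B); last first.
    move: ce'; rewrite (III _ _ eB ee) ?eqxx // => b bB.
    by rewrite e0' // nB.
  move: ce'; rewrite -(III _ _ eB ev); last first.
    move=> b bB; apply/negP => /orP[/eqP e1|rb].
      by move: (nB _ bB); rewrite e1 rv.
    by move: (nB _ bB) rb rv; corder_lia co e [:: b; v; e'].
  rewrite (III' _ _ eB' _) ?eqxx // 1?eq_sym // => b bB.
  apply/negP => /orP[/eqP e1|rb].
    by move: (nB _ bB); rewrite e1 rv.
  by move: (nB _ bB) rb rv; corder_lia co e [:: b; v; e'].
have [eB'|eB'] := boolP (e' \in B).
  move: ce'; rewrite (III' _ _ eB') ?eqxx // 1?eq_sym // => b bB.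
  rewrite e0 //=; apply: contra (nB b bB).
  by corder_lia co e [:: b; e'].
have B0 : B != [::] by apply/eqP => e1; have := mem_ball (2 * N) (1 : G);
  rewrite -/B e1 len1.
(* Neither end is in the ball: the first letter stays constant from the preceding ball element [x]
   to [e] and to [e']. *)
have [x xB xP] := corder_pred co B0 eB.
have xe : x != e by apply: contraNneq eB => <-.
have xe' : x != e' by apply: contraNneq eB' => <-.
have xP' b : b \in B -> ~~ r x b e.
  by move=> bB; apply/negP => rb; have [] := corder_neq co rb;
    rewrite eq_sym => bx _ _;
     move: (xP _ bB bx) rb; corder_lia co x [:: b; e].
have c1 : initial e = initial x by apply: III => // b bB; rewrite e0 //= xP'.
have c2 : initial e' = initial x.
  apply: III => // b bB; rewrite e0' //=; apply/negP => rb.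
  have bx : b != x by have [] := corder_neq co rb; rewrite eq_sym.
  by move: (xP _ bB bx) rb (nB _ bB); corder_lia co x [:: b; e; e'].
by move: ce'; rewrite c1 c2 eqxx.
Qed.

End Isolated.

Local Open Scope classical_set_scope.

(** * The space of circular orders *)

Section Relation.
Variable n : nat.
Local Notation G := (free_group n).
Local Open Scope ring_scope.
Implicit Types c : G * G * G -> sign3.

Definition co_rel c (x y z : G) : bool := co_val c x y z == 1.

Lemma co_val3 c x y z : [\/ co_val c x y z = -1,
  co_val c x y z = 0 | co_val c x y z = 1].
Proof.
rewrite /co_val; case: (c _) => v /=; rewrite !inE => /or3P[] /eqP->;
  [exact: Or31|exact: Or32|exact: Or33].
Qed.

Lemma co_val0 c x y z : is_circular_order c ->
  (co_val c x y z == 0) = [|| x == y, y == z | x == z].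
Proof.
move=> [c0 _ _]; apply/eqP/or3P => [/c0[]->|[]/eqP ?]; rewrite ?eqxx.
- exact: Or31. - exact: Or32. - exact: Or33.
- by apply/c0/Or31. - by apply/c0/Or32. - by apply/c0/Or33.
Qed.

Lemma co_val_swap c x y z : is_circular_order c -> co_val c x z y = - co_val c x y z.
Proof.
move=> C; have [_ cc _] := C; have := cc x y z y.
have -> : co_val c y z y = 0 by apply/eqP; rewrite co_val0 // eqxx !orbT.
have -> : co_val c x y y = 0 by apply/eqP; rewrite co_val0 // eqxx !orbT.
by lia.
Qed.

Lemma co_val_rot c x y z : is_circular_order c -> co_val c y z x = co_val c x y z.
Proof.
move=> C; rewrite (co_val_swap y x z) //; have [_ cc _] := C; have := cc x y x z.
have -> : co_val c x x z = 0 by apply/eqP; rewrite co_val0 // eqxx.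
have -> : co_val c x y x = 0 by apply/eqP; rewrite co_val0 // eqxx !orbT.
lia.
Qed.

Lemma co_rel_gorder c : is_circular_order c -> gorder (co_rel c).
Proof.
move=> C; rewrite /co_rel; split; last first.
  by move=> g x y z /eqP e; apply/eqP; case: C => _ _; exact.
split.
- by move=> x y z; rewrite (co_val_rot x y z).
- by move=> x y z /eqP e; rewrite (co_val_swap x y z) // e.
- move=> x y z w /eqP e1 /eqP e2; have [_ /(_ x y z w)+ _] := C.
  rewrite e1 e2; case: (co_val3 c y z w) => ->; case: (co_val3 c x y w) => -> //; lia.
- move=> x y z xy yz xz; rewrite (co_val_swap x y z) //.
  have := co_val0 x y z C; rewrite (negPf xy) (negPf yz) (negPf xz).
  by case: (co_val3 c x y z) => ->.
Qed.

Lemma co_rel_inj c c' : is_circular_order c -> is_circular_order c' ->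
  (forall x y z, co_rel c x y z = co_rel c' x y z) -> c = c'.
Proof.
move=> C C' E; apply: funext => -[[x y] z]; apply: val_inj.
have := E x y z; have := E x z y;
  rewrite /co_rel (co_val_swap x y z C) (co_val_swap x y z C') => e1 e2.
change (co_val c x y z = co_val c' x y z); move: e1 e2.
by case: (co_val3 c x y z) => ->; case: (co_val3 c' x y z) => ->.
Qed.

Fact sign3_subproof (b1 b2 : bool) :
  (if b1 then 1 else if b2 then -1 else 0 : int) \in [:: -1; 0; 1 : int].
Proof. by case: b1; case: b2. Qed.

Definition co_of (r : G -> G -> G -> bool) (t : G * G * G) : sign3 :=
  let: (x, y, z) := t in
  exist (fun z : int => z \in [:: -1; 0; 1]) _ (sign3_subproof (r x y z) (r x z y)).

Lemma co_of_rel r x y z : co_rel (co_of r) x y z = r x y z.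
Proof. by rewrite /co_rel /co_val /=; case: (r x y z); case: (r x z y). Qed.

(* The orientation cocycle of a linear order is a coboundary. *)
Lemma cycn_sign (a b d : nat) : (if cycn a b d then 1 else if cycn a d b then -1 else
  0 : int)
  = ((a < b)%N : int) - ((b < a)%N : int) + (((b < d)%N : int) - ((d < b)%N : int))
     - (((a < d)%N : int) - ((d < a)%N : int)).
Proof.
rewrite /cycn; case: (ltngtP a b) => // ab; case: (ltngtP b d) => // bd;
  case: (ltngtP a d) => // ad; lia.
Qed.

Lemma co_of_order r : gorder r -> is_circular_order (co_of r).
Proof.
move=> H; have co := gorder_co H; rewrite /is_circular_order /co_val /=; split.
- move=> x y z; split; last first.
    by case=> ->; rewrite (_ : r _ _ _ = false) 1?(_ : r _ _ _ = false) //;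
      apply/negP => /(corder_neq co)[]; rewrite ?eqxx.
  have [->|xy] := eqVneq x y; first by constructor 1.
  have [->|yz] := eqVneq y z; first by constructor 2.
  have [->|xz] := eqVneq x z; first by constructor 3.
  by have := corder_total co xy yz xz; case: (r x y z); case: (r x z y).
- move=> x y z w.
  have [f [_ fi fr]] := corder_rank co x [:: y; z; w].
  rewrite !fr ?inE ?eqxx ?orbT // !cycn_sign; lia.
- move=> g x y z; rewrite !(gorderE H).
  by case: (r x y z); case: (r x z y).
Qed.

End Relation.

Section IsolatedOrder.
Variable n : nat.
Local Notation G := (free_group n).
Local Notation T := {ptws G * G * G -> discrete_topology sign3}.

Lemma nbhs_agree (c : T) (l : seq (G * G * G)) :
  nbhs c [set c' : T | forall t, t \in l -> c' t = c t].
Proof.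
elim: l => [|t l IH]; first by apply: filterS (filterT) => c' _ t.
have N1 : nbhs c [set c' : T | c' t = c t].
  have := @proj_continuous _ (fun _ : G * G * G => discrete_topology sign3) t c.
  by move=> /(_ [set c t]); apply; exact: discrete_set1.
apply: filterS (filterI N1 IH) => c' [/= e H] u; rewrite inE => /orP[/eqP->//|];
  exact: H.
Qed.

(** The sets containing a cylinder around [c] form a filter, which converges to [c] because it does
    so in every coordinate. *)
Lemma nbhs_agreeP (c : T) (V : set T) : nbhs c V ->
  exists l : seq (G * G * G), forall c' : T, (forall t, t \in l -> c' t = c t) ->
    V c'.
Proof.
pose F : set_system T := [set U | exists l : seq (G * G * G), forall c' :
  T, (forall t, t \in l -> c' t = c t) -> U c'].
have FF : Filter F.
  split.
  - by exists [::].
  - move=> U W [l1 H1] [l2 H2]; exists (l1 ++ l2) => c' H; split.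
      by apply: H1 => t gtail; apply: H; rewrite mem_cat gtail.
    by apply: H2 => t gtail; apply: H; rewrite mem_cat gtail orbT.
  - by move=> U W UW [l H]; exists l => c' /H/UW.
suff : F --> c by apply.
apply/cvg_sup => t U; rewrite nbhsE => -[W [[B oB <-] Bc] WU].
by exists [:: t] => c' H; apply: WU; rewrite /= H ?inE.
Qed.

Lemma isolatedP (c : T) : CO G c ->
  (isolated (CO G) c <->
   exists S : seq G, forall r', gorder r' ->
     {in S & &, forall x y z, r' x y z = co_rel c x y z} ->
     forall x y z, r' x y z = co_rel c x y z).
Proof.
move=> C; split=> [[_ [V Vc VC]]|[S HS]].
  have [l Hl] := nbhs_agreeP Vc.
  pose S := flatten [seq [:: t.1.1; t.1.2; t.2] | t <- l].
  exists S => r' H' agree.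
  suff E : co_of r' = c by move=> x y z; rewrite -E co_of_rel.
  have : (V `&` CO G) (co_of r').
    split; last exact: co_of_order.
    apply: Hl => -[[x y] z] gtail; apply: val_inj => /=.
    have inS u : u \in [:: x; y; z] -> u \in S.
      by move=> uu; apply/flattenP; exists [:: x; y; z] => //; apply/mapP;
        exists (x, y, z).
    rewrite !agree ?inS ?inE ?eqxx ?orbT // /co_rel (co_val_swap x y z) //.
    by rewrite [RHS](_ : _ = co_val c x y z) //; case: (co_val3 c x y z) => ->.
  by rewrite VC.
split; first exact: mem_set.
exists [set c' : T | forall t, t \in [seq (xy, z) | xy <- [seq (x, y) | x <- S,
  y <- S], z <- S] -> c' t = c t].
  exact: nbhs_agree.
apply/seteqP; split=> [c' [/= agree C']|_ ->]; last by split.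
apply: co_rel_inj => //; apply: HS; first exact: co_rel_gorder.
move=> x y z xS yS zS; rewrite /co_rel /co_val agree //.
by apply: allpairs_f => //; exact: allpairs_f.
Qed.

End IsolatedOrder.

Local Open Scope ring_scope.

(** * The cyclic order of the circle *)

Section CircleOrder.
Variable R : realType.
Local Notation S1 := (circle R).
Implicit Types (a b t u : R) (x y z : S1).

Lemma circ_eq t u : circ t = circ u <-> t - u \is a Num.int.
Proof.
rewrite -[_ \is a _]/(eq_mod1 t u); split.
  by move=> e; apply/(@eqmodP R (eq_mod1_equiv_rel R)); exact: e.
by move/(@eqmodP R (eq_mod1_equiv_rel R)).
Qed.

Lemma circ_int t m : circ (t + m%:~R) = circ t.
Proof. by apply/circ_eq; rewrite addrAC subrr add0r; apply/intrP; exists m. Qed.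

Lemma circ1 t : circ (t + 1) = circ t.
Proof. exact: (circ_int t 1). Qed.

Lemma circ_surj x : exists t, x = circ t.
Proof. by exists (repr x); rewrite /circ reprK. Qed.

Lemma circ_inj t u : circ t = circ u -> `|t - u| < 1 -> t = u.
Proof.
move=> /circ_eq/intrP[m e]; rewrite e -intr_norm -[1]/(1%:~R) ltr_int => m1.
have m0 : m = 0 by lia.
by apply/eqP; rewrite -subr_eq0 e m0.
Qed.

Lemma circ_lift x a : exists t, x = circ t /\ a <= t < a + 1.
Proof.
have [u ->] := circ_surj x; exists (u - (Num.floor (u - a))%:~R); split.
  by rewrite -rmorphN circ_int.
have := floor_itv (u - a); lra.
Qed.

Definition cord x y z : bool := `[< ccw x y z >].

Lemma ordE x y z : ord x y z = if cord x y z then 1 else if cord x z y then -1 else 0.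
Proof. by []. Qed.

Lemma cord_circ a b t : a < b -> b < t -> t < a + 1 ->
  cord (circ a) (circ b) (circ t).
Proof. by move=> ab bt ta; apply/asboolP; exists a, b, t. Qed.

Lemma cord_lift x y z a : cord x y z -> x = circ a ->
  exists b t, [/\ y = circ b, z = circ t, a < b, b < t & t < a + 1].
Proof.
move=> /asboolP[a' [b' [t' [[h1 h2 h3] [-> -> ->]]]]] /circ_eq/intrP[m e].
exists (b' - m%:~R), (t' - m%:~R); rewrite -rmorphN !circ_int.
by split=> //; rewrite rmorphN; lra.
Qed.

(** The representative in the unit interval from 0; through it the circle inherits the cyclic order
    axioms from the reals. *)
Definition pos x : R := sval (cid (circ_lift x 0)).

Lemma circ_pos x : circ (pos x) = x.
Proof. by have [] := svalP (cid (circ_lift x 0)). Qed.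

Lemma pos_itv x : 0 <= pos x < 1.
Proof. by have [_] := svalP (cid (circ_lift x 0)); rewrite -/(pos x) add0r. Qed.

Lemma pos_inj : injective pos.
Proof. by move=> x y e; rewrite -(circ_pos x) e circ_pos. Qed.

Lemma cordE x y z : cord x y z = cycq (pos x) (pos y) (pos z).
Proof.
have := (pos_itv x, pos_itv y, pos_itv z).
set p := pos x; set q := pos y; set r := pos z => -[[px py] pz].
apply/idP/idP.
  move=> /cord_lift -/(_ p); rewrite circ_pos => /(_ erefl) [b [t [e1 e2 h1 h2 h3]]].
  have eb : b = q \/ b = q + 1.
    have [bq|qb] := leP 1 b; [right|left]; apply: circ_inj;
      rewrite ?circ1 ?circ_pos -?e1 // ltr_norml; lra.
  have et : t = r \/ t = r + 1.
    have [bq|qb] := leP 1 t; [right|left]; apply: circ_inj;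
      rewrite ?circ1 ?circ_pos -?e2 // ltr_norml; lra.
  by rewrite /cycq; apply/or3P; case: eb => eb; case: et => et;
    first [ by exfalso; lra
    | by apply: Or31; apply/andP; split; lra
    | by apply: Or32; apply/andP; split; lra
    | by apply: Or33; apply/andP; split; lra ].
rewrite -(circ_pos x) -(circ_pos y) -(circ_pos z) -/p -/q -/r.
move=> /or3P[]/andP[h1 h2].
- by apply: cord_circ => //; lra.
- by apply/asboolP; exists p, (q + 1), (r + 1); rewrite !circ1; split; split => //;
    lra.
- by apply/asboolP; exists p, q, (r + 1); rewrite !circ1; split; split => //; lra.
Qed.

Lemma cord_corder : corder cord.
Proof.
have C := @cycq_corder R; split.
- by move=> x y z; rewrite !cordE; exact: (corder_rot C).
- by move=> x y z; rewrite !cordE; exact: (corder_asym C).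
- by move=> x y z w; rewrite !cordE; exact: (corder_trans C).
- by move=> x y z xy yz xz; rewrite !cordE; apply: (corder_total C);
    rewrite (inj_eq pos_inj).
Qed.

Lemma circ_neq a b : a < b < a + 1 -> circ a != circ b.
Proof.
move=> ab; apply/eqP => /circ_inj; rewrite ltr_norml => H.
by have := H ltac:(lra); lra.
Qed.

Lemma closed_arcE a b x : a < b < a + 1 ->
  closed_arc (a, b) x <-> [|| x == circ a, x == circ b | cord (circ a) x (circ b)].
Proof.
move=> ab; split=> [[t /= ]|].
  rewrite in_itv /= => /andP[at1 tb] <-.
  have [<-|ta] := eqVneq a t; first by rewrite eqxx.
  have [->|tb'] := eqVneq t b; first by rewrite eqxx orbT.
  by rewrite cord_circ ?orbT //; lra.
case/or3P=> [/eqP->|/eqP->|].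
- by exists a => //=; rewrite in_itv /=; lra.
- by exists b => //=; rewrite in_itv /=; lra.
move=> /cord_lift -/(_ a erefl) [t [u [-> e h1 h2 h3]]].
have bu : u = b by apply: circ_inj; rewrite -?e // ltr_norml; lra.
by exists t => //=; rewrite in_itv /=; lra.
Qed.

Lemma circ_continuous : continuous (@circ R).
Proof. exact: pi_continuous. Qed.

Lemma nbhs_arc p x q : cord p x q -> nbhs x [set t | cord p t q].
Proof.
move=> pxq; rewrite nbhsE; exists [set t | cord p t q] => //; split => //.
rewrite /open /= /quotient_open /=.
rewrite openE => t /= pt; rewrite /interior.
have [b [a' [e1 e2 h1 h2 h3]]] := cord_lift (corder_rot cord_corder pt) erefl.
have : t \in `]a' - 1, b[ by rewrite in_itv /=; lra.
move/near_in_itvoo; apply: filterS => u; rewrite in_itv /= => /andP[u1 u2].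
have -> : p = circ (a' - 1) by rewrite e2 -[in RHS]circ1 subrK.
by rewrite e1; apply: cord_circ => //; lra.
Qed.

Lemma nbhs_arcP x U : nbhs x U -> exists p q, cord p x q /\ forall y, cord p y q ->
  U y.
Proof.
have [a ->] := circ_surj x => nU.
have : nbhs a (@circ R @^-1` U) by exact: circ_continuous.
move=> /nbhs_ballP[e /= e0 eU].
(* The bound 1/4 keeps the arc of half-length [d] below a full turn. *)
pose d := Num.min (e / 2) (1 / 4).
have [d0 d1 de] : [/\ 0 < d, d <= 1/4 & d < e].
  by rewrite /d; split; rewrite ?lt_min ?ge_min ?gt_min; first lra; apply/orP; lra.
exists (circ (a - d)), (circ (a + d)); split; first by apply: cord_circ; lra.
move=> t /cord_lift -/(_ _ erefl) [u [v [-> ev h1 h2 h3]]]; apply: eU.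
have av : a + d = v by apply: circ_inj => //; rewrite ltr_norml; lra.
by rewrite -ball_normE /ball_ /= ltr_norml; lra.
Qed.

End CircleOrder.

(** * Gaps of a dynamical realization *)

Section Homeo.
Variable R : realType.
Local Notation S1 := (circle R).
Implicit Types (x y z : S1) (h : S1 -> S1).

Lemma homeo_cord h x y z : homeo_plus h -> cord (h x) (h y) (h z) = cord x y z.
Proof.
move=> [_ _ /(_ x y z)]; rewrite !ordE.
by case: (cord x y z); case: (cord x z y); case: (cord (h x) _ _);
  case: (cord (h x) _ _).
Qed.

Lemma homeo_inj h : homeo_plus h -> injective h.
Proof. by move=> [_ [f [_ hf _]] _]; exact: can_inj hf. Qed.

Lemma homeo_surj h x : homeo_plus h -> exists y, h y = x.
Proof. by move=> [_ [f [_ _ fh]] _]; exists (f x). Qed.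

(* Every gap of the closure of the orbit is bounded by two points of the orbit
   itself; this is what the midpoints are for. *)
Definition gap_property (G : Type) (o : G -> S1) : Prop :=
  forall x, (forall g, o g <> x) ->
    (exists p q, cord p x q /\ forall g, ~~ cord p (o g) q) ->
  exists g k, cord (o g) x (o k) /\ forall l, ~~ cord (o g) (o l) (o k).

Lemma gap_homeo (G : Type) (o : G -> S1) h : homeo_plus h ->
  gap_property o -> gap_property (h \o o).
Proof.
move=> hh gp x ox [p [q [pxq no]]].
have [[x' ex] [p' ep] [q' eq]] := And3 (homeo_surj x hh) (homeo_surj p hh)
  (homeo_surj q hh).
have [||g [k [gxk nl]]] := gp x'.
- by move=> g e; apply: (ox g); rewrite /= e.
- exists p', q'; rewrite -(homeo_cord p' x' q' hh) ex ep eq; split=> // g.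
  by rewrite -(homeo_cord p' _ q' hh) ep eq no.
exists g, k; rewrite -ex /= homeo_cord //; split=> // l.
by rewrite homeo_cord.
Qed.

End Homeo.

(** * One-sided limits of midpoint sequences on the line *)

Section Records.
Variable R : realType.
Variables (X : R -> Prop) (rk : R -> nat).
Hypothesis rk_inj : forall u v, X u -> X v -> rk u = rk v -> `|u - v| < 1 -> u = v.
Hypothesis mid : forall u, X u -> (2 <= rk u)%N -> exists a b,
  [/\ a < b, u = (a + b) / 2, X a /\ (rk a < rk u)%N, X b /\ (rk b < rk u)%N &
      forall v, a < v < b -> X v -> (rk u <= rk v)%N].

Lemma min_rank (lo hi : R) : (exists2 u, X u & lo < u < hi) ->
  exists u, [/\ X u, lo < u < hi & forall v, X v -> lo < v < hi -> (rk u <= rk v)%N].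
Proof.
move=> [u0 Xu0 u0i].
pose Q m := `[< exists u, [/\ X u, lo < u < hi & rk u = m] >].
have exQ : exists m, Q m by exists (rk u0); apply/asboolP; exists u0.
case: (ex_minnP exQ) => m /asboolP[u [Xu ui um]] mm; exists u; split=> // v Xv vi.
by rewrite um; apply: mm; apply/asboolP; exists v.
Qed.

(* Among the points accumulating at a from the left, a new record is the
   midpoint of an interval that reaches beyond a by at least d, so the record
   after it would have to lie beyond a. *)
Lemma no_left_limit (a d : R) : 0 < d -> ~ X a ->
  (forall e, 0 < e -> exists2 u, X u & a - e < u < a) ->
  (forall u, a < u < a + d -> ~ X u) -> False.
Proof.
move=> d0 nXa acc free.
(* For [d] below 1, points of [X] between [a - d] and [a] are determined by their ranks. *)
wlog d1 : d d0 free / d < 1.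
  move=> W; apply: (W (Num.min d (1/2))).
  - by rewrite lt_min d0; lra.
  - by move=> u /andP[u1]; rewrite -ltrBlDl lt_min => /andP[u2 _]; apply: free; lra.
  - by rewrite gt_min; apply/orP; right; lra.
(* Three successive records, of increasing rank: thus [u3] has rank at least 2 and is a midpoint. *)
have [u1 [Xu1 i1 m1]] := min_rank (acc d d0).
have acc' u : u < a -> exists2 v, X v & u < v < a.
  by move=> ua; have [|v Xv vi] := acc (a - u); [lra|exists v => //; lra].
have [|u2 [Xu2 i2 m2]] := @min_rank u1 a; first by apply: acc'; lra.
have [|u3 [Xu3 i3 m3]] := @min_rank u2 a; first by apply: acc'; lra.
have lt_rk u v : X u -> X v -> a - d < u -> u < v -> v < a -> (rk u <= rk v)%N ->
  (rk u < rk v)%N.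
  move=> Xu Xv u1' uv va; rewrite leq_eqVlt => /orP[/eqP|//] e.
  by have := rk_inj Xu Xv e; rewrite ltr_norml => H; have := H ltac:(lra); lra.
have r12 : (rk u1 < rk u2)%N by apply: lt_rk; rewrite ?m1 //; lra.
have r23 : (rk u2 < rk u3)%N by apply: lt_rk; rewrite ?m2 //; lra.
have [b [c [bc e [Xb rb] [Xc rc] nin]]] :
  exists b c, [/\ b < c, u3 = (b + c) / 2, X b /\ (rk b < rk u3)%N,
    X c /\ (rk c < rk u3)%N &
      forall v, b < v < c -> X v -> (rk u3 <= rk v)%N] by apply: mid => //; lia.
(* As [u3] has least rank between [u2] and [a], the end [c] lies beyond the free interval; and [b]
   is at least [u2], which exceeds [a - d]. Their midpoint [u3] would exceed [a]. *)
have ca : a + d <= c.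
  rewrite leNgt; apply/negP => cd; have [ca|ca|ca] := ltgtP c a.
  - by have := m3 c Xc; rewrite leqNgt rc => H; have := H ltac:(lra).
  - by apply: (free c) => //; lra.
  - by apply: nXa; rewrite -ca.
have ub : u2 <= b.
  by rewrite leNgt; apply/negP => bu; have := nin u2; rewrite leqNgt r23 => H;
    have := H ltac:(lra) Xu2.
lra.
Qed.

End Records.

Lemma no_right_limit (R : realType) (X : R -> Prop) (rk : R -> nat) (a d : R) :
  (forall u v, X u -> X v -> rk u = rk v -> `|u - v| < 1 -> u = v) ->
  (forall u, X u -> (2 <= rk u)%N -> exists a b,
    [/\ a < b, u = (a + b) / 2, X a /\ (rk a < rk u)%N, X b /\ (rk b < rk u)%N &
      forall v, a < v < b -> X v -> (rk u <= rk v)%N]) ->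
  0 < d -> ~ X a ->
  (forall e, 0 < e -> exists2 u, X u & a < u < a + e) ->
  (forall u, a - d < u < a -> ~ X u) -> False.
Proof.
move=> inj mid d0 nXa acc free.
apply: (@no_left_limit _ (fun u => X (- u)) (fun u => rk (- u)) _ _ (- a) d) => //.
- by move=> u v Xu Xv e uv; apply: oppr_inj; apply: inj => //; rewrite -opprD normrN.
- move=> u Xu ru; have [b [c [bc e Hb Hc nin]]] := mid _ Xu ru.
  exists (- c), (- b); rewrite !opprK; split=> //; [lra|lra|].
  by move=> v vi; apply: nin; lra.
- by rewrite opprK.
- move=> e e0; have [u Xu ui] := acc e e0; exists (- u); rewrite ?opprK //; lra.
- by move=> u ui; apply: free; lra.
Qed.

Section Midpoint.
Variables (R : realType) (G : groupType) (rank : G -> nat).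
Variables (c : G * G * G -> sign3) (iota : G -> circle R).
Hypotheses (enum : enumeration rank) (emb : midpoint_embedding c rank iota).

Let rank_inj : injective rank. Proof. by have [] := enum. Qed.
Let iota_inj : injective iota. Proof. by have [] := emb. Qed.

(** Only finitely many points have rank below [m]; those other than [circ b] keep a positive
    distance from it. *)
Lemma isolated_below m (b : R) : exists2 e, 0 < e &
  forall h u, (rank h < m)%N -> iota h <> circ b -> `|u - b| < e -> circ u <> iota h.
Proof.
elim: m => [|m [e e0 H]]; first by exists 1.
have [[h [hm hb]]|nh] := pselect (exists h, rank h = m /\ iota h <> circ b);
  last first.
  exists e => // h u; rewrite ltnS leq_eqVlt => /orP[/eqP hm hb|]; last exact: H.
  by case: nh; exists h.
have [t [et ti]] := circ_lift (iota h) b.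
have tb : t != b by apply/eqP => tb; apply: hb; rewrite et tb.
have tb' : b < t by rewrite lt_neqAle eq_sym tb; case/andP: ti.
pose e' := Num.min e (Num.min (t - b) (b + 1 - t)).
have [h1 h2 h3 h4] : [/\ 0 < e', e' <= e, e' <= t - b & e' <= b + 1 - t].
  by rewrite /e'; split; rewrite ?lt_min ?ge_min ?lexx ?orbT // e0 /=; lra.
exists e' => // k u; rewrite ltnS leq_eqVlt => /orP[/eqP km _|km kb ue]; last first.
  by apply: H => //; apply: lt_le_trans ue h2.
rewrite ltr_norml => ue; have -> : k = h by apply: rank_inj; rewrite km.
rewrite et => eu; have [ut|ut] := ltP u b.
  have : u + 1 = t by apply: circ_inj; rewrite ?circ1 // ltr_norml; lra.
  lra.
have : u = t by apply: circ_inj => //; rewrite ltr_norml; lra.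
lra.
Qed.

(** Otherwise the arc could be prolonged a little beyond [t] without meeting a point of rank below
    [m], and would not be a whole component. *)
Lemma component_endpoint g (a b t : R) m : a < b <= a + 1 -> t = a \/ t = b ->
  connected_component (~` (iota @` [set h | (rank h < m)%N])) (iota g) = @circ R @`
    `]a, b[ ->
  iota g = circ ((a + b) / 2) ->
  exists2 h, iota h = circ t & (rank h < m)%N.
Proof.
move=> ab tab ccE gE; apply: contrapT => nh.
have [e e0 He] := isolated_below m t.
pose e' := Num.min e (b - a).
have [h1 h2 h3] : [/\ 0 < e', e' <= e & e' <= b - a].
  by rewrite /e'; split; rewrite ?lt_min ?ge_min ?lexx ?orbT // e0 /=; lra.
pose a' := Num.min a (t - e'); pose b' := Num.max b (t + e').
have [aa' bb' ta' tb'] : [/\ a' <= a, b <= b', a' <= t - e' & t + e' <= b'].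
  by rewrite /a' /b'; split; rewrite ?ge_min ?le_max lexx ?orbT.
have cover u : a' < u < b' -> a < u < b \/ `|u - t| < e'.
  move=> /andP[]; rewrite gt_min lt_max => /orP u1 /orP u2.
  have [au|ua] := ltP a u; have [ub|bu] := ltP u b; [left|right|right|right];
    rewrite ?au // ltr_norml; case: tab => et; case: u1 => u1; case: u2 => u2; lra.
have conn : connected (@circ R @` `]a', b'[).
  apply: connected_continuous_connected;
    first exact/connected_intervalP/interval_is_interval.
  by apply: continuous_subspaceT; exact: circ_continuous.
have sub : @circ R @` `]a', b'[ `<=` ~` (iota @` [set h | (rank h < m)%N]).
  move=> x [u /= ui <-] [h /= hm hu]; rewrite in_itv /= in ui.
  have [ui'|ut] := cover u ui.
    have : (@circ R @` `]a, b[) (circ u) by exists u => //=; rewrite in_itv.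
    by rewrite -ccE => /connected_component_sub; apply; exists h.
  apply: (He h u hm) => //; last exact: lt_le_trans ut h2.
  by move=> ht; apply: nh; exists h.
have gin : (@circ R @` `]a', b'[) (iota g).
  by rewrite gE; exists ((a + b) / 2) => //=; rewrite in_itv /=; lra.
have : (@circ R @` `]a', b'[) (circ t) by exists t => //=; rewrite in_itv /=; lra.
move/(connected_component_max gin sub conn); rewrite ccE => -[u /=].
rewrite in_itv /= => ui ub; have := circ_inj ub; rewrite ltr_norml => H.
by case: tab => et; have := H ltac:(lra); lra.
Qed.

Let X (u : R) : Prop := exists g, circ u = iota g.
Let rk (u : R) : nat := if pselect (X u) is left e then rank (sval (cid e)) else 0%N.

Let rkE u g : circ u = iota g -> rk u = rank g.
Proof.
move=> e; rewrite /rk; case: pselect => [e'|]; last by case; exists g.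
by congr rank; apply: iota_inj; rewrite -e -(svalP (cid e')).
Qed.

Let rk_inj u v : X u -> X v -> rk u = rk v -> `|u - v| < 1 -> u = v.
Proof.
move=> [g eg] [h eh]; rewrite (rkE eg) (rkE eh) => /rank_inj gh.
by apply: circ_inj; rewrite eg eh gh.
Qed.

Let mid u : X u -> (2 <= rk u)%N -> exists a b,
  [/\ a < b, u = (a + b) / 2, X a /\ (rk a < rk u)%N, X b /\ (rk b < rk u)%N &
      forall v, a < v < b -> X v -> (rk u <= rk v)%N].
Proof.
move=> [g eg]; rewrite (rkE eg) => g2; have [_ _ /(_ g g2)] := emb.
move=> [a0 [b0 [[Ug ab0 ccE0] gE0]]].
(* The given lifts of the endpoints are shifted by an integer so that their midpoint is [u]
   itself. *)
have [m em] : exists m : int, u = (a0 + b0) / 2 + m%:~R.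
  move: gE0; rewrite -eg => /circ_eq/intrP[m em]; exists m; rewrite -em; lra.
pose a := a0 + m%:~R; pose b := b0 + m%:~R.
have ab : a < b <= a + 1 by rewrite /a /b; lra.
have eu : u = (a + b) / 2 by rewrite em /a /b; lra.
have gE : iota g = circ ((a + b) / 2) by rewrite -eu.
have ccE : connected_component (~` (iota @` [set h | (rank h < rank g)%N])) (iota g)
  = @circ R @` `]a, b[.
  rewrite ccE0; apply/seteqP; split=> x [v /=]; rewrite in_itv /= => vi <-.
    by exists (v + m%:~R); rewrite ?circ_int //= in_itv /= /a /b; lra.
  exists (v - m%:~R); first by rewrite /= in_itv /=; move: vi; rewrite /a /b; lra.
  by rewrite -rmorphN circ_int.
exists a, b; split => //.
- by case/andP: ab.
- have [h hE hr] := component_endpoint ab (or_introl erefl) ccE gE.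
  by split; [exists h|rewrite (rkE (esym hE))].
- have [h hE hr] := component_endpoint ab (or_intror erefl) ccE gE.
  by split; [exists h|rewrite (rkE (esym hE))].
move=> v vi [h hv]; rewrite (rkE hv) leqNgt; apply/negP => hr.
have : (@circ R @` `]a, b[) (circ v) by exists v => //=; rewrite in_itv.
by rewrite -ccE => /connected_component_sub; apply; exists h.
Qed.

(** On the line, the ends of the gap around a lift [t] of [x] are the supremum of the orbit lifts
    below [t] and the infimum of those above. An end outside the orbit would be a one-sided limit of
    orbit lifts, which the midpoint rule forbids. *)
Lemma midpoint_gap : (exists g : G, g <> 1%g) -> gap_property iota.
Proof.
move=> [g1 g1n] x nx [p [q [pxq no]]].
have [t et] := circ_surj x.
have [q0 [p1 [eq ep tq qp pt]]] := cord_lift (corder_rot (@cord_corder R) pxq) et.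
pose p0 := p1 - 1.
have ep0 : p = circ p0 by rewrite ep /p0 -[in RHS]circ1 subrK.
have free u : p0 < u < q0 -> ~ X u.
  move=> ui [g gE]; have := no g; rewrite -gE ep0 eq.
  by rewrite cord_circ //; move: ui; rewrite /p0; lra.
have Xt : ~ X t by move=> [g gE]; apply: (nx g); rewrite et gE.
have lifts g a : exists u, circ u = iota g /\ a <= u < a + 1.
  by have [u [eu ui]] := circ_lift (iota g) a; exists u.
pose A := [set u | X u /\ u < t]; pose B := [set u | X u /\ t < u].
have A0 : A !=set0.
  have [u [eu ui]] := lifts g1 (t - 1); exists u; split; [by exists g1|lra].
have B0 : B !=set0.
  have [u [eu ui]] := lifts g1 (t + 1); exists u; split; [by exists g1|lra].
have sA : has_sup A by split=> //; exists t => u [_]; exact: ltW.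
have iB : has_inf B by split=> //; exists t => u [_]; exact: ltW.
set a := sup A; set b := inf B.
have Aa u : A u -> u <= a by move=> Au; exact: (ub_le_sup sA.2).
have bB u : B u -> b <= u by move=> Bu; exact: (ge_inf iB.2).
have ap : a <= p0.
  apply: ge_sup => // u [Xu ut]; rewrite leNgt; apply/negP => pu;
    apply: (free u) => //; lra.
have qb : q0 <= b.
  apply: lb_le_inf => // u [Xu ut]; rewrite leNgt; apply/negP => pu;
    apply: (free u) => //.
  by move: pt; rewrite /p0; lra.
have pt' : p0 < t by rewrite /p0; lra.
have free' u : a < u < b -> ~ X u.
  move=> ui Xu; have [ut|ut|ut] := ltgtP u t.
  - by have := Aa u (conj Xu ut); lra.
  - by have := bB u (conj Xu ut); lra.
  - by apply: Xt; rewrite -ut.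
have Xa : X a.
  apply: contrapT => nXa; apply: (no_left_limit rk_inj mid (a := a) (d := b - a)) =>
    //; first lra.
    move=> e e0; have [u Au ue] := sup_adherent e0 sA; exists u; first by case: Au.
    have := Aa u Au; rewrite le_eqVlt => /orP[/eqP ua|ua]; last by rewrite -/a in ue;
      lra.
    by case: nXa; rewrite -ua; case: Au.
  by move=> u ui; apply: free'; lra.
have Xb : X b.
  apply: contrapT => nXb; apply: (no_right_limit rk_inj mid (a := b) (d := b - a)) =>
    //; first lra.
    move=> e e0; have [u Bu ue] := inf_adherent e0 iB; exists u; first by case: Bu.
    have := bB u Bu; rewrite le_eqVlt => /orP[/eqP ua|ua]; last by rewrite -/b in ue;
      lra.
    by case: nXb; rewrite ua; case: Bu.
  by move=> u ui; apply: free'; lra.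
have [g ga] := Xa; have [k kb] := Xb.
(* A second orbit point keeps the gap from being the circle minus one point. *)
have ba : b < a + 1.
  have [h hg] : exists h, iota h <> iota g.
    have [e|] := pselect (g1 = g); last by exists g1 => /iota_inj.
    by exists 1%g => /iota_inj e1; apply: g1n; rewrite e e1.
  have [u [eu ui]] := lifts h a.
  have ua : a != u by apply/eqP => ua; apply: hg; rewrite -eu -ua ga.
  have ut : t < u.
    have [ut|//|ut] := ltgtP u t.
      have := Aa u (conj (ex_intro _ h eu) ut) => ?; move/eqP: ua; lra.
    by case: Xt; exists h; rewrite -ut.
  by have := bB u (conj (ex_intro _ h eu) ut); lra.
exists g, k; rewrite -ga -kb et; split; first by apply: cord_circ; lra.
move=> l; apply/negP => /cord_lift -/(_ a erefl) [u [v [eu ev h1 h2 h3]]].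
have vb : v = b by apply: circ_inj => //; rewrite ltr_norml; lra.
by apply: (free' u); [lra|exists l].
Qed.

End Midpoint.

(** * From ping-pong to jumps *)

(* What the proof uses of a dynamical realization: an action preserving the
   cyclic order, with a free orbit that induces r and has the gap property. *)
Record ordered_action n (R : realType) (r : free_group n -> free_group n ->
  free_group n -> bool)
    (rho : free_group n -> circle R ->
      circle R) (x0 : circle R) : Prop := OrderedAction {
  oa_order : gorder r;
  oa_one : forall x, rho 1%g x = x;
  oa_mul : forall g h x, rho (g * h)%g x = rho g (rho h x);
  oa_cord : forall g x y z, cord (rho g x) (rho g y) (rho g z) = cord x y z;
  oa_inj : injective (rho^~ x0);
  oa_rel : forall x y z, r x y z = cord (rho x x0) (rho y x0) (rho z x0);
  oa_gap : gap_property (rho^~ x0)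
}.

Lemma realization_action n (R : realType) (c :
  free_group n * free_group n * free_group n -> sign3)
    rho (x0 : circle R) : (0 < n)%N -> is_circular_order c ->
      dynamical_realization c rho x0 ->
  ordered_action (co_rel c) rho x0.
Proof.
case: n c rho => // n c rho _ C [rank [iota [phi [h [enum emb [[phi_h phi_mul]
  phi_iota _] hh [rho_h ->]]]]]].
have phi1 x : phi 1%g x = x.
  by apply: (homeo_inj (phi_h 1%g)); rewrite -phi_mul mulg1.
have oE g : rho g (h (iota 1%g)) = h (iota g) by rewrite rho_h phi_iota mulg1.
have [iota_inj iota_c _] := emb.
split.
- exact: co_rel_gorder.
- by move=> x; have [y <-] := homeo_surj x hh; rewrite rho_h phi1.
- by move=> g k x; have [y <-] := homeo_surj x hh; rewrite !rho_h phi_mul.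
- move=> g x y z; have [[x' <-] [y' <-] [z' <-]] := And3 (homeo_surj x hh)
    (homeo_surj y hh) (homeo_surj z hh).
  by rewrite !rho_h !homeo_cord.
- by move=> g k /=; rewrite !oE => /(homeo_inj hh)/iota_inj.
- move=> x y z; rewrite !oE homeo_cord // /co_rel iota_c ordE.
  by case: (cord (iota x) (iota y) (iota z)); case: (cord (iota x) (iota z) (iota y)).
have -> : rho^~ (h (iota 1%g)) = h \o iota by apply: funext => g; rewrite /= oE.
apply: gap_homeo => //; apply: (midpoint_gap enum emb).
by exists (generator (ord0, false)) => /(congr1 (@initial _)).
Qed.

Section Closedness.
Variable R : realType.
Local Notation S1 := (circle R).

Lemma nbhs_setC1 (x y : S1) : x <> y -> nbhs y (~` [set x]).
Proof.
move=> xy; have [a ea] := circ_surj x; have [t [et ti]] := circ_lift y a.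
have ta : t != a by apply/eqP => e; apply: xy; rewrite ea et e.
have at' : a < t by rewrite lt_neqAle eq_sym ta; case/andP: ti.
have : cord x y (circ ((t + (a + 1)) / 2)) by rewrite ea et; apply: cord_circ; lra.
move/nbhs_arc; apply: filterS => z /= xz zx.
by have [] := corder_neq (@cord_corder R) xz; rewrite zx eqxx.
Qed.

Lemma arcs_closed (D : set S1) y : finite_union_of_closed_arcs D -> ~ D y ->
  nbhs y (~` D).
Proof.
move=> [l lp ->] {D}; elim: l lp => [|[a b] l IH] lp nD.
  by apply: filterS filterT => z _ [p].
have nl : nbhs y (~` \bigcup_(p in [set` l]) closed_arc p).
  apply: IH => [p pl|[p pl py]]; first by apply: lp; rewrite inE pl orbT.
  by apply: nD; exists p => //=; rewrite inE (pl : is_true (p \in l)) orbT.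
have /= ab := lp (a, b) (mem_head _ _).
have na : ~ closed_arc (a, b) y by move=> H; apply: nD; exists (a, b) => //=;
  exact: mem_head.
have co := @cord_corder R.
have na' : nbhs y (~` closed_arc (a, b)).
  have : cord (circ b) y (circ a).
    have /negP : ~ [|| y == circ a,
      y == circ b | cord (circ a) y (circ b)] by move/(closed_arcE _ ab).
    by move: (circ_neq ab); corder_lia co (circ a) [:: circ b; y].
  move/nbhs_arc; apply: filterS => z /= bza /(closed_arcE _ ab).
  by move: bza (circ_neq ab); corder_lia co (circ a) [:: circ b; z].
apply: filterS (filterI na' nl) => z [z1 z2] [p /=];
  rewrite inE => /orP[/eqP->//|pl pz].
by apply: z2; exists p.
Qed.

End Closedness.

Section PingPong.
Variables (n : nat) (R : realType) (r : free_group n -> free_group n ->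
  free_group n -> bool).
Variables (rho : free_group n -> circle R -> circle R) (x0 : circle R).
Hypothesis OA : ordered_action r rho x0.
Variable D : letter n -> set (circle R).
Hypotheses (D_closed : forall s y, ~ D s y ->
  nbhs y (~` D s)) (D_triv : trivIset setT D)
  (D_ping : forall s, rho (generator s) @` (~` D (letter_inv s)) `<=` D s)
  (D_base : (~` \bigcup_s D s) x0).
Local Notation G := (free_group n).
Local Notation o := (fun g => rho g x0).
Let H : gorder r := oa_order OA.
Let co : corder r := gorder_co H.

(** The base point serves as the class of the empty word, so that orbit points are sorted by
    [initial]. *)
Let E (k : option (letter n)) : set (circle R) := if k is Some s then D s else [set
  x0].

Let E_disj k l x : E k x -> E l x -> k = l.
Proof.
case: k l => [s|] [t|] //=.
- by move=> sx tx; congr Some; apply: (D_triv (i := s) (j := t)) => //; exists x.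
- by move=> sx e; case: D_base; exists s => //; rewrite -e.
- by move=> e sx; case: D_base; exists t => //; rewrite -e.
Qed.

Let E_closed k y : ~ E k y -> nbhs y (~` E k).
Proof. by case: k => [s|] /=; [exact: D_closed|move=> ny; apply: nbhs_setC1 => e;
  exact: ny]. Qed.

Let o_E (g : G) : E (initial g) (o g).
Proof.
elim/word_ind: g => [|s g gs IH]; first exact: (oa_one OA).
rewrite initial_mulS //= (oa_mul OA); apply: D_ping; exists (o g) => // sg.
by move: gs; rewrite (E_disj IH (sg : E (Some (letter_inv s)) _)) eqxx.
Qed.

Let o_cl (g : G) k : E k (o g) -> initial g = k.
Proof. by move/(E_disj (o_E g)). Qed.

(** From [o g] towards [o h], let [p] be the supremum of the orbit points in the class of [g], and
    [q] the infimum of the others from there on. Closed disjoint classes force [p < q], and the gap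
    property makes both ends orbit points. *)
Lemma pingpong_jump_separated : jump_separated r.
Proof.
move=> g h gh.
have [a ea] := circ_surj (o g); have [b [eb bi]] := circ_lift (o h) a.
have ab : a < b.
  rewrite lt_neqAle; case/andP: bi => -> _; rewrite andbT; apply/eqP => ab.
  by move: gh; rewrite (oa_inj OA (_ : o g = o h)) ?eqxx // ea eb ab.
pose A := [set u | a <= u <= b /\ exists x, initial x = initial g /\ circ u = o x].
have Aa : A a by split; [lra|exists g].
have sA : has_sup A by split; [exists a|exists b => u [] /andP[]].
set p := sup A.
have Ap u : A u -> u <= p by move=> Au; exact: (ub_le_sup sA.2).
have pb : p <= b by apply: ge_sup; [exists a|move=> u [] /andP[]].
have apx : a <= p by exact: Ap.
have nbhs_lift u (W : set (circle R)) : nbhs (circ u) W ->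
  exists2 e, 0 < e & forall v, `|u - v| < e -> W (circ v).
  move=> nW; have : nbhs u (@circ R @^-1` W) by exact: circ_continuous.
  move=> /nbhs_ballP[e e0 He]; exists e => // v uv; apply: He; rewrite -ball_normE.

have Ep : E (initial g) (circ p).
  apply: contrapT => /E_closed/nbhs_lift[e e0 He].
  have [u Au ue] := sup_adherent e0 sA; have uA := Ap u Au.
  case: Au => _ [x [xg ux]]; apply: (He u); first by rewrite ltr_norml;
    rewrite -/p in ue; lra.
  by rewrite ux -xg; exact: o_E.
have pb' : p < b.
  rewrite lt_neqAle pb andbT; apply/eqP => e; rewrite e -eb in Ep.
  by move: gh; rewrite (o_cl Ep) eqxx.
pose B := [set u | p <= u <= b /\ exists y, initial y != initial g /\ circ u = o y].
have Bb : B b by split; [lra|exists h; rewrite eq_sym].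
have iB : has_inf B by split; [exists b|exists p => u [] /andP[]].
set q := inf B.
have Bq u : B u -> q <= u by move=> Bu; exact: (ge_inf iB.2).
have pq : p <= q by apply: lb_le_inf; [exists b|move=> u [] /andP[]].
have qb : q <= b by exact: Bq.
(* [q] is approached by points of finitely many closed classes, so it lies in one of them. *)
have [k kg Eq] : exists2 k, k != initial g & E k (circ q).
  apply: contrapT => nE.
  have : nbhs (circ q) [set z | forall k, k != initial g -> ~ E k z].
    apply: (@filter_forall _ (option (letter n)) (fun k z => k != initial g ->
      ~ E k z) _ (nbhs_filter _)) => k.
    have [->|kg] := eqVneq k (initial g).
      by apply: filterS filterT => z _.
    have : ~ E k (circ q) by move=> Ek; apply: nE; exists k.
    by move/E_closed; apply: filterS => z Ez _.
  move=> /nbhs_lift[e e0 He].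
  have [u Bu ue] := inf_adherent e0 iB; have uB := Bq u Bu.
  case: Bu => _ [y [yg uy]]; apply: (He u _ (initial y) yg).
    by rewrite ltr_norml; rewrite -/q in ue; lra.
  by rewrite uy; exact: o_E.
have pq' : p < q.
  rewrite lt_neqAle pq andbT; apply/eqP => e; rewrite -e in Eq.
  by rewrite (E_disj Eq Ep) eqxx in kg.
have free u l : p < u < q -> circ u <> o l.
  move=> ui ul; have [lg|lg] := eqVneq (initial l) (initial g).
    by have : A u by [split; [lra|exists l]]; move/Ap; lra.
  by have : B u by [split; [lra|exists l]]; move/Bq; lra.
pose t := (p + q) / 2.
have [||g' [k' [gtk ng]]] := oa_gap OA (x := circ t).
- by move=> l /esym; apply: free; rewrite /t; lra.
- exists (circ p), (circ q); split; first by apply: cord_circ; rewrite /t; lra.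
  move=> l; apply/negP => /cord_lift -/(_ p erefl) [u [v [eu ev h1 h2 h3]]].
  have vq : v = q by apply: circ_inj => //; rewrite ltr_norml; lra.
  by apply: (free u l) => //; lra.
have [q1 [p1 [eq1 ep1 tq1 qp1 pt1]]] := cord_lift (corder_rot (@cord_corder R) gtk)
  erefl.
pose p0 := p1 - 1.
have ep0 : o g' = circ p0 by rewrite ep1 /p0 -[in RHS]circ1 subrK.
have tpq : p < t < q by rewrite /t; lra.
have p0t : p0 < t by rewrite /p0; lra.
have free' u l : p0 < u < q1 -> circ u <> o l.
  move=> ui ul; have := ng l; rewrite -ul ep0 eq1 cord_circ //; rewrite /p0 in ui *;
    lra.
(* The orbit gap around [t] contains the interval from [p] to [q]; it is no larger, since orbit
   points come arbitrarily close to [p] and [q]. *)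
have p0p : p0 <= p.
  by rewrite leNgt; apply/negP => pp; apply: (free p0 g'); [lra|rewrite ep0].
have q1q : q <= q1.
  by rewrite leNgt; apply/negP => pp; apply: (free q1 k'); [lra|rewrite eq1].
have p0E : p0 = p.
  apply/eqP; rewrite eq_le p0p leNgt; apply/negP => pp.
  have [|u Au ue] := @sup_adherent _ A (p - p0) _ sA; first lra.
  have uA := Ap u Au; case: Au => _ [x [_ ux]]; apply: (free' u x) => //.
  by rewrite -/p in ue; lra.
have q1E : q1 = q.
  apply/eqP; rewrite eq_le q1q andbT leNgt; apply/negP => pp.
  have [|u Bu ue] := @inf_adherent _ B (q1 - q) _ iB; first lra.
  have uB := Bq u Bu; case: Bu => _ [x [_ ux]]; apply: (free' u x) => //.
  by rewrite -/q in ue; lra.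
exists g', k'; split; [split; [split|]|].
- apply/eqP => e; have : circ p = circ q by rewrite -p0E -ep0 -q1E -eq1 e.
  by move/circ_inj; rewrite ltr_norml => HH; have := HH ltac:(lra); lra.
- by move=> z; rewrite (oa_rel OA) ng.
- have -> : initial g' = initial g by apply: o_cl; rewrite /= ep0 p0E.
  by rewrite eq_sym (o_cl (k := k)) //= eq1 q1E.
have [pa|pa] := eqVneq p a.
  by left; apply: (oa_inj OA); rewrite /= ep0 p0E ea pa.
right; rewrite (oa_rel OA) ea eb ep0 p0E; apply: cord_circ => //; try lra.
Qed.

End PingPong.

Local Close Scope ring_scope.
Local Close Scope classical_set_scope.

(** * From jumps to ping-pong *)

Section ComplementaryArcs.
Variables (T : eqType) (r : T -> T -> T -> bool) (k : nat) (a b : nat -> T).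
Hypotheses (co : corder r) (k_gt0 : 0 < k).
Hypothesis ab : forall i, i < k -> b i != a i.
Hypothesis disj_a : forall i j, i < k -> j < k -> i != j ->
  [&& a j != b i, a j != a i & ~~ r (b i) (a j) (a i)].
Hypothesis disj_b : forall i j, i < k -> j < k -> i != j ->
  [&& b j != b i, b j != a i & ~~ r (b i) (b j) (a i)].

Definition inU x := exists2 i, i < k & r (b i) x (a i).
(** The closed arc from [a i] to the next [b j], described without naming that [b j]. *)
Definition arc_after i x := forall j, j < k -> ~~ r (a i) (b j) x.

(** Take the last [a i] before [x]: if some [b j] comes between them, the open arc starting at [b j]
    has not ended yet at [x]. *)
Lemma arc_cover x : inU x \/ exists2 i, i < k & arc_after i x.
Proof.
have [/mapP[i]|nx] := boolP (x \in map a (iota 0 k)).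
  rewrite mem_iota add0n => /andP[_ ik] ->; right; exists i => // j _.
  by apply/negP => /(corder_neq co)[_ _]; rewrite eqxx.
have l0 : map a (iota 0 k) != [::] by rewrite -size_eq0 size_map size_iota -lt0n.
have [_ /mapP[i ik ->] iP] := corder_pred co l0 nx.
rewrite mem_iota add0n /= in ik.
have [|nA] := pselect (arc_after i x); first by right; exists i.
left; have [j [jk aj]] : exists j, j < k /\ r (a i) (b j) x.
  by apply: contrapT => nj; apply: nA => j jk; apply/negP => aj; apply: nj; exists j.
exists j => //; have [ji|ji] := eqVneq j i.
  by move: aj; rewrite ji; corder_lia co x [:: a i; b i].
rewrite eq_sym in ji; have /and3P[_ aji _] := disj_a ik jk ji.
have := iP (a j); rewrite map_f ?mem_iota // => /(_ isT aji).
by move: aj; corder_lia co x [:: a i; a j; b j].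
Qed.

Lemma arc_after_inU i x : i < k -> arc_after i x -> ~ inU x.
Proof.
move=> ik Ax [j jk bxa]; move: (Ax j jk) bxa; have [->|ij] := eqVneq j i.
  by corder_lia co x [:: a i; b i].
by move: (disj_a jk ik ij); corder_lia co x [:: a i; a j; b j].
Qed.

Lemma arc_after_uniq i j x : i < k -> j < k -> arc_after i x -> arc_after j x ->
  i = j.
Proof.
move=> ik jk Ai Aj; apply/eqP; apply: contraT => ij.
have ji : j != i by rewrite eq_sym.
move: (Ai j jk) (Aj i ik) (disj_a ik jk ij) (disj_a jk ik ji) (ab ik) (ab jk).
by corder_lia co x [:: a i; a j; b i; b j].
Qed.

Lemma arc_afterE i : i < k -> exists2 m, m < k & a i != b m /\
  forall x, arc_after i x <-> [|| x == a i, x == b m | r (a i) x (b m)].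
Proof.
move=> ik; have nab j : j < k -> a i != b j.
  move=> jk; have [->|ji] := eqVneq j i; first by rewrite eq_sym ab.
  by have /and3P[] := disj_a jk ik ji.
have nx : a i \notin map b (iota 0 k).
  by apply/mapP => -[j]; rewrite mem_iota add0n => /nab/eqP.
have l0 : map b (iota 0 k) != [::] by rewrite -size_eq0 size_map size_iota -lt0n.
have [_ /mapP[m mk ->] mP] := corder_succ co l0 nx.
rewrite mem_iota add0n /= in mk; exists m => //; split; first exact: nab.
move=> x; split=> [/(_ m mk)|xm j jk].
  by move: (nab m mk); corder_lia co x [:: a i; b m].
have [->|jm] := eqVneq (b j) (b m).
  by move: xm (nab m mk); corder_lia co x [:: a i; b m].
have := mP (b j); rewrite map_f ?mem_iota // => /(_ isT jm).
by move: xm (nab m mk); corder_lia co x [:: a i; b m; b j].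
Qed.

End ComplementaryArcs.

Section Words.
Variable n : nat.
Local Notation G := (free_group n).
Local Notation gen := (@generator n).
Local Open Scope group_scope.
Implicit Types x y : G.

Lemma gtail_gen s x : initial x != Some (letter_inv s) -> gtail (gen s * x) = x.
Proof. by move=> xs; rewrite /gtail initial_mulS // gen_invK. Qed.

Lemma iter_gtail_div x y : initial x != initial y ->
  y = iter (len x) (@gtail n) (x^-1 * y).
Proof.
elim/word_ind: x y => [|s x xs IH] y xy; first by rewrite invg1 mul1g.
rewrite initial_mulS // in xy; have ys :
  initial y != Some (letter_inv (letter_inv s)).
  by rewrite letter_invK eq_sym.
rewrite len_mulS // invgM -mulgA -gen_inv iterS -IH ?initial_mulS ?gtail_gen //.
Qed.

(** Right multiplication by a letter acts at the end of a word and reaches the first letter only at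
    or next to 1. *)
Lemma initial_edge x s : x != 1 -> x * gen s != 1 -> initial (x * gen s) = initial x.
Proof.
elim/word_ind: x => [|t x xt IH]; first by rewrite eqxx.
move=> _; rewrite [RHS]initial_mulS // -mulgA => nz.
have [x1|x1] := eqVneq x 1.
  move: nz; rewrite x1 mul1g => nz; apply: initial_mulS;
    apply: contraNneq nz => -[->].
  by rewrite gen_inv mulgV.
have [->|x2] := eqVneq (x * gen s) 1; first by rewrite initial_mulS.
by apply: initial_mulS; rewrite IH.
Qed.

End Words.

(** * Domains built from the gap after 1 *)

Section Domains.
Variables (n : nat) (R : realType) (r : free_group n -> free_group n ->
  free_group n -> bool).
Variables (rho : free_group n -> circle R -> circle R) (x0 : circle R).
Hypotheses (OA : ordered_action r rho x0) (Sep : jump_separated r).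
Variable w : free_group n.
Hypothesis w_border : border r 1%g w.
Local Notation G := (free_group n).
Local Notation gen := (@generator n).
Local Notation o := (fun g => rho g x0).
Local Open Scope group_scope.
Let H : gorder r := oa_order OA.
Let co : corder r := gorder_co H.
Let cc : corder (@cord R) := @cord_corder R.
Let k := len w.
Let q i := iter i (@gtail n) w.
(* inverse of the prefix of length i of w; the gap after gg i ends at q i *)
Let gg i := q i * w^-1.

Let w_neq1 : w != 1. Proof. by case: w_border => -[]; rewrite eq_sym. Qed.

Let k_gt0 : (0 < k)%N.
Proof. by rewrite lt0n; apply: contra w_neq1 => /eqP l0; apply/eqP/initial_None;
  have := l0; rewrite /k /len /initial; case: (word w). Qed.

Let lq i : len (q i) = (k - i)%N. Proof. exact: len_iter_gtail. Qed.

Let qk : q k = 1.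
Proof. by have := lq k; rewrite subnn => l0; apply: initial_None; move: l0;
  rewrite /len /initial; case: (word _). Qed.

Let gg0 : gg 0 = 1. Proof. exact: mulgV. Qed.
Let ggk : gg k = w^-1. Proof. by rewrite /gg qk mul1g. Qed.
Let ggw i : gg i * w = q i. Proof. by rewrite /gg mulgVK. Qed.

Let gg_inj i j : (i <= k)%N -> (j <= k)%N -> gg i = gg j -> i = j.
Proof. by move=> ik jk /mulIg/(congr1 len); rewrite !lq; lia. Qed.

Let cl_q i : (i < k)%N -> exists t, initial (q i) = Some t.
Proof. by move=> ik; apply: initial_len; rewrite lq; lia. Qed.

Let q_neq1 i : (i < k)%N -> q i != 1.
Proof. by move=> /cl_q[t E]; apply/eqP => e; rewrite e in E. Qed.

Let gg_step i t : initial (q i) = Some t -> gg i = gen t * gg i.+1.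
Proof. by move=> E; have [e _ _] := gtail_initial E; rewrite /gg {1}e -mulgA. Qed.

Let jumpE x y : jump r x y -> y = x * w.
Proof.
move=> j; have := jump_mul H x^-1 j; rewrite mulVg => j'.
by rewrite -(jump_uniq H j' w_border.1) mulVKg.
Qed.

(** [w] is the reduced product of [x^-1] and [y], so [x^-1] is a prefix of [w] and [y] the remaining
    suffix. *)
Let borderE x y : border r x y -> exists2 j, (j <= k)%N & x = gg j /\ y = q j.
Proof.
move=> [j c]; have e := jumpE j; have ew : w = x^-1 * y by rewrite e mulKg.
have l := len_mulV c; have y_q := iter_gtail_div c; rewrite -ew in l y_q.
have yq : y = q (len x) by rewrite y_q.
exists (len x); first by rewrite /k l; lia.
by split=> //; rewrite /gg -yq e mulgK.
Qed.

Let gap h x := cord (o h) x (o (h * w)).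

Let o_jump h l : ~~ cord (o h) (o l) (o (h * w)).
Proof.
rewrite -(oa_rel OA) -(mulVKg h l) -{1}(mulg1 h) (gorderE H).
by case: w_border => -[_ ->].
Qed.

Let o_inj g h : (o g == o h) = (g == h).
Proof. exact: (inj_eq (oa_inj OA)). Qed.

Let hw_neq h : h != h * w.
Proof. by rewrite -{1}(mulg1 h) (inj_eq (mulgI h)) eq_sym. Qed.

Let gap_uniq h h' x : gap h x -> gap h' x -> h = h'.
Proof.
move=> g1 g2; apply/eqP; rewrite -o_inj; apply: contraT => hh'.
have : o (h * w) != o (h' * w) by rewrite o_inj (inj_eq (mulIg w)) -o_inj.
move: g1 g2 hh' (o_jump h h') (o_jump h (h' * w)) (o_jump h' h) (o_jump h' (h * w)).
by rewrite /gap; corder_lia cc (o h) [:: o (h * w); o h'; o (h' * w); x].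
Qed.

Let gap_orbit h l : ~ gap h (o l). Proof. exact/negP/o_jump. Qed.

Local Open Scope ring_scope.

Let lo : R := sval (cid (circ_surj x0)).
Let loE : x0 = circ lo. Proof. exact: svalP (cid (circ_surj x0)). Qed.

Let hiP : exists b, o w = circ b /\ lo < b < lo + 1.
Proof.
have [b [eb bi]] := circ_lift (o w) lo; exists b; split=> //.
have nb : lo != b.
  apply/eqP => e; have : o w == o 1%g by rewrite eb -e (oa_one OA) -loE.
  by rewrite o_inj (negPf w_neq1).
by rewrite lt_neqAle nb.
Qed.

Let hi : R := sval (cid hiP).
Let hiE : o w = circ hi. Proof. by case: (svalP (cid hiP)). Qed.
Let lohi : lo < hi < lo + 1. Proof. by case: (svalP (cid hiP)). Qed.

(** Subdivision of the gap after 1, with one piece for each of the [k.+1] prefixes of [w]. *)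
Let zpos i : R := lo + (hi - lo) * (i%:R / k.+1%:R).
Let z h i := rho h (circ (zpos i)).

Let zpos_lt i j : (i < j)%N -> zpos i < zpos j.
Proof.
move=> ij; have [h1 _] := andP lohi.
by rewrite /zpos ltrD2l ltr_pM2l ?subr_gt0 // ltr_pM2r ?ltr_nat // invr_gt0 ltr0n.
Qed.

Let zpos0 : zpos 0 = lo. Proof. by rewrite /zpos mul0r mulr0 addr0. Qed.
Let zposk : zpos k.+1 = hi.
Proof. by rewrite /zpos divff ?pnatr_eq0 // mulr1 addrC subrK. Qed.

Let z0 h : z h 0 = o h. Proof. by rewrite /z zpos0 -loE. Qed.
Let zk h : z h k.+1 = o (h * w)%g. Proof. by rewrite /z zposk -hiE (oa_mul OA). Qed.
Let z_mul f h i : z (f * h)%g i = rho f (z h i). Proof. by rewrite /z (oa_mul OA).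
  Qed.

Let zpos_itv i : (0 < i <= k.+1)%N -> lo < zpos i < lo + 1.
Proof.
move=> /andP[i0 ik]; have := zpos_lt i0; rewrite zpos0 => ->.
have : zpos i <= hi.
  by move: ik; rewrite leq_eqVlt -zposk => /orP[/eqP->//|/zpos_lt/ltW].
by have := lohi; rewrite /=; lra.
Qed.

Let z_cord h i j l : (i < j < l)%N -> (l <= k.+1)%N -> cord (z h i) (z h j) (z h l).
Proof.
move=> /andP[ij jl] lk; rewrite (oa_cord OA); apply: cord_circ.
- exact: zpos_lt.
- exact: zpos_lt.
have := zpos_itv (i := l); rewrite lk andbT => /(_ ltac:(lia)) zl.
have : lo <= zpos i.
  by rewrite -zpos0; case: (posnP i) => [->//|/zpos_lt/ltW].
lra.
Qed.

Let z_inj h i j : (i <= k.+1)%N -> (j <= k.+1)%N -> i != j -> z h i != z h j.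
Proof.
wlog ij : i j / (i < j)%N.
  move=> W ik jk; rewrite neq_ltn => /orP[ij|ij]; first by apply: W => //;
    rewrite neq_ltn ij.
  by rewrite eq_sym; apply: W => //; rewrite neq_ltn ij.
move=> ik jk _; have k0 := k_gt0.
have [j1|j1] := eqVneq j k.+1; last first.
  by have [] := corder_neq cc (z_cord h (i := i) (j := j) (l := k.+1) ltac:(lia)
    ltac:(lia)).
have [i0|i0] := eqVneq i 0%N.
  by have [] := corder_neq cc (z_cord h (i := i) (j := 1) (l := j) ltac:(lia)
    ltac:(lia)).
by have [] := corder_neq cc (z_cord h (i := 0) (j := i) (l := j) ltac:(lia)
  ltac:(lia)).
Qed.

Let z_gap h i : (0 < i < k.+1)%N -> gap h (z h i).
Proof. by move=> ik; rewrite /gap -z0 -zk; apply: z_cord; lia. Qed.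

Local Close Scope ring_scope.

(* h translates the i-th piece of the gap after 1 to a closed arc, which belongs
   to the domain of h * (take i w) *)
Let piece h i x := [|| x == z h i, x == z h i.+1 | cord (z h i) x (z h i.+1)].
Let inK g x := exists2 i, (i <= k)%N & piece (g * gg i)%g i x.

Let rho_inj f : injective (rho f).
Proof. by move=> x y e; rewrite -(oa_one OA x) -(mulVg f) (oa_mul OA) e -(oa_mul OA)
  mulVg (oa_one OA). Qed.

Let piece_mul f h i x : piece (f * h)%g i (rho f x) = piece h i x.
Proof. by rewrite /piece !z_mul !(inj_eq (@rho_inj f)) (oa_cord OA). Qed.

Let inK_mul f g x : inK (f * g)%g (rho f x) <-> inK g x.
Proof.
split=> -[i ik]; first by rewrite -mulgA piece_mul => px; exists i.
by move=> px; exists i => //; rewrite -mulgA piece_mul.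
Qed.

Let inK_inv s t x : inK t (rho s x) -> inK (s^-1 * t)%g x.
Proof. by move=> Kx; apply/(inK_mul s); rewrite mulVKg. Qed.

Let pieceP h i x : (i <= k)%N -> piece h i x ->
  [\/ x = o h /\ i = 0%N, x = o (h * w)%g /\ i = k | gap h x].
Proof.
move=> ik px; have [e0|e0] := eqVneq x (o h).
  constructor 1; split=> //; apply/eqP; rewrite -leqn0 leqNgt; apply/negP => i0.
  have := z_gap h (i := i); rewrite i0 ltnS ik => /(_ isT) gi.
  move: px; rewrite e0 -z0 /piece => /or3P[/eqP e|/eqP e|].
  - by move: gi; rewrite -e z0 => /gap_orbit.
  - by have := @z_inj h 0 i.+1 isT ltac:(lia) isT; rewrite e eqxx.
  - by have := @z_cord h 0 i i.+1 ltac:(lia) ltac:(lia);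
      corder_lia cc (z h 0) [:: z h i; z h i.+1].
have [e1|e1] := eqVneq x (o (h * w)%g).
  constructor 2; split=> //; apply/eqP; rewrite eqn_leq ik leqNgt; apply/negP => i0.
  move: px; rewrite e1 -zk /piece => /or3P[/eqP e|/eqP e|].
  - by have := @z_inj h k.+1 i ltac:(lia) ltac:(lia) ltac:(lia); rewrite e eqxx.
  - by have := @z_inj h k.+1 i.+1 ltac:(lia) ltac:(lia) ltac:(lia); rewrite e eqxx.
  - by have := @z_cord h i i.+1 k.+1 ltac:(lia) ltac:(lia);
      corder_lia cc (z h i) [:: z h k.+1; z h i.+1].
constructor 3; rewrite /gap; rewrite -z0 in e0 *; rewrite -zk in e1 *.
have [i0|i0] := eqVneq i 0%N; have [i1|i1] := eqVneq i k.
- by move: i1 k_gt0; rewrite i0 => <-.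
- have := @z_cord h 0 i.+1 k.+1 ltac:(lia) ltac:(lia); move: px;
    rewrite i0 /piece => + Z.
  by move: e0 e1 Z; corder_lia cc (z h 0) [:: x; z h 1; z h k.+1].
- have := @z_cord h 0 i k.+1 ltac:(lia) ltac:(lia); move: px;
    rewrite i1 /piece => + Z.
  by move: e0 e1 Z; corder_lia cc (z h 0) [:: x; z h k; z h k.+1].
have := @z_cord h 0 i i.+1 ltac:(lia) ltac:(lia);
  have := @z_cord h 0 i.+1 k.+1 ltac:(lia) ltac:(lia).
by move: px e0 e1; rewrite /piece; corder_lia cc (z h 0) [:: x; z h i; z h i.+1;
  z h k.+1].
Qed.

Let opiece h i x := cord (z h i) x (z h i.+1).

Let opiece_uniq h i m x : (i <= k)%N -> (m <= k)%N -> opiece h i x -> piece h m x ->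
  i = m.
Proof.
move=> ik mk ox px; apply/eqP; apply: contraT; rewrite neq_ltn => /orP[im|mi].
  have := @z_cord h i m m.+1 ltac:(lia) ltac:(lia).
  move: ox px; rewrite /opiece /piece; move: im; rewrite leq_eqVlt => /orP[/eqP->|im].
    by corder_lia cc (z h i) [:: z h m; z h m.+1; x].
  have := @z_cord h i i.+1 m ltac:(lia) ltac:(lia).
  by corder_lia cc (z h i) [:: z h i.+1; z h m; z h m.+1; x].
have := @z_cord h m i i.+1 ltac:(lia) ltac:(lia).
move: ox px; rewrite /opiece /piece; move: mi; rewrite leq_eqVlt => /orP[/eqP->|mi].
  by corder_lia cc (z h m) [:: z h i; z h i.+1; x].
have := @z_cord h m m.+1 i ltac:(lia) ltac:(lia).
by corder_lia cc (z h m) [:: z h m.+1; z h i; z h i.+1; x].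
Qed.

Let opiece_gap h i x : (i <= k)%N -> opiece h i x -> gap h x.
Proof.
move=> ik ox; have px : piece h i x by rewrite /piece -/(opiece h i x) ox !orbT.
have [[e i0]|[e i1]|//] := pieceP ik px.
  by move: ox; rewrite /opiece i0 e z0 => /(corder_neq cc)[]; rewrite eqxx.
by move: ox; rewrite /opiece i1 e zk => /(corder_neq cc)[_]; rewrite eqxx.
Qed.

Let gap_inK h x : gap h x -> exists g, inK g x.
Proof.
move=> hx; pose Q i := (0 < i)%N && ((x == z h i) || cord (z h 0) x (z h i)).
have exQ : exists i, Q i by exists k.+1; rewrite /Q z0 zk -/(gap h x) hx orbT.
have Qk : Q k.+1 by rewrite /Q z0 zk -/(gap h x) hx orbT.
case: (ex_minnP exQ) => -[|m] // /andP[_ Qm] mm.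
have mk : (m <= k)%N by have := mm _ Qk.
exists (h * (gg m)^-1)%g, m; rewrite // mulgVK /piece.
move: Qm => /orP[->|Qm]; first by rewrite orbT.
have [m0|m0] := posnP m; first by rewrite m0 in Qm *; rewrite Qm !orbT.
have : ~~ Q m by apply/negP => /mm; rewrite ltnn.
rewrite /Q m0 /= negb_or => /andP[n1 n2].
have : x != z h 0 by move: hx; rewrite z0 => /(corder_neq cc)[]; rewrite eq_sym.
have := @z_cord h 0 m m.+1 ltac:(clear -m0; lia) ltac:(clear -mk; lia).
by move: Qm n1 n2; corder_lia cc (z h 0) [:: x; z h m; z h m.+1].
Qed.

Let orbit_inK g : inK g (o g).
Proof. by exists 0%N => //; rewrite gg0 mulg1 /piece z0 eqxx. Qed.

(** The domains cover the orbit and all its gaps, so a point outside them is a limit of the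
    orbit. *)
Let not_inK x p p' : (forall g, ~ inK g x) -> cord p x p' ->
  exists g, cord p (o g) p'.
Proof.
move=> nK pxp; apply: contrapT => ng.
have [||g [h [gxh nl]]] := oa_gap OA (x := x).
- by move=> g e; apply: (nK g); rewrite -e; exact: orbit_inK.
- by exists p, p'; split=> // g; apply/negP => pg; apply: ng; exists g.
have gh : jump r g h.
  split; last by move=> l; rewrite (oa_rel OA).
  by apply/eqP => e; move: gxh; rewrite e => /(corder_neq cc)[_ _]; rewrite eqxx.
have : gap g x by rewrite /gap -(jumpE gh).
by move=> /gap_inK[l /nK].
Qed.

(* The open arcs from b i to a i are the interior of the domain of 1; the last
   piece of the gap before 1 and the first piece of the gap after 1 are merged
   into the arc with index 0, which contains the base point. *)
Let a i := z (gg i) i.+1.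
Let bi i := if i is 0%N then k else i.
Let b i := z (gg (bi i)) (bi i).

Let bi_le i : (i < k)%N -> (0 < bi i <= k)%N.
Proof. by case: i => [_|i ik] /=; [rewrite k_gt0 leqnn|exact: ltnW]. Qed.

Let bi_inj i j : (i < k)%N -> (j < k)%N -> bi i = bi j -> i = j.
Proof. by case: i j => [|i] [|j] //=; lia. Qed.

Let a_gap i : (i < k)%N -> gap (gg i) (a i).
Proof. by move=> ik; apply: z_gap. Qed.

Let b_gap i : (i < k)%N -> gap (gg (bi i)) (b i).
Proof. by move=> /bi_le ib; apply: z_gap; rewrite ltnS. Qed.

Let x0E : x0 = o 1%g. Proof. exact: esym (oa_one OA x0). Qed.

Let ggkw : (gg k * w = 1)%g. Proof. by rewrite ggk mulVg. Qed.

Let x0_mid : cord (b 0) x0 (a 0).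
Proof.
have h1 := b_gap k_gt0; have h2 := a_gap k_gt0.
have := o_jump 1%g (gg k); have := o_jump (gg k) w.
move: h1 h2; rewrite /gap /= ggkw gg0 mul1g -x0E.
by corder_lia cc x0 [:: b 0; a 0; o w; o (gg k)].
Qed.

Let inU_opiece i x : (i < k)%N -> cord (b i) x (a i) ->
  x = x0 \/ exists2 l, (l = i \/ l = bi i) & (l <= k)%N /\ opiece (gg l) l x.
Proof.
case: i => [|i] ik /= bxa; last by right; exists i.+1; [left|split=> //; exact: ltnW].
have [->|xx0] := eqVneq x x0; [by left|right].
have eb : b 0 = z (gg k) k by [].
have ea : a 0 = z 1 1%N by rewrite /a gg0.
have [x1|x1] := boolP (cord x0 x (a 0)).
  by exists 0%N; [left|split=> //; rewrite /opiece gg0 z0 -x0E -ea].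
exists k; [by right|split=> //]; rewrite /opiece zk ggkw -x0E -eb.
by move: x0_mid bxa x1 xx0; corder_lia cc x0 [:: b 0; a 0; x].
Qed.

Let opiece_inK l x : (l <= k)%N -> opiece (gg l) l x -> inK 1%g x.
Proof. by move=> lk ox; exists l;
  rewrite // mul1g /piece -/(opiece (gg l) l x) ox !orbT. Qed.

Let inU_inK x : inU (@cord R) k a b x -> inK 1%g x.
Proof.
move=> [i ik /(inU_opiece ik)[->|[l _ [lk ox]]]]; last exact: opiece_inK ox.
by rewrite x0E; exact: orbit_inK.
Qed.

(** An open piece determines its gap and its index there, hence the domain to which it belongs; the
    base point is treated separately. *)
Let inK_inU g x : inK g x -> inU (@cord R) k a b x -> g = 1%g.
Proof.
move=> [m mk px] [i ik /(inU_opiece ik) Ux].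
have K0 : piece (g * gg m) m x0 -> g = 1%g.
  have W h : x0 = o h -> h = 1 by move=> e; apply/eqP; rewrite -o_inj -e; apply/eqP.
  move=> /(pieceP mk)[[/W e m0]|[/W e mE]|].
  - by rewrite -e m0 gg0 mulg1.
  - by rewrite -e mE -mulgA ggkw mulg1.
  - by rewrite x0E => /gap_orbit.
case: Ux => [e|[l _ [lk ox]]]; first by rewrite e in px; exact: K0.
have xl := opiece_gap lk ox; case: (pieceP mk px) => [[e _]|[e _]|xm].
- by move: xl; rewrite e => /gap_orbit.
- by move: xl; rewrite e => /gap_orbit.
have e := gap_uniq xl xm; rewrite -e in px.
have lm := opiece_uniq lk mk ox px; rewrite lm in e.
by apply: (mulIg (gg m)); rewrite mul1g -e.
Qed.

Let ab i : (i < k)%N -> b i != a i.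
Proof.
case: i => [|i] ik; last by apply: z_inj => //; rewrite ?neq_ltn ?ltnS ?leqnn //; lia.
by have [_ _] := corder_neq cc x0_mid.
Qed.

Let seg_gap i x : (i < k)%N -> [|| x == b i, x == a i | cord (b i) x (a i)] ->
  [\/ x = x0, gap (gg i) x | gap (gg (bi i)) x].
Proof.
move=> ik /or3P[/eqP->|/eqP->|/(inU_opiece ik)[->|[l li [lk /(opiece_gap lk) lx]]]].
- by constructor 3; exact: b_gap.
- by constructor 2; exact: a_gap.
- by constructor 1.
by case: li => e; rewrite -e; [constructor 2|constructor 3].
Qed.

Let gap_x0 h : ~ gap h x0. Proof. by rewrite x0E; exact: gap_orbit. Qed.

Let disj_a i j : (i < k)%N -> (j < k)%N -> i != j ->
  [&& a j != b i, a j != a i & ~~ cord (b i) (a j) (a i)].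
Proof.
move=> ik jk ij; suff : ~~ [|| a j == b i, a j == a i | cord (b i) (a j) (a i)].
  by rewrite !negb_or.
apply/negP => /(seg_gap ik)[e|g1|g1].
- by have := a_gap jk; rewrite e => /gap_x0.
- by move/eqP: ij; apply; apply: gg_inj (gap_uniq g1 (a_gap jk)); apply: ltnW.
have /andP[i0 ik'] := bi_le ik.
have := gg_inj ik' (ltnW jk) (gap_uniq g1 (a_gap jk)).
by move: ij jk i0; case: (i) ik => [|i'] ? /= ? ? ? ?; lia.
Qed.

Let disj_b i j : (i < k)%N -> (j < k)%N -> i != j ->
  [&& b j != b i, b j != a i & ~~ cord (b i) (b j) (a i)].
Proof.
move=> ik jk ij; suff : ~~ [|| b j == b i, b j == a i | cord (b i) (b j) (a i)].
  by rewrite !negb_or.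
have /andP[j0 jk'] := bi_le jk; have /andP[i0 ik'] := bi_le ik.
apply/negP => /(seg_gap ik)[e|g1|g1].
- by have := b_gap jk; rewrite e => /gap_x0.
- have := gg_inj (ltnW ik) jk' (gap_uniq g1 (b_gap jk)).
  by move: ij ik jk j0; case: (j) => [|j'] /= ? ? ? ? ?; lia.
by move/eqP: ij; apply; apply: bi_inj => //; apply: gg_inj (gap_uniq g1 (b_gap jk)).
Qed.

Local Notation arc i := (arc_after (@cord R) k a b i).
Local Notation U := (inU (@cord R) k a b).

Let arc_U i x : (i < k)%N -> arc i x -> ~ U x.
Proof. by move=> ik; apply: (arc_after_inU cc disj_a). Qed.

Let arc_q i : (i < k)%N -> arc i (o (q i)).
Proof.
move=> ik j jk; apply/negP => abq; have ag := a_gap ik; have bg := b_gap jk.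
have gi : gap (gg i) (b j).
  by move: ag abq; rewrite /gap ggw; corder_lia cc (o (gg i)) [:: a i; b j; o (q i)].
have /andP[j0 jk'] := bi_le jk.
have ji := gg_inj jk' (ltnW ik) (gap_uniq bg gi).
case: j jk abq {bg gi} j0 jk' ji => [|j] jk abq j0 jk' /= ji; first by move: ik;
  rewrite -ji ltnn.
move: abq ag; rewrite -ji /gap ggw -(z0 (gg j.+1)).
have := @z_cord (gg j.+1) 0 j.+1 j.+2 ltac:(lia) ltac:(lia).
have -> : b j.+1 = z (gg j.+1) j.+1 by [].
have -> : a j.+1 = z (gg j.+1) j.+2 by [].
by corder_lia cc (z (gg j.+1) 0) [:: z (gg j.+1) j.+1; z (gg j.+1) j.+2; o (q j.+1)].
Qed.

(** The words are separated by a border, that is, by the gap after some [gg j]. It contains a point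
    [b], except when [j] is 0. *)
Let cut_point g h : g != 1%g -> initial g != initial h ->
  exists2 j, (j < k)%N & cord (o g) (b j) (o h).
Proof.
move=> g1 gh; have ghn : g != h by apply: contraNneq gh => ->.
have W x : (x == g) || r g x h -> forall y, cord (o x) y (o (x * w)%g) ->
  cord (o g) y (o h).
  move=> xg y xyw; have := o_jump x g; have := o_jump x h; move: xg xyw ghn.
  rewrite (oa_rel OA) -!o_inj.
  by corder_lia cc (o g) [:: o x; o h; y; o (x * w)%g].
have [x [y [bxy xg]]] := Sep gh; have [j jk [xj yj]] := borderE bxy.
have {}xg : (x == g) || r g x h by case: xg => ->; rewrite ?eqxx ?orbT.
have bW j' : (j' < k)%N -> (gg (bi j') == g) || r g (gg (bi j')) h ->
    exists2 j, (j < k)%N & cord (o g) (b j) (o h).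
  by move=> j'k xg'; exists j' => //; apply: W xg' _ _; exact: b_gap.
case: j jk xj yj => [|j] jk xj yj; last first.
  have [jk'|jk'] := ltnP j.+1 k; first by apply: (bW j.+1) => //; rewrite -xj.
  by apply: (bW 0%N) => //; rewrite /= (_ : k = j.+1) -?xj //; apply/eqP;
    rewrite eqn_leq jk jk'.
(* For the gap after 1, the point [b 0] of the gap ending at 1 is used; that gap starts at or after
   [g], because [g] is not 1. *)
apply: (bW 0%N) => //=; rewrite gg0 in xj; rewrite xj in xg.
have rg1 : r g 1 h by move: xg; rewrite eq_sym (negPf g1).
have := o_jump (gg k) g; rewrite ggkw -(ggkw).
rewrite ggkw; move: rg1; rewrite !(oa_rel OA) -!o_inj => rg1 nj.
have : o (gg k) != o 1%g by rewrite o_inj -ggkw hw_neq.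
by move: rg1 nj; corder_lia cc (o g) [:: o (gg k); o 1%g; o h].
Qed.

(** A different first letter would put some [b j] between [o g] and [o (q i)], whereas both lie in
    the arc starting at [a i]. *)
Let arc_initial i g : (i < k)%N -> arc i (o g) -> initial g = initial (q i).
Proof.
move=> ik Ag; apply/eqP; apply: contraT => cg.
have Aq := arc_q ik; have qn := q_neq1 ik.
have gn : g != 1%g.
  apply/eqP => e; apply: (arc_U ik Ag); exists 0%N => //; rewrite e -x0E;
    exact: x0_mid.
have na h : a i != o h by apply/eqP => e; have := a_gap ik; rewrite e => /gap_orbit.
have gq : o g != o (q i) by rewrite o_inj; apply: contraNneq cg => ->.
have [c1|c1] := boolP (cord (a i) (o g) (o (q i))).
  have [j jk bj] := cut_point gn cg; move: (Aq j jk) c1 bj.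
  by corder_lia cc (a i) [:: o g; o (q i); b j].
rewrite eq_sym in cg; have [j jk bj] := cut_point qn cg;
  move: (Ag j jk) c1 bj (na g) (na (q i)) gq.
by corder_lia cc (a i) [:: o g; o (q i); b j].
Qed.

(** The words [h * (gg i)^-1] form a path in the Cayley graph; avoiding 1, it stays in one
    branch. *)
Let initial_path (h : G) l m : (l <= m <= k)%N ->
  (forall i, (l <= i <= m)%N -> h * (gg i)^-1 != 1)%g ->
  initial (h * (gg l)^-1)%g = initial (h * (gg m)^-1)%g.
Proof.
move=> /andP[lm mk] nz; elim: m lm mk nz => [|m IH] lm mk nz.
  by move: lm; rewrite leqn0 => /eqP->.
move: lm; rewrite leq_eqVlt => /orP[/eqP->//|lm].
rewrite IH //; [|exact: ltnW|by move=> i il; apply: nz; lia].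
have [t /gg_step e] := cl_q mk.
have e' : (h * (gg m.+1)^-1 = h * (gg m)^-1 * gen t)%g.
  by rewrite e (invgM (gen t)) -mulgA mulgVK.
by rewrite e' initial_edge // -?e'; apply: nz; lia.
Qed.

(** If [x] lies in a gap, one end of the gap lies in the same arc, on the side of [q i]. The words
    owning the pieces from [x] to that end form a path avoiding 1, so [g] has the first letter of
    that end. *)
Let arc_inK i g x : (i < k)%N -> arc i x -> inK g x ->
  g = 1%g \/ initial g = initial (q i).
Proof.
move=> ik Ax [m mk px]; have [g1|g1] := eqVneq g 1%g; [by left|right].
set h := (g * gg m)%g in px.
have gE : g = (h * (gg m)^-1)%g by rewrite /h mulgK.
case: (pieceP mk px) => [[e m0]|[e mE]|hx].
- by rewrite gE m0 gg0 invg1 mulg1; apply: arc_initial => //; rewrite -e.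
- by rewrite gE mE ggk invgK; apply: arc_initial => //; rewrite -e.
have Aq := arc_q ik.
have xq : x != o (q i) by apply/eqP => e; move: hx; rewrite e => /gap_orbit.
have na l : a i != o l by apply/eqP => e; have := a_gap ik; rewrite e => /gap_orbit.
have oh : o h != o (h * w)%g by rewrite o_inj hw_neq.
have blE l : (0 < l < k)%N -> b l = z (gg l) l by case: l.
have [c1|c1] := boolP ((x == a i) || cord (a i) x (o (q i))).
  have Ahw : arc i (o (h * w)%g).
    move=> j jk; move: (Aq j jk) c1 hx (o_jump h (q i)) xq.
    by rewrite /gap; corder_lia cc x [:: a i; o h; o (h * w)%g; o (q i); b j].
  have cw := arc_initial ik Ahw; rewrite gE -cw -[in RHS](invgK w) -ggk.
  apply: initial_path; first by rewrite mk leqnn.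
  move=> l; rewrite leq_eqVlt => /andP[/orP[/eqP<- _|ml lk]]; first by rewrite -gE.
  (* A visit of the path to 1 would put a point [b l] between [x] and the end of the gap, inside the
     arc; at the end itself it would contradict the first letter. *)
  apply/eqP => e; have hl : h = gg l by apply: (mulIg (gg l)^-1); rewrite e mulgV.
  move: lk; rewrite leq_eqVlt => /orP[/eqP lk|lk].
    by have [t E] := cl_q ik; move: cw; rewrite hl lk ggkw E.
  have bl := blE l ltac:(clear -ml lk; lia).
  have : (x == b l) || cord x (b l) (o (h * w)%g).
    rewrite bl -hl -zk; move: px; rewrite /piece.
    have := @z_cord h m l k.+1 ltac:(clear -ml lk; lia) ltac:(clear; lia).
    have [->|ml'] := eqVneq l m.+1; first by corder_lia cc (z h m) [:: z h m.+1;
      z h k.+1; x].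
    have := @z_cord h m m.+1 l ltac:(clear -ml ml'; lia) ltac:(clear -lk; lia).
    by corder_lia cc (z h m) [:: z h m.+1; z h l; z h k.+1; x].
  have abl : a i != b l.
    by have [->|li] := eqVneq l i; [rewrite eq_sym ab|have /and3P[] := disj_a lk ik
      li].
  move: (Aq l lk) c1 hx (o_jump h (q i)) xq abl.
  by rewrite /gap; corder_lia cc x [:: a i; o h; o (h * w)%g; o (q i); b l].
have Ah : arc i (o h).
  move=> j jk; move: (Ax j jk) c1 hx (o_jump h (q i)) xq (na (q i)) (na h).
  by rewrite /gap; corder_lia cc x [:: a i; o h; o (h * w)%g; o (q i); b j].
have ch := arc_initial ik Ah; rewrite gE -ch -[in RHS](mulg1 h) -[in RHS]invg1 -gg0.
apply/esym/initial_path; first by rewrite mk.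
move=> l /andP[_]; rewrite leq_eqVlt => /orP[/eqP->|lm]; first by rewrite -gE.
apply/eqP => e; have hl : h = gg l by apply: (mulIg (gg l)^-1); rewrite e mulgV.
have [l0|l0] := posnP l.
  by have [t E] := cl_q ik; move: ch; rewrite hl l0 gg0 E.
have lk : (l < k)%N by exact: leq_trans lm mk.
have bl := blE l ltac:(clear -l0 lk; lia).
have : cord (o h) (b l) x.
  rewrite bl -hl -z0; move: px hx; rewrite /piece /gap -z0 -zk.
  have := @z_cord h 0 l m ltac:(clear -l0 lm; lia) ltac:(clear -mk; lia).
  have := @z_cord h l m m.+1 ltac:(clear -lm; lia) ltac:(clear -mk; lia).
  have := @z_cord h 0 m m.+1 ltac:(clear -l0 lm; lia) ltac:(clear -mk; lia).
  by corder_lia cc (z h 0) [:: z h l; z h m; z h m.+1; z h k.+1; x].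
move: (Ax l lk) c1 hx (o_jump h (q i)) xq (na (q i)) (na h).
by rewrite /gap; corder_lia cc x [:: a i; o h; o (h * w)%g; o (q i); b l].
Qed.

Let arc_closed_arc i : (i < k)%N -> exists p : R * R,
  (p.1 < p.2 < p.1 + 1)%R /\ forall x, closed_arc p x <-> arc i x.
Proof.
move=> ik; have [m mk [abm arcE]] := arc_afterE cc k_gt0 ab disj_a ik.
have [u eu] := circ_surj (a i); have [v [ev uv]] := circ_lift (b m) u.
have {}uv : (u < v < u + 1)%R.
  case/andP: uv => uv ->; rewrite andbT lt_neqAle uv andbT.
  by apply: contraNneq abm => e; rewrite eu ev e.
by exists (u, v); split=> // x; rewrite closed_arcE // -eu -ev arcE.
Qed.

Let D (s : letter n) : set (circle R) :=
  [set x | exists2 i, (i < k)%N & initial (q i) = Some s /\ arc i x]%classic.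

Let D_arcs s : finite_union_of_closed_arcs (D s).
Proof.
have W (l : seq nat) : (forall i, i \in l -> i < k)%N -> finite_union_of_closed_arcs
    [set x | exists2 i, i \in l & arc i x]%classic.
  elim: l => [|i l IH] lk.
    by exists [::] => //; apply/seteqP; split=> x [].
  have [|L LP LE] := IH; first by move=> j jl; apply: lk; rewrite inE jl orbT.
  have [p [pP pE]] := arc_closed_arc (lk i (mem_head _ _)).
  exists (p :: L); first by move=> p'; rewrite inE => /orP[/eqP->|/LP].
  apply/seteqP; split=> x.
    move=> [j]; rewrite inE => /orP[/eqP->|jl] jx.
      by exists p; [exact: mem_head|apply/pE].
    have : [set x | exists2 i, i \in l & arc i x]%classic x by exists j.
    by rewrite LE => -[p' p'L p'x]; exists p' => //=;
      rewrite inE (p'L : is_true (p' \in L)) orbT.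
  move=> [p' /=]; rewrite inE => /orP[/eqP->|p'L] p'x.
    by exists i; [exact: mem_head|apply/pE].
  have : (\bigcup_(p in [set` L]) closed_arc p)%classic x by exists p'.
  by rewrite -LE => -[j jl jx]; exists j => //; rewrite inE jl orbT.
have -> : D s = [set x | exists2 i,
  i \in [seq i <- iota 0 k | initial (q i) == Some s] & arc i x]%classic.
  apply/seteqP; split=> x [i].
    by move=> ik [ci ix]; exists i => //; rewrite mem_filter ci eqxx mem_iota.
  by rewrite mem_filter mem_iota => /andP[/eqP ci /andP[_ ik]] ix; exists i.
by apply: W => i; rewrite mem_filter mem_iota => /andP[_ /andP[_ ]].
Qed.

Let D_triv : trivIset setT D.
Proof.
move=> s t _ _ [x [[i ik [ci ix]] [j jk [cj jx]]]].
have ij := arc_after_uniq cc ab disj_a ik jk ix jx.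
by move: cj; rewrite -ij ci => -[].
Qed.

Let D_inK s g x : inK g x -> initial g = Some s -> D s x.
Proof.
move=> Kx cg; have [/(inK_inU Kx) g1|[j jk jx]] := arc_cover cc k_gt0 disj_a x.
  by rewrite g1 in cg.
exists j => //; split=> //; have [g1|<-//] := arc_inK jk jx Kx.
by rewrite g1 in cg.
Qed.

Let D_base : (~` \bigcup_s D s)%classic x0.
Proof.
move=> [s _ [i ik [_ ix]]]; apply: (arc_U ik ix).
by exists 0%N => //; exact: x0_mid.
Qed.

Let rhoVK s x : rho s (rho s^-1 x) = x.
Proof. by rewrite -(oa_mul OA) mulgV (oa_one OA). Qed.

(** Were [y] in a domain of a word not starting with [s], then [x] would be in the domain of a word
    starting with [s^-1]. So [y] lies in a complementary arc, and if that arc has another letter, in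
    no domain at all; then [y] is a limit of orbit points. *)
Let D_ping s : (rho (gen s) @` (~` D (letter_inv s)) `<=` D s)%classic.
Proof.
move=> _ [x nDx <-]; set y := rho (gen s) x.
have cinv g : initial g <> Some s -> initial ((gen s)^-1 * g) = Some (letter_inv s).
  by move=> gs; rewrite -gen_inv initial_mulS // letter_invK; apply/eqP.
have notK g : initial g <> Some s -> ~ inK g y.
  by move=> gs /inK_inv Kx; apply: nDx; apply: D_inK Kx _; exact: cinv.
have [Uy|[i ik iy]] := arc_cover cc k_gt0 disj_a y.
  by case: (notK 1) => //; exact: inU_inK.
exists i => //; split=> //; apply: contrapT => ci.
have nK g : ~ inK g y.
  move=> Ky; case: (arc_inK ik iy Ky) => cg; apply: notK Ky; rewrite cg //.
have [m mk [abm arcE]] := arc_afterE cc k_gt0 ab disj_a ik.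
have Ka j : (j < k)%N -> inK 1 (a j).
  by move=> jk; exists j; [exact: ltnW|rewrite mul1g /piece eqxx orbT].
have Kb j : (j < k)%N -> inK 1 (b j).
  by move=> /bi_le/andP[_ jk]; exists (bi j); rewrite // mul1g /piece eqxx.
have ayb : cord (a i) y (b m).
  have /or3P[/eqP e|/eqP e|//] : [|| y == a i,
    y == b m | cord (a i) y (b m)] by apply/arcE.
    by case: (nK 1); rewrite e; exact: Ka.
  by case: (nK 1); rewrite e; exact: Kb.
(* Orbit points near [y] lie in the arc, so they do not start with [s]; pulled back by [s] they lie
   in [D (letter_inv s)], though a neighbourhood of [x] avoids this closed set. *)
have [p [p' [pxp pD]]] := nbhs_arcP (arcs_closed (D_arcs (letter_inv s)) nDx).
have pyp : cord (rho (gen s) p) y (rho (gen s) p') by rewrite (oa_cord OA).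
have [u [u' [uyu uP]]] := nbhs_arcP (filterI (nbhs_arc ayb) (nbhs_arc pyp)).
have [g /uP[/= ga gp]] := not_inK nK uyu.
have cg : initial g = initial (q i) by apply: arc_initial => //; apply/arcE;
  rewrite ga !orbT.
have : cord p (o ((gen s)^-1 * g)) p'.
  by rewrite -(oa_cord OA (gen s)) (oa_mul OA) rhoVK.
move/pD; apply; apply: D_inK (orbit_inK _) _; apply: cinv; by rewrite cg.
Qed.

Lemma pingpong_exists : exists D : letter n -> set (circle R),
  [/\ forall s, finite_union_of_closed_arcs (D s), trivIset setT D,
      (forall s, rho (gen s) @` (~` D (letter_inv s)) `<=` D s)%classic
    & (~` \bigcup_s D s)%classic x0].
Proof. by exists D. Qed.

End Domains.

(** * The equivalence *)

Local Open Scope classical_set_scope.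

Theorem theorem1p5 (R : realType) (n : nat)
    (c : {ptws free_group n * free_group n * free_group n ->
          discrete_topology sign3})
    (rho : free_group n -> circle R -> circle R) (x0 : circle R) :
  CO (free_group n) c -> dynamical_realization c rho x0 ->
  (isolated (CO (free_group n)) c <->
  exists D : letter n -> set (circle R),
    [/\ forall s, finite_union_of_closed_arcs (D s),
        trivIset setT D,
        forall s, rho (generator s) @` (~` D (letter_inv s)) `<=` D s
      & (~` \bigcup_s D s) x0]).
Proof.
move=> C real; rewrite isolatedP //.
(* Without generators the group is trivial: it has a single order, and there are no domains to
   find. *)
have [n0|n_gt0] := posnP n.
  subst n; split=> _; last first.
    exists [::] => r' H' _ x y z; have xy : x = y.
      by apply: word_inj; case: (word x) (word y) => [|[[]]//] [|[[]]].
    rewrite xy; apply/idP/idP => [/(corder_neq (gorder_co H'))[]|];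
      rewrite ?eqxx //.
    by move/(corder_neq (gorder_co (co_rel_gorder C))) => []; rewrite eqxx.
  by exists (fun=> set0); split=> [[[]]|[[]]|[[]]|[[[]]]].
have OA := realization_action n_gt0 C real; have H := oa_order OA.
split=> [[S HS]|[D [D_arcs D_triv D_ping D_base]]]; last first.
  apply: (jump_separated_rigid H).
  by apply: (pingpong_jump_separated OA _ D_triv D_ping D_base) => s y; exact: arcs_closed.
(* The successor makes the radius positive, so that the ball contains the letters. *)
pose N := (\max_(g <- S) len g).+1.
have sep : jump_separated (co_rel c).
  apply: (@determined_jump_separated _ _ N) => // r' H' agree; apply: HS => //.
  have SN g : g \in S -> g \in ball n N.
    move=> gS; rewrite mem_ball; apply: leqW.
    exact: (@leq_bigmax_seq _ S xpredT (@len n)).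
  by move=> x y z xS yS zS; apply: agree; exact: SN.
have [F [F_border [F0|[w w_border _]]]] := border_list H; last first.
  exact: (pingpong_exists OA sep w_border).
(* The words 1 and [a_1] have different first letters, so a border exists and [F] is not empty. *)
have initial_gen1 : initial (1%g : free_group n) != initial (generator (Ordinal n_gt0, false)) by [].
have [x [y [b _]]] := sep _ _ initial_gen1.
have : x \in F by apply/F_border; left; exists y.
by rewrite F0.
Qed.
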